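(* For $\zeta=(\beta,\eta,\omega,E_F)$ with $\beta,\eta>0$ and $\omega,E_F\in\mathbb R$, let $c_{k_1k_2}$ be the Chebyshev coefficients of $F_\zeta$. There exist $\alpha_{\mathrm{diag}}(\zeta)>0$ and $\alpha_{\mathrm{anti}}(\zeta)\ge0$ such that $$|c_{k_1k_2}|\le C(\zeta)\exp\bigl[-\alpha_{\mathrm{diag}}(\zeta)(k_1+k_2)-\alpha_{\mathrm{anti}}(\zeta)|k_1-k_2|\bigr]$$ for some $C(\zeta)<\infty$ independent of $k_1,k_2$. In the limit $\beta\to\infty$, $\omega,\eta\to0$ with $|\omega|\lesssim\eta$, and assuming $E_F\in(-1,1)$, we have that $$\alpha_{\mathrm{diag}}(\zeta)=\begin{cases}\Theta(\eta)&\text{if $\zeta$ is relaxation- or mixed-constrained},\\ \Theta(\beta^{-1})&\text{if $\zeta$ is temperature-constrained},\end{cases}$$ $$\alpha_{\mathrm{anti}}(\zeta)=\begin{cases}\Theta(\eta^{1/2})&\text{if $\zeta$ is relaxation-constrained},\\ \mathcal O(\beta^{-1})&\text{if $\zeta$ is mixed-constrained},\\ 0&\text{if $\zeta$ is temperature-constrained},\end{cases}$$ and $$\begin{cases}\beta\lesssim\eta^{-1/2}&\text{if $\zeta$ is relaxation-constrained},\\ \eta^{-1/2}\lesssim\beta\lesssim\eta^{-1}&\text{if $\zeta$ is mixed-constrained},\\ \eta^{-1}\lesssim\beta&\text{if $\zeta$ is temperature-constrained}.\end{cases}$$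
   Context: **Conductivity function.** $f_\beta(E)=(1+e^{\beta E})^{-1}$ and $F_\zeta(E_1,E_2)=\dfrac{f_\beta(E_1-E_F)-f_\beta(E_2-E_F)}{(E_1-E_2)(E_1-E_2+\omega+i\eta)}$ (extended by continuity to $E_1=E_2$). Its Chebyshev coefficients are defined by $F_\zeta(E_1,E_2)=\sum_{k_1,k_2\ge0}c_{k_1k_2}T_{k_1}(E_1)T_{k_2}(E_2)$ on $[-1,1]^2$, $T_k$ the Chebyshev polynomials of the first kind. **Notation.** $f=\mathcal O(g)$ means $\limsup|f|/|g|<\infty$; $f=\Theta(g)$ means $\limsup f/g<\infty$ and $\liminf f/g>0$ (signed) in the stated limit; $\lesssim$ means inequality up to a positive constant in the stated limit. **Parameter function.** For a curve $b\subset\mathbb C$ connecting $-1$ and $1$, $\alpha_b(x)=\log\bigl|x+\sqrt[b]{x^2-1}\bigr|$, where $\sqrt[b]{x^2-1}$ is the branch of $\sqrt{x^2-1}$ with branch cut $b$ and sign such that $x+\sqrt[b]{x^2-1}\to\infty$ as $x\to\infty$. The Bernstein ellipse is $E(\alpha)=\{x\in\mathbb C:\alpha_{[-1,1]}(x)<\alpha\}=\{\cosh\tilde\alpha\cos\theta+i\sinh\tilde\alpha\sin\theta:\tilde\alpha\in[0,\alpha),\theta\in[0,2\pi)\}$. The notation $x+0i$ means the limit from above (positive imaginary direction), relevant when $x$ lies on the branch cut. **Classification of $\zeta$.** Let $$\alpha_{\max}(\zeta)=\min\bigl\{\alpha_{[-1,1]}(1-|\omega|+i\eta),\ \alpha_{[-1,1]}(E_F+\tfrac{\pi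 i}{\beta})\bigr\},$$ $$D(\zeta)=\bigl(E(\alpha_{\max}(\zeta))+\omega+i\eta\bigr)\cap\{x\in\mathbb C:\operatorname{Im}x\le0\},$$ $$b^\star(\zeta)=\bigl([-1,1]\setminus D(\zeta)\bigr)\cup\{x\in\partial D(\zeta):\operatorname{Im}x<0\},$$ $$x^\star(\zeta)=\operatorname*{arg\,min}_{x\in\partial E(\alpha_{\max}(\zeta))+\omega+i\eta}\alpha_{b^\star(\zeta)}(x+0i).$$ $\zeta$ is called *relaxation-constrained* if $\alpha_{[-1,1]}(1-|\omega|+i\eta)\le\alpha_{[-1,1]}(E_F+\tfrac{\pi i}\beta)$; *temperature-constrained* if $\alpha_{[-1,1]}(E_F+\tfrac{\pi i}\beta)\le\alpha_{b^\star(\zeta)}(x^\star(\zeta)+0i)$; *mixed-constrained* otherwise. *)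

(* Defs.v *)
From Stdlib Require Import Reals ClassicalEpsilon.
From Coquelicot Require Import Coquelicot.
Open Scope R_scope.

Record parameters : Type := mk_parameters {
  beta : R;   (* inverse temperature *)
  eta : R;    (* inverse relaxation time *)
  omega : R;  (* frequency *)
  EF : R      (* Fermi level *)
}.

(** * The conductivity function and its Chebyshev coefficients *)

Definition fermi (b E : R) : R := / (1 + exp (b * E)).

Definition shift (z : parameters) : C := (omega z, eta z).

(* On the diagonal the difference quotient of [E => fermi b (E - EF)] is
   extended by its limit, the derivative. *)
Definition F_cond (z : parameters) (E1 E2 : R) : C :=
  let f := fun E => fermi (beta z) (E - EF z) in
  let quotient :=
    if Req_EM_T E1 E2 then Derive f E1 else (f E1 - f E2) / (E1 - E2) in
  (RtoC quotient / (RtoC E1 - RtoC E2 + shift z))%C.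

Fixpoint chebyshev_T (k : nat) (x : R) : R :=
  match k with
  | O => 1
  | S k' =>
    match k' with
    | O => x
    | S k'' => 2 * x * chebyshev_T k' x - chebyshev_T k'' x
    end
  end.

Definition chebyshev_sum (c : nat -> nat -> C) (N : nat) (E1 E2 : R) : C :=
  sum_n (fun k1 => sum_n (fun k2 =>
    (c k1 k2 * RtoC (chebyshev_T k1 E1) * RtoC (chebyshev_T k2 E2))%C) N) N.

(* [F E1 E2 = \sum_(k1, k2) c k1 k2 * T_k1 E1 * T_k2 E2] on [-1,1]^2.  The
   square partial sums are required to converge uniformly, which absolute
   convergence on [-1,1]^2 implies; by orthogonality such a [c] is unique. *)
Definition chebyshev_coefficients (F : R -> R -> C) (c : nat -> nat -> C)
    : Prop :=
  forall eps : R, 0 < eps ->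
  exists N0 : nat, forall N : nat, (N0 <= N)%nat ->
  forall E1 E2 : R, -1 <= E1 <= 1 -> -1 <= E2 <= 1 ->
    Cmod (chebyshev_sum c N E1 E2 - F E1 E2)%C <= eps.

(** * Branches of [sqrt (x^2 - 1)] and the parameter function *)

(* On the cut [b] itself only the sign of the root is left unspecified. *)
Definition is_sqrt_branch (b : C -> Prop) (g : C -> C) : Prop :=
  (forall x : C, (g x * g x = x * x - 1)%C) /\
  (forall x : C, ~ b x -> continuous (T := C_UniformSpace)
                                     (U := C_UniformSpace) g x) /\
  (forall M : R, exists N : R, forall x : C,
     N < Cmod x -> M < Cmod (x + g x)%C).

Definition sqrt_branch (b : C -> Prop) : C -> C :=
  epsilon (inhabits (fun _ : C => RtoC 0)) (is_sqrt_branch b).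

Definition alpha (b : C -> Prop) (x : C) : R :=
  ln (Cmod (x + sqrt_branch b x)%C).

(* [alpha_above b x] is the limit written alpha_b(x + 0i). *)
Definition alpha_above (b : C -> Prop) (x : C) : R :=
  lim (filtermap (fun t : R => alpha b (x + (0, t))%C) (at_right 0)).

Definition segment (x : C) : Prop := -1 <= Re x <= 1 /\ Im x = 0.

Definition bernstein (a : R) (x : C) : Prop := alpha segment x < a.

Definition boundary (A : C -> Prop) (x : C) : Prop :=
  ~ locally (T := C_UniformSpace) x A /\
  ~ locally (T := C_UniformSpace) x (fun y => ~ A y).

Definition translate (s : C) (A : C -> Prop) (x : C) : Prop := A (x - s)%C.

(** * Classification of the parameters *)

Definition alpha_relaxation (z : parameters) : R :=
  alpha segment ((1 - Rabs (omega z))%R, eta z).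

Definition alpha_temperature (z : parameters) : R :=
  alpha segment (EF z, (PI / beta z)%R).

Definition alpha_max (z : parameters) : R :=
  Rmin (alpha_relaxation z) (alpha_temperature z).

Definition D_set (z : parameters) (x : C) : Prop :=
  translate (shift z) (bernstein (alpha_max z)) x /\ Im x <= 0.

Definition b_star (z : parameters) (x : C) : Prop :=
  (segment x /\ ~ D_set z x) \/ (boundary (D_set z) x /\ Im x < 0).

Definition is_arg_min (A : C -> Prop) (f : C -> R) (x : C) : Prop :=
  A x /\ forall y : C, A y -> f x <= f y.

(* Minimizers need not be unique; only the minimal value is used below. *)
Definition x_star (z : parameters) : C :=
  epsilon (inhabits (RtoC 0))
    (is_arg_min
       (translate (shift z) (boundary (bernstein (alpha_max z))))
       (alpha_above (b_star z))).

Definition relaxation_constrained (z : parameters) : Prop :=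
  alpha_relaxation z <= alpha_temperature z.

Definition temperature_constrained (z : parameters) : Prop :=
  alpha_temperature z <= alpha_above (b_star z) (x_star z).

Definition mixed_constrained (z : parameters) : Prop :=
  ~ relaxation_constrained z /\ ~ temperature_constrained z.

(** * Asymptotic notation *)

(* beta -> infinity, omega -> 0, eta -> 0 through positive values, subject to
   [Rabs omega <= K * eta], at fixed Fermi level [e]. *)
Definition low_temperature_limit (e K : R) (P : parameters -> Prop) : Prop :=
  exists b0 d : R, 0 < d /\
  forall z : parameters,
    EF z = e -> b0 < beta z -> 0 < eta z < d -> Rabs (omega z) < d ->
    Rabs (omega z) <= K * eta z -> P z.

(* [limsup |f|/|g| < oo] along [L]. *)
Definition is_bigO (L : (parameters -> Prop) -> Prop) (f g : parameters -> R)
    : Prop :=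
  exists M : R, L (fun z => Rabs (f z) / Rabs (g z) <= M).

(* [limsup f/g < oo] and [liminf f/g > 0] along [L]. *)
Definition is_bigTheta (L : (parameters -> Prop) -> Prop)
    (f g : parameters -> R) : Prop :=
  exists m M : R, 0 < m /\ L (fun z => m <= f z / g z <= M).

Definition is_lesssim (L : (parameters -> Prop) -> Prop)
    (f g : parameters -> R) : Prop :=
  exists M : R, 0 < M /\ L (fun z => f z <= M * g z).

(* Main.v *)
(** Idea. Let [psi y] be the root of [p^2 - 2 y p + 1] in the unit disc. The
    [k1]-th Chebyshev coefficient in [E1] of [1 / (E1 - E2 + s)], with
    [s = omega + i eta], is up to a constant [psi(E2 - s)^(k1+1)] divided by
    [1 - psi(E2 - s)^2]. To expand it in [E2 = cos w] with [k2 <= k1], shift [w] from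
    [0, pi] to [i T + [0, pi]] with [T] of order [sqrt eta]: there
    [|psi(cos w - s)| <= exp (- (Im w + 2 d))] with [d] of order [eta], and on the
    vertical sides, where [cos w] is real, also [|psi(cos w - s)| <= exp (- T)]. This
    is the decay [exp (- 2 d k2 - T (k1 - k2))]; the case [k1 < k2] follows by symmetry.
    The contour shift is done on Riemann sums, i.e. on the discrete Chebyshev
    coefficients at Gauss nodes, so that neither integrals nor Fourier inversion is
    needed.

    The difference quotient of the Fermi function is the uniform limit of sums over
    [j < N] of [zeta_j / (beta (y_j - E1) (y_j - E2))], the partial fraction expansion
    obtained by replacing [exp u] with [(1 + u / N)^N]. Multiplication by
    [1 / (y_j - E)] preserves the weighted bound, at a cost [|psi y_j|], and the sum of
    the [|psi y_j|^2] is bounded uniformly in [N].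

    For the classification, the root [g] of [x^2 - 1] with cut [b_star] satisfies
    [ln |x + g x| = A x] in the upper half plane and [- A x] in the region between the
    segment and the flipped arc, [A] being the parameter of the Bernstein ellipse
    through [x]. Hence [alpha_above b_star] is [A] or [- A] on the shifted ellipse
    according to the sign of [Im x], and testing at the bottom of the ellipse shows that
    [alpha_temperature] is of order at most [eta] when [z] is temperature-constrained. *)
Require Import Defs.
From Stdlib Require Import Reals Lra Lia ClassicalEpsilon Ranalysis5.
From Coquelicot Require Import Coquelicot.
Open Scope R_scope.

(** * Finite sums *)

(** For [k2 <= k1] one has [2 d k2 + T (k1 - k2) = d (k1 + k2) + (T - d) (k1 - k2)], whence the
    antidiagonal rate [T - d]. Two conditions limit [T]. Near the ends of the segment, the bounds on
    [psi (cos w - s)] need [T^2 (eta + |omega|)] to be small against [eta^2], which for [|omega|] of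
    order at most [eta] allows [T] of order [sqrt eta]. Multiplication by [T_k] costs a factor
    [exp (T k)] in the weight, so the poles of the Fermi function must satisfy
    [|psi y_j| < exp (- T)], which allows [T] of order [1 / beta]. The rates are minima of such
    explicit quantities and are not read off from [alpha_max]; the classification enters through
    comparisons of [eta], [sqrt eta] and [1 / beta], and through the switch in [anti_rate]. Neither
    the Chebyshev series nor the Fermi function is treated exactly: discrete coefficients are exact
    on polynomials of low degree and controlled by the sup norm uniformly in the number of nodes, so
    weighted bounds survive uniform limits with the same constant. *)

Fixpoint csum (f : nat -> C) (n : nat) : C :=
  match n with O => 0%C | S m => (csum f m + f m)%C end.

Fixpoint rsum (f : nat -> R) (n : nat) : R :=
  match n with O => 0 | S m => rsum f m + f m end.

Lemma csum_ext (f g : nat -> C) (n : nat) :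
  (forall i, (i < n)%nat -> f i = g i) -> csum f n = csum g n.
Proof.
  induction n as [|n IH]; simpl; intros H; [reflexivity|].
  rewrite IH, (H n); auto.
Qed.

Lemma csum_plus (f g : nat -> C) (n : nat) :
  csum (fun i => f i + g i)%C n = (csum f n + csum g n)%C.
Proof. induction n as [|n IH]; simpl; [ring|]. rewrite IH; ring. Qed.

Lemma csum_minus (f g : nat -> C) (n : nat) :
  csum (fun i => f i - g i)%C n = (csum f n - csum g n)%C.
Proof. induction n as [|n IH]; simpl; [ring|]. rewrite IH; ring. Qed.

Lemma csum_scal (a : C) (f : nat -> C) (n : nat) :
  csum (fun i => a * f i)%C n = (a * csum f n)%C.
Proof. induction n as [|n IH]; simpl; [ring|]. rewrite IH; ring. Qed.

Lemma csum_zero (n : nat) : csum (fun _ => 0%C) n = 0%C.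
Proof. induction n as [|n IH]; simpl; [ring|]. rewrite IH; ring. Qed.

Lemma csum_swap (f : nat -> nat -> C) (n m : nat) :
  csum (fun i => csum (f i) m) n = csum (fun j => csum (fun i => f i j) n) m.
Proof.
  induction n as [|n IH]; simpl.
  - now rewrite csum_zero.
  - now rewrite IH, csum_plus.
Qed.

Lemma csum_shift (f : nat -> C) (n : nat) :
  csum f (S n) = (f O + csum (fun i => f (S i)) n)%C.
Proof.
  induction n as [|n IH]; [simpl; ring|].
  change (csum f (S (S n))) with (csum f (S n) + f (S n))%C.
  rewrite IH; simpl; ring.
Qed.

Lemma csum_rev (f : nat -> C) (n : nat) :
  csum f n = csum (fun i => f (n - 1 - i)%nat) n.
Proof.
  induction n as [|n IH]; [reflexivity|].
  rewrite (csum_shift (fun i => f (S n - 1 - i)%nat)).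
  simpl csum at 1. rewrite IH.
  replace (S n - 1 - 0)%nat with n by lia.
  rewrite Cplus_comm; f_equal.
  apply csum_ext; intros i Hi; f_equal; lia.
Qed.

Lemma csum_telescope (f : nat -> C) (n : nat) :
  csum (fun i => f (S i) - f i)%C n = (f n - f O)%C.
Proof. induction n as [|n IH]; simpl; [ring|]. rewrite IH; ring. Qed.

Lemma csum_single (f : nat -> C) (n k : nat) : (k < n)%nat ->
  (forall i, (i < n)%nat -> i <> k -> f i = 0%C) -> csum f n = f k.
Proof.
  induction n as [|n IH]; intros Hk H; [lia|]. simpl.
  destruct (Nat.eq_dec k n) as [->|E].
  - rewrite (csum_ext f (fun _ => 0%C)), csum_zero by (intros; apply H; lia).
    ring.
  - rewrite IH, (H n) by (try lia; intros; apply H; lia). ring.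
Qed.

Lemma rsum_ext (f g : nat -> R) (n : nat) :
  (forall i, (i < n)%nat -> f i = g i) -> rsum f n = rsum g n.
Proof.
  induction n as [|n IH]; simpl; intros H; [reflexivity|].
  rewrite IH, (H n); auto.
Qed.

Lemma rsum_le (f g : nat -> R) (n : nat) :
  (forall i, (i < n)%nat -> f i <= g i) -> rsum f n <= rsum g n.
Proof.
  induction n as [|n IH]; simpl; intros H; [lra|].
  apply Rplus_le_compat; auto.
Qed.

Lemma rsum_scal (a : R) (f : nat -> R) (n : nat) :
  rsum (fun i => a * f i) n = a * rsum f n.
Proof. induction n as [|n IH]; simpl; [ring|]. rewrite IH; ring. Qed.

Lemma rsum_const (a : R) (n : nat) : rsum (fun _ => a) n = INR n * a.
Proof.
  induction n as [|n IH]; [simpl; ring|]. rewrite S_INR; simpl; rewrite IH; ring.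
Qed.

Lemma rsum_term_le (f : nat -> R) (n k : nat) : (k < n)%nat ->
  (forall i, (i < n)%nat -> 0 <= f i) -> f k <= rsum f n.
Proof.
  induction n as [|n IH]; intros Hk H; [lia|]. simpl.
  assert (0 <= rsum f n).
  { replace 0 with (rsum (fun _ => 0) n) by (rewrite rsum_const; ring).
    apply rsum_le; auto. }
  destruct (Nat.eq_dec k n) as [->|E]; [lra|].
  assert (f k <= rsum f n) by (apply IH; [lia|auto]).
  specialize (H n ltac:(lia)); lra.
Qed.

Lemma rsum_csum (f : nat -> R) (n : nat) :
  csum (fun i => RtoC (f i)) n = RtoC (rsum f n).
Proof.
  induction n as [|n IH]; simpl; [reflexivity|].
  now rewrite IH, RtoC_plus.
Qed.

Lemma csum_Cmod (f : nat -> C) (n : nat) :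
  Cmod (csum f n) <= rsum (fun i => Cmod (f i)) n.
Proof.
  induction n as [|n IH]; simpl; [rewrite Cmod_0; lra|].
  eapply Rle_trans; [apply Cmod_triangle|lra].
Qed.

Lemma csum_Cmod_le (f : nat -> C) (n : nat) (B : R) :
  (forall i, (i < n)%nat -> Cmod (f i) <= B) -> Cmod (csum f n) <= INR n * B.
Proof.
  intros H. eapply Rle_trans; [apply csum_Cmod|].
  rewrite <- rsum_const. now apply rsum_le.
Qed.

Lemma sum_n_csum (f : nat -> C) (n : nat) : sum_n f n = csum f (S n).
Proof.
  induction n as [|n IH].
  - rewrite sum_O; simpl; ring.
  - rewrite sum_Sn, IH; reflexivity.
Qed.

(** * Chebyshev polynomials *)

Lemma chebyshev_T_SS (k : nat) (x : R) :
  chebyshev_T (S (S k)) x = 2 * x * chebyshev_T (S k) x - chebyshev_T k x.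
Proof. reflexivity. Qed.

Lemma chebyshev_T_cos (k : nat) (t : R) :
  chebyshev_T k (cos t) = cos (INR k * t).
Proof.
  enough (H : chebyshev_T k (cos t) = cos (INR k * t) /\
    chebyshev_T (S k) (cos t) = cos (INR (S k) * t)) by apply H.
  induction k as [|k [IH1 IH2]].
  - simpl. rewrite Rmult_0_l, Rmult_1_l, cos_0; auto.
  - split; [exact IH2|].
    rewrite chebyshev_T_SS, IH1, IH2.
    replace (INR (S (S k)) * t) with (INR (S k) * t + t) by (rewrite (S_INR (S k)); ring).
    replace (INR k * t) with (INR (S k) * t - t) by (rewrite S_INR; ring).
    rewrite cos_plus, cos_minus; ring.
Qed.

Lemma cos_acos_mod (x : R) : -1 <= x <= 1 -> exists t, 0 <= t <= PI /\ cos t = x.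
Proof.
  intros H; exists (acos x); split; [apply acos_bound|now apply cos_acos].
Qed.

Lemma chebyshev_T_bound (k : nat) (x : R) : -1 <= x <= 1 ->
  Rabs (chebyshev_T k x) <= 1.
Proof.
  intros H; destruct (cos_acos_mod x H) as [t [_ <-]].
  rewrite chebyshev_T_cos. apply Rabs_le, COS_bound.
Qed.

Definition dist_nat (k m : nat) : nat := (k - m) + (m - k).

Lemma INR_dist_nat (k m : nat) : INR (dist_nat k m) = Rabs (INR k - INR m).
Proof.
  unfold dist_nat. destruct (Nat.le_ge_cases k m) as [H|H].
  - replace (k - m)%nat with O by lia. rewrite plus_INR, minus_INR by lia.
    rewrite Rabs_left1; [simpl; ring|]. apply le_INR in H; lra.
  - replace (m - k)%nat with O by lia. rewrite plus_INR, minus_INR by lia.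
    rewrite Rabs_right; [simpl; ring|]. apply le_INR in H; lra.
Qed.

Lemma chebyshev_T_mult (k m : nat) (x : R) : -1 <= x <= 1 ->
  chebyshev_T m x * chebyshev_T k x =
  (chebyshev_T (k + m) x + chebyshev_T (dist_nat k m) x) / 2.
Proof.
  intros H; destruct (cos_acos_mod x H) as [t [_ <-]].
  rewrite !chebyshev_T_cos, INR_dist_nat, plus_INR.
  replace (cos (Rabs (INR k - INR m) * t)) with (cos (INR k * t - INR m * t)).
  - rewrite Rmult_plus_distr_r, cos_plus, cos_minus; field.
  - unfold Rabs; destruct (Rcase_abs _).
    + rewrite <- cos_neg. f_equal; ring.
    + f_equal; ring.
Qed.

(** * Chebyshev-Gauss nodes *)

Definition node_angle (N j : nat) : R := (2 * INR j + 1) * PI / (2 * INR N).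
Definition node (N j : nat) : R := cos (node_angle N j).

Lemma node_range (N j : nat) : -1 <= node N j <= 1.
Proof. apply COS_bound. Qed.

Lemma node_rev (N j : nat) : (j < N)%nat -> node N (N - 1 - j) = - node N j.
Proof.
  intros H. unfold node, node_angle.
  rewrite minus_INR, minus_INR by lia.
  assert (INR N <> 0) by (apply not_0_INR; lia).
  replace ((2 * (INR N - INR 1 - INR j) + 1) * PI / (2 * INR N))
    with (PI - (2 * INR j + 1) * PI / (2 * INR N)) by (simpl; field; auto).
  rewrite cos_minus, cos_PI, sin_PI; ring.
Qed.

(** Multiplied by [2 sin h], the sum telescopes to [sin (m pi) = 0]; the range of [m] ensures
    [sin h <> 0]. *)
Lemma node_cos_sum (N m : nat) : (0 < m < 2 * N)%nat ->
  rsum (fun j => cos (INR m * node_angle N j)) N = 0.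
Proof.
  intros H.
  set (h := INR m * PI / (2 * INR N)).
  assert (Hm : 0 < INR m) by (apply lt_0_INR; lia).
  assert (Hm2 : INR m < 2 * INR N).
  { change 2 with (INR 2). rewrite <- mult_INR. apply lt_INR; lia. }
  pose proof PI_RGT_0 as HP.
  assert (Hh : 0 < h < PI).
  { unfold h; split.
    - apply Rdiv_lt_0_compat; nra.
    - apply Rmult_lt_reg_r with (2 * INR N); [lra|]. field_simplify; [|lra]. nra. }
  assert (Hs : 0 < sin h) by (apply sin_gt_0; lra).
  assert (E : forall n, 2 * sin h * rsum (fun j => cos (INR m * node_angle N j)) n
    = sin (2 * INR n * h)).
  { induction n as [|n IH].
    - simpl. rewrite Rmult_0_r, Rmult_0_r, Rmult_0_l, sin_0; ring.
    - change (rsum (fun j => cos (INR m * node_angle N j)) (S n)) with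
        (rsum (fun j => cos (INR m * node_angle N j)) n + cos (INR m * node_angle N n)).
      rewrite Rmult_plus_distr_l, IH, S_INR.
      replace (INR m * node_angle N n) with (2 * INR n * h + h)
        by (unfold h, node_angle; field; lra).
      replace (2 * (INR n + 1) * h) with ((2 * INR n * h + h) + h) by ring.
      replace (2 * INR n * h) with ((2 * INR n * h + h) - h) at 1 by ring.
      rewrite sin_plus, sin_minus; ring. }
  specialize (E N).
  replace (2 * INR N * h) with (INR m * PI) in E by (unfold h; field; lra).
  assert (sin (INR m * PI) = 0) as E2.
  { apply sin_eq_0_1. exists (Z.of_nat m). now rewrite INR_IZR_INZ. }
  rewrite E2 in E. apply Rmult_integral in E. destruct E; lra.
Qed.

(** The product formula leaves the indices [k + l] and [|k - l|], both below [2 N], where only index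
    0 has a nonzero sum. At index [2 N] aliasing would begin. *)
Lemma node_orthogonality (N k l : nat) : (k + l < 2 * N)%nat ->
  rsum (fun j => chebyshev_T k (node N j) * chebyshev_T l (node N j)) N =
  if Nat.eq_dec k l then (if Nat.eq_dec k 0 then INR N else INR N / 2) else 0.
Proof.
  intros H.
  assert (E : forall m, (m < 2 * N)%nat ->
    rsum (fun j => chebyshev_T m (node N j)) N = if Nat.eq_dec m 0 then INR N else 0).
  { intros m Hm. destruct (Nat.eq_dec m 0) as [->|Em].
    - simpl. rewrite rsum_const; ring.
    - rewrite <- (node_cos_sum N m) by lia. apply rsum_ext; intros.
      apply chebyshev_T_cos. }
  rewrite (rsum_ext _ (fun j => / 2 * (chebyshev_T (l + k) (node N j) +
     chebyshev_T (dist_nat l k) (node N j)))).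
  2:{ intros i _. rewrite chebyshev_T_mult by apply node_range. field. }
  rewrite rsum_scal.
  assert (P : forall f g n, rsum (fun j => f j + g j) n = rsum f n + rsum g n).
  { intros f g n; induction n as [|n IH]; simpl; [ring|rewrite IH; ring]. }
  rewrite P, !E by (unfold dist_nat; lia).
  unfold dist_nat.
  repeat match goal with
  | |- context [Nat.eq_dec ?a ?b] => destruct (Nat.eq_dec a b)
  end; try lia; field.
Qed.

(** * Discrete Chebyshev coefficients *)

(** A discrete cosine transform without the usual halving at [k = 0]: it returns twice the zeroth
    coefficient, which is harmless for upper bounds. *)
Definition gauss (N k : nat) (h : R -> C) : C :=
  (RtoC (2 / INR N) * csum (fun j => h (node N j) * RtoC (chebyshev_T k (node N j)))%C N)%C.

Lemma gauss_ext (N k : nat) (f g : R -> C) :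
  (forall x, -1 <= x <= 1 -> f x = g x) -> gauss N k f = gauss N k g.
Proof.
  intros H; unfold gauss; f_equal. apply csum_ext; intros.
  rewrite H by apply node_range; reflexivity.
Qed.

Lemma gauss_plus (N k : nat) (f g : R -> C) :
  gauss N k (fun x => f x + g x)%C = (gauss N k f + gauss N k g)%C.
Proof.
  unfold gauss. rewrite <- Cmult_plus_distr_l, <- csum_plus.
  f_equal; apply csum_ext; intros; ring.
Qed.

Lemma gauss_scal (N k : nat) (a : C) (f : R -> C) :
  gauss N k (fun x => a * f x)%C = (a * gauss N k f)%C.
Proof.
  unfold gauss. rewrite <- !csum_scal. apply csum_ext; intros; ring.
Qed.

Lemma gauss_minus (N k : nat) (f g : R -> C) :
  gauss N k (fun x => f x - g x)%C = (gauss N k f - gauss N k g)%C.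
Proof.
  rewrite (gauss_ext _ _ _ (fun x => f x + (-1) * g x)%C) by (intros; ring).
  rewrite gauss_plus, gauss_scal; ring.
Qed.

Lemma gauss_csum (N k n : nat) (f : nat -> R -> C) :
  gauss N k (fun x => csum (fun i => f i x) n) = csum (fun i => gauss N k (f i)) n.
Proof.
  induction n as [|n IH]; simpl.
  - rewrite (gauss_ext _ _ _ (fun x => 0 * 0)%C) by (intros; ring).
    rewrite (gauss_scal _ _ 0 (fun _ => 0%C)); ring.
  - now rewrite gauss_plus, IH.
Qed.

Lemma gauss_bound (N k : nat) (h : R -> C) (B : R) : (0 < N)%nat ->
  (forall x, -1 <= x <= 1 -> Cmod (h x) <= B) -> Cmod (gauss N k h) <= 2 * B.
Proof.
  intros HN H. unfold gauss. rewrite Cmod_mult, Cmod_R.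
  assert (H0 : 0 < INR N) by (apply lt_0_INR; lia).
  rewrite Rabs_right by (apply Rle_ge, Rlt_le, Rdiv_lt_0_compat; lra).
  replace (2 * B) with (2 / INR N * (INR N * B)) by (field; lra).
  apply Rmult_le_compat_l; [apply Rlt_le, Rdiv_lt_0_compat; lra|].
  apply csum_Cmod_le. intros i _. rewrite Cmod_mult, Cmod_R.
  rewrite <- (Rmult_1_r B).
  apply Rmult_le_compat; auto using Cmod_ge_0, Rabs_pos, node_range, chebyshev_T_bound.
Qed.

Lemma gauss_T (N k l : nat) : (k + l < 2 * N)%nat ->
  gauss N k (fun x => RtoC (chebyshev_T l x)) =
  RtoC (if Nat.eq_dec k l then (if Nat.eq_dec k 0 then 2 else 1) else 0).
Proof.
  intros H. unfold gauss.
  rewrite (csum_ext _ (fun j => RtoC (chebyshev_T k (node N j) * chebyshev_T l (node N j)))).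
  2:{ intros; rewrite RtoC_mult; ring. }
  rewrite rsum_csum, node_orthogonality, <- RtoC_mult by auto.
  assert (INR N <> 0) by (apply not_0_INR; lia).
  f_equal. destruct (Nat.eq_dec k l), (Nat.eq_dec k 0); field; auto.
Qed.

(** The identity is pointwise at the nodes, so it is exact for all [k], [m] and [N], with no
    aliasing. *)
Lemma gauss_mult_T (N k m : nat) (h : R -> C) :
  gauss N k (fun x => RtoC (chebyshev_T m x) * h x)%C =
  (RtoC (/ 2) * (gauss N (k + m) h + gauss N (dist_nat k m) h))%C.
Proof.
  unfold gauss. rewrite <- Cmult_plus_distr_l, <- csum_plus, <- !csum_scal.
  apply csum_ext; intros i _.
  transitivity (RtoC (2 / INR N) * (h (node N i) *
    RtoC (chebyshev_T m (node N i) * chebyshev_T k (node N i))))%C.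
  - rewrite RtoC_mult; ring.
  - rewrite chebyshev_T_mult by apply node_range.
    unfold Rdiv at 2; rewrite RtoC_mult, RtoC_plus; ring.
Qed.

Lemma gauss_swap (N k1 k2 : nat) (G : R -> R -> C) :
  gauss N k2 (fun x2 => gauss N k1 (fun x1 => G x1 x2)) =
  gauss N k1 (fun x1 => gauss N k2 (fun x2 => G x1 x2)).
Proof.
  unfold gauss.
  rewrite (csum_ext _ (fun j => RtoC (2 / INR N) * csum (fun i =>
     G (node N i) (node N j) * RtoC (chebyshev_T k1 (node N i))
       * RtoC (chebyshev_T k2 (node N j))) N)%C).
  2:{ intros j _. rewrite <- Cmult_assoc. f_equal. rewrite Cmult_comm, <- csum_scal.
      apply csum_ext; intros; ring. }
  rewrite (csum_ext (fun j => RtoC (2 / INR N) * _ * _)%C (fun i => RtoC (2 / INR N) * csum (fun j =>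
     G (node N i) (node N j) * RtoC (chebyshev_T k1 (node N i))
       * RtoC (chebyshev_T k2 (node N j))) N)%C).
  2:{ intros j _. rewrite <- Cmult_assoc. f_equal. rewrite Cmult_comm, <- csum_scal.
      apply csum_ext; intros; ring. }
  now rewrite !csum_scal, csum_swap.
Qed.

Definition gauss2 (N k1 k2 : nat) (G : R -> R -> C) : C :=
  gauss N k2 (fun x2 => gauss N k1 (fun x1 => G x1 x2)).

Lemma gauss2_bound (N k1 k2 : nat) (G : R -> R -> C) (B : R) : (0 < N)%nat ->
  (forall x1 x2, -1 <= x1 <= 1 -> -1 <= x2 <= 1 -> Cmod (G x1 x2) <= B) ->
  Cmod (gauss2 N k1 k2 G) <= 4 * B.
Proof.
  intros HN H. replace (4 * B) with (2 * (2 * B)) by ring.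
  apply gauss_bound; auto. intros; apply gauss_bound; auto.
Qed.

Lemma gauss2_minus (N k1 k2 : nat) (F G : R -> R -> C) :
  gauss2 N k1 k2 (fun x1 x2 => F x1 x2 - G x1 x2)%C =
  (gauss2 N k1 k2 F - gauss2 N k1 k2 G)%C.
Proof.
  unfold gauss2. rewrite <- gauss_minus. apply gauss_ext; intros.
  now rewrite gauss_minus.
Qed.

Lemma gauss2_dist (N k1 k2 : nat) (F G : R -> R -> C) (eps : R) : (0 < N)%nat ->
  (forall x1 x2, -1 <= x1 <= 1 -> -1 <= x2 <= 1 -> Cmod (F x1 x2 - G x1 x2) <= eps) ->
  Cmod (gauss2 N k1 k2 F) <= Cmod (gauss2 N k1 k2 G) + 4 * eps.
Proof.
  intros HN H.
  replace (gauss2 N k1 k2 F) with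
    (gauss2 N k1 k2 G + gauss2 N k1 k2 (fun x1 x2 => F x1 x2 - G x1 x2))%C
    by (rewrite gauss2_minus; ring).
  eapply Rle_trans; [apply Cmod_triangle|].
  apply Rplus_le_compat_l. now apply gauss2_bound.
Qed.

(** * Exponentially weighted bounds on discrete coefficients *)

Definition weight (d a : R) (k1 k2 : nat) : R :=
  exp (- d * (INR k1 + INR k2) - a * Rabs (INR k1 - INR k2)).

Lemma weight_pos (d a : R) (k1 k2 : nat) : 0 < weight d a k1 k2.
Proof. apply exp_pos. Qed.

Lemma weight_sym (d a : R) (k1 k2 : nat) : weight d a k1 k2 = weight d a k2 k1.
Proof.
  unfold weight. rewrite Rabs_minus_sym. f_equal; ring.
Qed.

Lemma exp_pow_INR (x : R) (n : nat) : exp x ^ n = exp (INR n * x).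
Proof.
  induction n as [|n IH]; [simpl; now rewrite Rmult_0_l, exp_0|].
  rewrite S_INR, Rmult_plus_distr_r, exp_plus, <- IH, Rmult_1_l; simpl; ring.
Qed.

Lemma exp_le_compat (x y : R) : x <= y -> exp x <= exp y.
Proof.
  intros [Hxy| ->]; [left; now apply exp_increasing|right; reflexivity].
Qed.

Lemma weight_shift (d a : R) (k l k2 m : nat) : 0 <= d -> 0 <= a ->
  Rabs (INR k - INR l) <= INR m ->
  weight d a l k2 <= exp (d + a) ^ m * weight d a k k2.
Proof.
  intros Hd Ha H. unfold weight.
  rewrite exp_pow_INR, <- exp_plus.
  apply exp_le_compat.
  assert (Rabs (INR k - INR k2) <= Rabs (INR l - INR k2) + INR m).
  { replace (INR k - INR k2) with ((INR l - INR k2) + (INR k - INR l)) by ring.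
    eapply Rle_trans; [apply Rabs_triang|]. lra. }
  assert (INR k - INR l <= INR m) by (eapply Rle_trans; [apply Rle_abs|exact H]).
  nra.
Qed.

(* Aliasing spoils [gauss2 N k1 k2] by terms vanishing as [N] grows; hence the
   slack [eps]. *)
Definition coef_bound (d a : R) (G : R -> R -> C) (M : R) : Prop :=
  forall (k1 k2 : nat) (eps : R), 0 < eps ->
  exists N0 : nat, forall N : nat, (N0 <= N)%nat ->
    Cmod (gauss2 N k1 k2 G) <= M * weight d a k1 k2 + eps.

Lemma coef_bound_ext (d a : R) (F G : R -> R -> C) (M : R) :
  (forall x1 x2, -1 <= x1 <= 1 -> -1 <= x2 <= 1 -> F x1 x2 = G x1 x2) ->
  coef_bound d a F M -> coef_bound d a G M.
Proof.
  intros E H k1 k2 eps He. destruct (H k1 k2 eps He) as [N0 HN].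
  exists N0; intros N HN1. specialize (HN N HN1).
  replace (gauss2 N k1 k2 G) with (gauss2 N k1 k2 F); auto.
  unfold gauss2. apply gauss_ext; intros; apply gauss_ext; auto.
Qed.

Lemma coef_bound_weaken (d a : R) (G : R -> R -> C) (M M' : R) :
  M <= M' -> coef_bound d a G M -> coef_bound d a G M'.
Proof.
  intros HM H k1 k2 eps He. destruct (H k1 k2 eps He) as [N0 HN].
  exists N0; intros N HN1. eapply Rle_trans; [now apply HN|].
  apply Rplus_le_compat_r, Rmult_le_compat_r; [left; apply weight_pos|auto].
Qed.

Lemma coef_bound_swap (d a : R) (G : R -> R -> C) (M : R) :
  coef_bound d a G M -> coef_bound d a (fun x1 x2 => G x2 x1) M.
Proof.
  intros H k1 k2 eps He. destruct (H k2 k1 eps He) as [N0 HN].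
  exists N0; intros N HN1. unfold gauss2. rewrite gauss_swap, weight_sym.
  now apply HN.
Qed.

Lemma coef_bound_plus (d a : R) (F G : R -> R -> C) (M1 M2 : R) :
  coef_bound d a F M1 -> coef_bound d a G M2 ->
  coef_bound d a (fun x1 x2 => F x1 x2 + G x1 x2)%C (M1 + M2).
Proof.
  intros HF HG k1 k2 eps He.
  destruct (HF k1 k2 (eps / 2)) as [N1 H1]; [lra|].
  destruct (HG k1 k2 (eps / 2)) as [N2 H2]; [lra|].
  exists (max N1 N2); intros N HN.
  specialize (H1 N ltac:(lia)). specialize (H2 N ltac:(lia)).
  replace (gauss2 N k1 k2 (fun x1 x2 => F x1 x2 + G x1 x2)%C)
    with (gauss2 N k1 k2 F + gauss2 N k1 k2 G)%C.
  - eapply Rle_trans; [apply Cmod_triangle|]. lra.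
  - unfold gauss2. rewrite <- gauss_plus. apply gauss_ext; intros.
    now rewrite gauss_plus.
Qed.

Lemma gauss2_scal (N k1 k2 : nat) (c : C) (G : R -> R -> C) :
  gauss2 N k1 k2 (fun x1 x2 => c * G x1 x2)%C = (c * gauss2 N k1 k2 G)%C.
Proof.
  unfold gauss2. rewrite <- gauss_scal. apply gauss_ext; intros.
  now rewrite gauss_scal.
Qed.

Lemma coef_bound_scal (d a : R) (c : C) (G : R -> R -> C) (M : R) :
  coef_bound d a G M -> coef_bound d a (fun x1 x2 => c * G x1 x2)%C (Cmod c * M).
Proof.
  intros H k1 k2 eps He.
  assert (Hc : 0 < Cmod c + 1) by (pose proof (Cmod_ge_0 c); lra).
  destruct (H k1 k2 (eps / (Cmod c + 1))) as [N0 HN]; [now apply Rdiv_lt_0_compat|].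
  exists N0; intros N HN1. specialize (HN N HN1).
  rewrite gauss2_scal, Cmod_mult.
  eapply Rle_trans; [apply Rmult_le_compat_l; [apply Cmod_ge_0|exact HN]|].
  rewrite Rmult_plus_distr_l, Rmult_assoc. apply Rplus_le_compat_l.
  apply Rmult_le_reg_r with (Cmod c + 1); auto. field_simplify; [|lra].
  pose proof (Cmod_ge_0 c); nra.
Qed.

Lemma coef_bound_csum (d a : R) (G : nat -> R -> R -> C) (M : nat -> R) (n : nat) :
  (forall i, (i < n)%nat -> coef_bound d a (G i) (M i)) ->
  coef_bound d a (fun x1 x2 => csum (fun i => G i x1 x2) n) (rsum M n).
Proof.
  induction n as [|n IH]; intros H; simpl.
  - intros k1 k2 eps He. exists 1%nat; intros N HN.
    rewrite Rmult_0_l. replace (0 + eps) with (4 * (eps / 4)) by field.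
    apply gauss2_bound; [lia|]. intros; rewrite Cmod_0; lra.
  - apply coef_bound_plus; auto.
Qed.

(** The new coefficient averages those at [k1 + m] and [|k1 - m|], both within distance [m] of [k1],
    and the weight changes by at most [exp (d + a)] per unit step. *)
Lemma coef_bound_mult_T (d a : R) (G : R -> R -> C) (M : R) (m : nat) :
  0 <= d -> 0 <= a -> 0 <= M -> coef_bound d a G M ->
  coef_bound d a (fun x1 x2 => RtoC (chebyshev_T m x1) * G x1 x2)%C
    (exp (d + a) ^ m * M).
Proof.
  intros Hd Ha HM H k1 k2 eps He.
  destruct (H (k1 + m)%nat k2 eps He) as [N1 H1].
  destruct (H (dist_nat k1 m) k2 eps He) as [N2 H2].
  exists (max N1 N2); intros N HN.
  specialize (H1 N ltac:(lia)). specialize (H2 N ltac:(lia)).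
  replace (gauss2 N k1 k2 (fun x1 x2 => RtoC (chebyshev_T m x1) * G x1 x2)%C)
    with (RtoC (/ 2) * (gauss2 N (k1 + m) k2 G + gauss2 N (dist_nat k1 m) k2 G))%C.
  2:{ unfold gauss2. rewrite <- gauss_plus, <- gauss_scal. apply gauss_ext; intros.
      now rewrite gauss_mult_T. }
  rewrite Cmod_mult, Cmod_R, Rabs_right by lra.
  pose proof (Cmod_triangle (gauss2 N (k1 + m) k2 G) (gauss2 N (dist_nat k1 m) k2 G)) as HT.
  pose proof (pos_INR k1) as P1. pose proof (pos_INR m) as P2.
  assert (W1 : weight d a (k1 + m) k2 <= exp (d + a) ^ m * weight d a k1 k2).
  { apply weight_shift; auto. rewrite plus_INR. apply Rabs_le; lra. }
  assert (W2 : weight d a (dist_nat k1 m) k2 <= exp (d + a) ^ m * weight d a k1 k2).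
  { apply weight_shift; auto. rewrite INR_dist_nat.
    apply Rabs_le; unfold Rabs; destruct (Rcase_abs _); lra. }
  apply (Rmult_le_compat_l M) in W1; [|auto].
  apply (Rmult_le_compat_l M) in W2; [|auto].
  lra.
Qed.

(** [gauss2] is bounded by 4 times the sup norm for every [N], so a uniform approximation costs only
    slack and [M] is preserved. *)
Lemma coef_bound_limit (d a : R) (F : R -> R -> C) (M : R) :
  (forall eps, 0 < eps -> exists G, coef_bound d a G M /\
     forall x1 x2, -1 <= x1 <= 1 -> -1 <= x2 <= 1 -> Cmod (F x1 x2 - G x1 x2) <= eps) ->
  coef_bound d a F M.
Proof.
  intros H k1 k2 eps He. destruct (H (eps / 8)) as [G [HG E]]; [lra|].
  destruct (HG k1 k2 (eps / 2)) as [N0 HN]; [lra|].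
  exists (S N0); intros N HN1. specialize (HN N ltac:(lia)).
  pose proof (gauss2_dist N k1 k2 F G (eps / 8) ltac:(lia) E). lra.
Qed.

(** On a square partial sum [gauss2] returns exactly [c k1 k2] times 1, 2 or 4; replacing the
    partial sum by [F] costs an arbitrarily small amount. *)
Lemma chebyshev_coefficient_bound (d a : R) (F : R -> R -> C) (M : R)
    (c : nat -> nat -> C) :
  chebyshev_coefficients F c -> coef_bound d a F M ->
  forall k1 k2, Cmod (c k1 k2) <= M * weight d a k1 k2.
Proof.
  intros Hc HF k1 k2. apply Rle_plus_epsilon. intros eps He.
  destruct (HF k1 k2 (eps / 2)) as [N0 HN]; [lra|].
  destruct (Hc (eps / 8)) as [N1 HN1]; [lra|].
  (* All degrees and indices are at most [n], so [N > 2 n] rules out aliasing in the partial sum. *)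
  set (n := max N1 (max k1 k2)). set (N := max N0 (n + n + 1)).
  specialize (HN N ltac:(lia)). specialize (HN1 n ltac:(lia)).
  assert (E : gauss2 N k1 k2 (chebyshev_sum c n) =
    (c k1 k2 * RtoC (if Nat.eq_dec k1 0 then 2 else 1)
      * RtoC (if Nat.eq_dec k2 0 then 2 else 1))%C).
  { unfold gauss2.
    rewrite (gauss_ext _ _ _ (fun x2 => csum (fun l2 =>
       (c k1 l2 * RtoC (if Nat.eq_dec k1 0 then 2 else 1))
         * RtoC (chebyshev_T l2 x2)) (S n))%C).
    - rewrite gauss_csum.
      rewrite (csum_single _ _ k2); [|lia|].
      2:{ intros l Hl El. rewrite gauss_scal, gauss_T by lia.
          destruct (Nat.eq_dec k2 l); [lia|ring]. }
      rewrite gauss_scal, gauss_T by lia.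
      destruct (Nat.eq_dec k2 k2); [|lia]. reflexivity.
    - intros x2 Hx2.
      rewrite (gauss_ext _ _ _ (fun x1 => csum (fun l1 =>
        csum (fun l2 => c l1 l2 * RtoC (chebyshev_T l2 x2)) (S n)
         * RtoC (chebyshev_T l1 x1)) (S n))%C).
      + rewrite gauss_csum.
        rewrite (csum_single _ _ k1); [|lia|].
        2:{ intros l Hl El. rewrite gauss_scal, gauss_T by lia.
            destruct (Nat.eq_dec k1 l); [lia|ring]. }
        rewrite gauss_scal, gauss_T by lia.
        destruct (Nat.eq_dec k1 k1); [|lia].
        rewrite Cmult_comm, <- csum_scal. apply csum_ext; intros; ring.
      + intros x1 Hx1. unfold chebyshev_sum. rewrite sum_n_csum.
        apply csum_ext; intros l1 _. rewrite sum_n_csum.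
        rewrite Cmult_comm, <- csum_scal. apply csum_ext; intros; ring. }
  assert (HB : Cmod (c k1 k2) <= Cmod (gauss2 N k1 k2 (chebyshev_sum c n))).
  { rewrite E, !Cmod_mult, !Cmod_R. pose proof (Cmod_ge_0 (c k1 k2)).
    destruct (Nat.eq_dec k1 0), (Nat.eq_dec k2 0); rewrite !Rabs_right by lra; lra. }
  pose proof (gauss2_dist N k1 k2 (chebyshev_sum c n) F (eps / 8) ltac:(lia)) as HD.
  specialize (HD ltac:(auto)). lra.
Qed.

(** * Resolvents *)

(** Coefficients of [1 / (y - x) = 2 p / (1 - 2 x p + p^2)] with [y = (p + 1/p) / 2], from the
    Poisson kernel [(1 - p^2) / (1 - 2 x p + p^2) = 1 + 2 sum p^k T_k(x)]. *)
Definition resolvent_coef (p : C) (k : nat) : C :=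
  match k with
  | O => (2 * p / (1 - p * p))%C
  | S _ => (4 * p ^ S k / (1 - p * p))%C
  end.

Lemma Cmod_nonneg (r : R) : 0 <= r -> Cmod (RtoC r) = r.
Proof. intros H. rewrite Cmod_R. now apply Rabs_right, Rle_ge. Qed.

Lemma Cmod_minus_ge (a b : C) : Cmod a - Cmod b <= Cmod (a - b).
Proof.
  replace a with ((a - b) + b)%C at 1 by ring.
  pose proof (Cmod_triangle (a - b) b). lra.
Qed.

Lemma one_minus_sqr_ge (p : C) : 1 - Cmod p * Cmod p <= Cmod (1 - p * p)%C.
Proof.
  rewrite <- Cmod_mult. pose proof (Cmod_minus_ge 1 (p * p)) as H.
  rewrite Cmod_1 in H. exact H.
Qed.

Lemma Cmod_lt_1_neq (z : C) : Cmod z < 1 -> (1 - z)%C <> 0%C.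
Proof.
  intros H E. pose proof (Cmod_minus_ge 1 z) as H1.
  rewrite E, Cmod_0, Cmod_1 in H1. lra.
Qed.

(** The polynomial factors as [(e - p) (e' - p)] with [e], [e'] the conjugate numbers
    [x +- i sqrt (1 - x^2)] of modulus 1. *)
Lemma quadratic_ge (p : C) (x : R) : -1 <= x <= 1 -> Cmod p <= 1 ->
  (1 - Cmod p) * (1 - Cmod p) <= Cmod (1 - 2 * x * p + p * p)%C.
Proof.
  intros Hx Hp. set (s := sqrt (1 - x * x)).
  assert (Hs : s * s = 1 - x * x) by (apply sqrt_sqrt; nra).
  set (e := (x, s) : C). set (e' := (x, - s) : C).
  assert (He : Cmod e = 1).
  { unfold Cmod; simpl. replace (_ + _) with 1 by nra. apply sqrt_1. }
  assert (He' : Cmod e' = 1).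
  { unfold Cmod; simpl. replace (_ + _) with 1 by nra. apply sqrt_1. }
  replace (1 - 2 * x * p + p * p)%C with ((e - p) * (e' - p))%C.
  - rewrite Cmod_mult. pose proof (Cmod_minus_ge e p). pose proof (Cmod_minus_ge e' p).
    apply Rmult_le_compat; lra.
  - destruct p as [u v]. unfold e, e'. apply injective_projections; simpl; nra.
Qed.

(** The three-term recurrence cancels all interior terms, so the truncation error is explicit and no
    infinite series is needed. *)
Lemma resolvent_partial (p : C) (x : R) (n : nat) : (1 - p * p)%C <> 0%C ->
  ((1 - 2 * x * p + p * p) *
    csum (fun k => resolvent_coef p k * RtoC (chebyshev_T k x)) (S n) =
  2 * p / (1 - p * p) * (1 - p * p - 2 * p ^ S n * RtoC (chebyshev_T (S n) x)
     + 2 * p ^ S (S n) * RtoC (chebyshev_T n x)))%C.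
Proof.
  intros Hp. induction n as [|n IH].
  - simpl. field; auto.
  - change (csum (fun k => resolvent_coef p k * RtoC (chebyshev_T k x))%C (S (S n))) with
      (csum (fun k => resolvent_coef p k * RtoC (chebyshev_T k x)) (S n)
        + resolvent_coef p (S n) * RtoC (chebyshev_T (S n) x))%C.
    rewrite Cmult_plus_distr_l, IH, chebyshev_T_SS.
    unfold resolvent_coef.
    rewrite RtoC_minus, !RtoC_mult.
    rewrite !Cpow_S. field; auto.
Qed.

Lemma resolvent_eq (p y : C) (x : R) : (p * p - 2 * y * p + 1 = 0)%C ->
  (1 - 2 * x * p + p * p = 2 * p * (y - x))%C.
Proof.
  intros H. transitivity ((p * p - 2 * y * p + 1) + 2 * p * (y - x))%C; [ring|].
  rewrite H; ring.
Qed.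

Lemma resolvent_approx (p y : C) (x rho : R) (n : nat) :
  (p * p - 2 * y * p + 1 = 0)%C -> Cmod p <= rho -> rho < 1 -> -1 <= x <= 1 ->
  Cmod (/ (y - x) - csum (fun k => resolvent_coef p k * RtoC (chebyshev_T k x)) (S n))%C
    <= 8 / ((1 - rho) * ((1 - rho) * (1 - rho))) * rho ^ n.
Proof.
  intros Hy Hp Hr Hx.
  pose proof (Cmod_ge_0 p) as Hp0.
  assert (Hpp : Cmod (p * p) < 1) by (rewrite Cmod_mult; nra).
  pose proof (Cmod_lt_1_neq _ Hpp) as Hne.
  pose proof (quadratic_ge p x Hx ltac:(lra)) as HQ.
  assert (HQ' : (1 - rho) * (1 - rho) <= Cmod (1 - 2 * x * p + p * p)%C).
  { eapply Rle_trans; [|exact HQ]. apply Rmult_le_compat; lra. }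
  assert (HQ0 : (1 - 2 * x * p + p * p)%C <> 0%C).
  { apply Cmod_gt_0. nra. }
  assert (Hpn : p <> 0%C).
  { intros ->. apply (f_equal Cmod) in Hy.
    replace (0 * 0 - 2 * y * 0 + 1)%C with (RtoC 1) in Hy by ring.
    rewrite Cmod_1, Cmod_0 in Hy; lra. }
  assert (Hyx : (y - x)%C <> 0%C).
  { intros E. rewrite (resolvent_eq p y x Hy), E in HQ0. apply HQ0; ring. }
  assert (E : (/ (y - x) - csum (fun k => resolvent_coef p k * RtoC (chebyshev_T k x)) (S n)
    = 2 * p / (1 - p * p) * (2 * p ^ S n * RtoC (chebyshev_T (S n) x)
     - 2 * p ^ S (S n) * RtoC (chebyshev_T n x)) / (1 - 2 * x * p + p * p))%C).
  { pose proof (resolvent_partial p x n Hne) as HP.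
    replace (csum (fun k => resolvent_coef p k * RtoC (chebyshev_T k x)) (S n))%C
      with ((1 - 2 * x * p + p * p) *
       csum (fun k => resolvent_coef p k * RtoC (chebyshev_T k x)) (S n)
         / (1 - 2 * x * p + p * p))%C by (field; auto).
    rewrite HP.
    replace (/ (y - x))%C with (2 * p / (1 - 2 * x * p + p * p))%C.
    - field; auto.
    - rewrite (resolvent_eq p y x Hy). field; auto. }
  rewrite E. rewrite Cmod_div, Cmod_mult, Cmod_div, Cmod_mult by auto.
  assert (H2 : Cmod 2 = 2) by (apply Cmod_nonneg; lra).
  assert (HD : 1 - rho <= Cmod (1 - p * p)%C).
  { eapply Rle_trans; [|apply one_minus_sqr_ge]. nra. }
  assert (HN : Cmod (2 * p ^ S n * RtoC (chebyshev_T (S n) x)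
     - 2 * p ^ S (S n) * RtoC (chebyshev_T n x))%C <= 4 * rho ^ n).
  { assert (B : forall j l, (n <= j)%nat ->
      Cmod (2 * p ^ j * RtoC (chebyshev_T l x))%C <= 2 * rho ^ n).
    { intros j l Hj. rewrite !Cmod_mult, H2, Cmod_pow, Cmod_R.
      assert (Cmod p ^ j <= rho ^ n).
      { replace j with (n + (j - n))%nat by lia. rewrite pow_add.
        rewrite <- (Rmult_1_r (rho ^ n)).
        apply Rmult_le_compat; try (apply pow_le; auto).
        - apply pow_incr; lra.
        - rewrite <- (pow1 (j - n)). apply pow_incr; lra. }
      pose proof (chebyshev_T_bound l x Hx).
      pose proof (pow_le (Cmod p) j Hp0). nra. }
    unfold Cminus. eapply Rle_trans; [apply Cmod_triangle|]. rewrite Cmod_opp.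
    pose proof (B (S n) (S n) ltac:(lia)). pose proof (B (S (S n)) n ltac:(lia)). lra. }
  unfold Rdiv.
  replace (8 * / ((1 - rho) * ((1 - rho) * (1 - rho))) * rho ^ n) with
   (2 * / (1 - rho) * (4 * rho ^ n) * / ((1 - rho) * (1 - rho))) by (field; lra).
  assert (0 < / Cmod (1 - p * p)%C) by (apply Rinv_0_lt_compat; lra).
  assert (0 < (1 - rho) * (1 - rho)) by nra.
  assert (0 < / Cmod (1 - 2 * x * p + p * p)%C) by (apply Rinv_0_lt_compat; lra).
  rewrite H2.
  apply Rmult_le_compat; [| lra | |apply Rinv_le_contravar; lra].
  - repeat apply Rmult_le_pos; try lra. apply Cmod_ge_0.
  - apply Rmult_le_compat; [|apply Cmod_ge_0| |exact HN].
    + repeat apply Rmult_le_pos; lra.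
    + apply Rmult_le_compat; try lra. apply Rinv_le_contravar; lra.
Qed.

Lemma resolvent_bound (p y : C) (x rho : R) :
  (p * p - 2 * y * p + 1 = 0)%C -> Cmod p <= rho -> rho < 1 -> -1 <= x <= 1 ->
  Cmod (/ (y - x))%C <= 2 / ((1 - rho) * (1 - rho)).
Proof.
  intros Hy Hp Hr Hx.
  pose proof (quadratic_ge p x Hx ltac:(lra)) as HQ.
  assert (0 < (1 - rho) * (1 - rho)) by nra.
  assert (HQ' : (1 - rho) * (1 - rho) <= Cmod (1 - 2 * x * p + p * p)%C).
  { eapply Rle_trans; [|exact HQ]. apply Rmult_le_compat; lra. }
  rewrite (resolvent_eq p y x Hy) in HQ'.
  assert (H2 : Cmod 2 = 2) by (apply Cmod_nonneg; lra).
  rewrite !Cmod_mult, H2 in HQ'.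
  pose proof (Cmod_ge_0 (y - x)%C).
  assert (0 < Cmod (y - x)%C) by nra.
  rewrite Cmod_inv by now apply Cmod_gt_0.
  apply Rmult_le_reg_r with (Cmod (y - x)%C); auto.
  rewrite Rinv_l by lra.
  apply Rmult_le_reg_r with ((1 - rho) * (1 - rho)); auto.
  field_simplify; [|lra]. nra.
Qed.

Lemma rsum_geometric (q : R) (n : nat) : 0 <= q < 1 ->
  rsum (fun k => q ^ k) n <= / (1 - q).
Proof.
  intros Hq.
  assert (E : rsum (fun k => q ^ k) n = (1 - q ^ n) / (1 - q)).
  { induction n as [|n IH]; simpl; [field; lra|]. rewrite IH; field; lra. }
  rewrite E. unfold Rdiv. rewrite <- (Rmult_1_l (/ (1 - q))) at 2.
  apply Rmult_le_compat_r; [left; apply Rinv_0_lt_compat; lra|].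
  pose proof (pow_le q n ltac:(lra)); lra.
Qed.

(** In the expansion of the resolvent, the cost [exp (d + a)^k] of multiplying by [T_k] is beaten by
    [|p|^k]. The remaining factor [|p|] is kept, because the squares of these factors are later
    summed over the poles. The sup bound [B] serves only the convergence and does not enter the
    constant. *)
Lemma coef_bound_resolvent (d a : R) (G : R -> R -> C) (M rho B : R) (p y : C) :
  0 <= d -> 0 <= a -> 0 <= M -> coef_bound d a G M ->
  (forall x1 x2, -1 <= x1 <= 1 -> -1 <= x2 <= 1 -> Cmod (G x1 x2) <= B) ->
  (p * p - 2 * y * p + 1 = 0)%C -> Cmod p * exp (d + a) <= rho -> rho < 1 ->
  coef_bound d a (fun x1 x2 => / (y - x1) * G x1 x2)%C
    (4 / ((1 - rho) * (1 - rho)) * Cmod p * M).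
Proof.
  intros Hd Ha HM HG HB Hy Hp Hr.
  pose proof (Cmod_ge_0 p) as Hp0.
  assert (Hexp : 1 <= exp (d + a)) by (pose proof (exp_ineq1_le (d + a)); lra).
  assert (Hpr : Cmod p <= rho) by nra.
  apply coef_bound_limit. intros eps Heps.
  set (K := 8 / ((1 - rho) * ((1 - rho) * (1 - rho)))).
  assert (HK : 0 < K).
  { unfold K. apply Rdiv_lt_0_compat; [lra|]. repeat apply Rmult_lt_0_compat; lra. }
  assert (HB0 : 0 <= B).
  { eapply Rle_trans; [apply Cmod_ge_0|apply (HB 0 0); lra]. }
  assert (Hn : exists n, K * rho ^ n * B <= eps).
  { destruct (pow_lt_1_zero rho) with (y := eps / (K * (B + 1))) as [n Hn].
    - rewrite Rabs_right; lra.
    - apply Rdiv_lt_0_compat; nra.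
    - exists n. specialize (Hn n ltac:(lia)).
      assert (Hpn : 0 <= rho ^ n) by (apply pow_le; lra).
      rewrite Rabs_right in Hn by lra.
      assert (HKB : 0 < K * (B + 1)) by nra.
      apply (Rmult_lt_compat_r (K * (B + 1))) in Hn; [|auto].
      unfold Rdiv in Hn. rewrite Rmult_assoc, Rinv_l, Rmult_1_r in Hn by lra.
      nra. }
  destruct Hn as [n Hn].
  exists (fun x1 x2 => csum (fun k => resolvent_coef p k *
      (RtoC (chebyshev_T k x1) * G x1 x2)) (S n))%C.
  split.
  - eapply coef_bound_weaken;
      [|apply (coef_bound_csum d a _ (fun k => Cmod (resolvent_coef p k) *
         (exp (d + a) ^ k * M)))].
    + assert (HD : 1 - rho <= Cmod (1 - p * p)%C).
      { eapply Rle_trans; [|apply one_minus_sqr_ge]. nra. }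
      assert (Hne : (1 - p * p)%C <> 0%C) by (apply Cmod_gt_0; lra).
      apply Rle_trans with
        (rsum (fun k => (4 / (1 - rho) * Cmod p * M) * rho ^ k) (S n)).
      * apply rsum_le. intros k _.
        assert (Hc : Cmod (resolvent_coef p k) <= 4 / (1 - rho) * Cmod p * Cmod p ^ k).
        { assert (Hi : / Cmod (1 - p * p)%C <= / (1 - rho)) by (apply Rinv_le_contravar; lra).
          assert (Hi0 : 0 < / Cmod (1 - p * p)%C) by (apply Rinv_0_lt_compat; lra).
          assert (H2 : Cmod 2 = 2) by (apply Cmod_nonneg; lra).
          assert (H4 : Cmod 4 = 4) by (apply Cmod_nonneg; lra).
          destruct k as [|k]; unfold resolvent_coef; rewrite Cmod_div, Cmod_mult by auto.
          - rewrite H2. simpl. unfold Rdiv. nra.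
          - rewrite H4, Cmod_pow.
            change (Cmod p ^ S (S k)) with (Cmod p * Cmod p ^ S k).
            pose proof (pow_le (Cmod p) (S k) Hp0).
            assert (0 <= Cmod p * Cmod p ^ S k) by nra.
            unfold Rdiv. nra. }
        assert (He : 0 <= exp (d + a) ^ k) by (apply pow_le; lra).
        assert (Hpk : (Cmod p * exp (d + a)) ^ k <= rho ^ k).
        { apply pow_incr; split; [nra|auto]. }
        rewrite Rpow_mult_distr in Hpk.
        apply Rle_trans with (4 / (1 - rho) * Cmod p * Cmod p ^ k * (exp (d + a) ^ k * M)).
        { apply Rmult_le_compat_r; [nra|auto]. }
        replace (4 / (1 - rho) * Cmod p * Cmod p ^ k * (exp (d + a) ^ k * M)) with
          (4 / (1 - rho) * Cmod p * M * (Cmod p ^ k * exp (d + a) ^ k)) by ring.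
        apply Rmult_le_compat_l; auto.
        assert (0 < 4 / (1 - rho)) by (apply Rdiv_lt_0_compat; lra).
        repeat apply Rmult_le_pos; lra.
      * rewrite rsum_scal.
        replace (4 / ((1 - rho) * (1 - rho)) * Cmod p * M) with
          (4 / (1 - rho) * Cmod p * M * / (1 - rho)) by (field; lra).
        apply Rmult_le_compat_l.
        -- assert (0 < 4 / (1 - rho)) by (apply Rdiv_lt_0_compat; lra).
           repeat apply Rmult_le_pos; lra.
        -- apply rsum_geometric; split; [nra|auto].
    + intros k _. apply coef_bound_scal, coef_bound_mult_T; auto.
  - intros x1 x2 Hx1 Hx2.
    replace (csum (fun k => resolvent_coef p k * (RtoC (chebyshev_T k x1) * G x1 x2)) (S n))%C
      with (csum (fun k => resolvent_coef p k * RtoC (chebyshev_T k x1)) (S n) * G x1 x2)%C.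
    2:{ rewrite Cmult_comm, <- csum_scal. apply csum_ext; intros; ring. }
    replace (/ (y - x1) * G x1 x2 -
      csum (fun k => resolvent_coef p k * RtoC (chebyshev_T k x1)) (S n) * G x1 x2)%C
      with ((/ (y - x1) - csum (fun k => resolvent_coef p k * RtoC (chebyshev_T k x1)) (S n))
         * G x1 x2)%C by ring.
    rewrite Cmod_mult.
    eapply Rle_trans; [|exact Hn].
    apply Rmult_le_compat; auto using Cmod_ge_0.
    apply resolvent_approx; auto.
Qed.

(** * Inverse of the Joukowski map *)

Lemma sqr_Cmod (z : C) : Cmod z * Cmod z = Re z * Re z + Im z * Im z.
Proof. pose proof (Cmod2_alt z) as H. simpl in H. rewrite !Rmult_1_r in H. exact H. Qed.

Lemma Cmod_le_abs (z : C) : Cmod z <= Rabs (Re z) + Rabs (Im z).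
Proof.
  apply Rsqr_incr_0_var.
  - unfold Rsqr. rewrite sqr_Cmod.
    pose proof (Rabs_pos (Re z)). pose proof (Rabs_pos (Im z)).
    pose proof (Rsqr_abs (Re z)). pose proof (Rsqr_abs (Im z)). unfold Rsqr in *. nra.
  - pose proof (Rabs_pos (Re z)). pose proof (Rabs_pos (Im z)). lra.
Qed.

Lemma csqrt_exists (z : C) : exists g : C, (g * g = z)%C.
Proof.
  destruct z as [a b]. set (r := Cmod (a, b)).
  assert (Hr : r * r = a * a + b * b) by (unfold r; rewrite sqr_Cmod; reflexivity).
  assert (Ha : - r <= a <= r).
  { pose proof (re_le_Cmod (a, b)) as H. fold r in H. simpl in H.
    apply Rabs_le_between in H. lra. }
  set (u := sqrt ((r + a) / 2)). set (v := sqrt ((r - a) / 2)).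
  assert (Hu : u * u = (r + a) / 2) by (apply sqrt_sqrt; lra).
  assert (Hv : v * v = (r - a) / 2) by (apply sqrt_sqrt; lra).
  assert (Huv : u * v = Rabs b / 2).
  { unfold u, v. rewrite <- sqrt_mult by lra.
    replace ((r + a) / 2 * ((r - a) / 2)) with ((b / 2) * (b / 2)) by nra.
    rewrite (sqrt_Rsqr_abs (b / 2) : sqrt ((b/2) * (b/2)) = _).
    unfold Rdiv. rewrite Rabs_mult, (Rabs_right (/ 2)); lra. }
  destruct (Rle_lt_dec 0 b) as [Hb|Hb].
  - exists (u, v). rewrite Rabs_right in Huv by lra.
    apply injective_projections; simpl; lra.
  - exists (u, - v). rewrite Rabs_left in Huv by lra.
    apply injective_projections; simpl; lra.
Qed.

Lemma joukowski_root_exists (y : C) :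
  exists p : C, (p * p - 2 * y * p + 1 = 0)%C /\ Cmod p <= 1.
Proof.
  destruct (csqrt_exists (y * y - 1)%C) as [g Hg].
  assert (E : ((y + g) * (y - g) = 1)%C).
  { transitivity (y * y - g * g)%C; [ring|]. rewrite Hg; ring. }
  destruct (Rle_lt_dec (Cmod (y + g)%C) 1) as [H|H].
  - exists (y + g)%C; split; auto.
    transitivity (g * g - (y * y - 1))%C; [ring|]. rewrite Hg; ring.
  - exists (y - g)%C; split.
    + transitivity (g * g - (y * y - 1))%C; [ring|]. rewrite Hg; ring.
    + apply (f_equal Cmod) in E. rewrite Cmod_mult, Cmod_1 in E.
      nra.
Qed.

(** On [[-1, 1]] both roots have modulus 1 and the choice between them is arbitrary; elsewhere the
    root is unique. *)
Definition psi (y : C) : C :=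
  proj1_sig (constructive_indefinite_description _ (joukowski_root_exists y)).

Lemma psi_root (y : C) : (psi y * psi y - 2 * y * psi y + 1 = 0)%C.
Proof.
  unfold psi. destruct (constructive_indefinite_description _ _) as [p H]; apply H.
Qed.

Lemma psi_le_1 (y : C) : Cmod (psi y) <= 1.
Proof.
  unfold psi. destruct (constructive_indefinite_description _ _) as [p H]; apply H.
Qed.

Lemma psi_outer (x : C) : ((x + (x - psi x)) * psi x = 1)%C.
Proof.
  transitivity (1 - (psi x * psi x - 2 * x * psi x + 1))%C; [ring|].
  rewrite psi_root; ring.
Qed.

Lemma joukowski_root_neq_0 (y p : C) : (p * p - 2 * y * p + 1 = 0)%C -> p <> 0%C.
Proof.
  intros H ->. apply (f_equal Re) in H. simpl in H. lra.
Qed.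

Lemma sinh_opp (x : R) : sinh (- x) = - sinh x.
Proof. unfold sinh. rewrite Ropp_involutive. lra. Qed.

Lemma sinh_ln (x : R) : 0 < x -> sinh (ln x) = (x - / x) / 2.
Proof. intros H. unfold sinh. now rewrite exp_Ropp, exp_ln. Qed.

(* [s = sinh (ln |p|)^2] satisfies the equation of the ellipse
   [X^2 / (1 + s) + Y^2 / s = 1], cleared of denominators. *)
Lemma joukowski_root_ellipse (y p : C) (s : R) :
  (p * p - 2 * y * p + 1 = 0)%C -> s = sinh (ln (Cmod p)) * sinh (ln (Cmod p)) ->
  s * s + s * (1 - Re y * Re y - Im y * Im y) = Im y * Im y.
Proof.
  intros H ->.
  assert (Hp : 0 < Cmod p) by (apply Cmod_gt_0; eapply joukowski_root_neq_0; eauto).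
  rewrite sinh_ln by auto.
  pose proof (sqr_Cmod p) as Hm.
  set (r := Cmod p) in *. clearbody r.
  destruct y as [X Y], p as [u v]. simpl in *.
  apply (f_equal Re) in H as H1. apply (f_equal Im) in H as H2. simpl in H1, H2.
  assert (E1 : 2 * X * (r * r) = u * (r * r + 1)).
  { rewrite Hm. apply (f_equal (Rmult u)) in H1. apply (f_equal (Rmult v)) in H2. lra. }
  assert (E2 : 2 * Y * (r * r) = v * (r * r - 1)).
  { rewrite Hm. apply (f_equal (Rmult v)) in H1. apply (f_equal (Rmult u)) in H2. lra. }
  assert (HX : X = u * (r * r + 1) / (2 * (r * r))) by (rewrite <- E1; field; lra).
  assert (HY : Y = v * (r * r - 1) / (2 * (r * r))) by (rewrite <- E2; field; lra).
  set (s := (r - / r) / 2 * ((r - / r) / 2)).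
  assert (F : X * X * s + Y * Y * (1 + s) = s * (1 + s)).
  { replace s with ((r * r - 1) * (r * r - 1) / (4 * (r * r))) by (unfold s; field; lra).
    rewrite HX, HY.
    transitivity ((r * r - 1) * (r * r - 1) * ((r * r + 1) * (r * r + 1)) * (u * u + v * v) /
      (16 * ((r * r) * (r * r) * (r * r)))); [field; lra|].
    rewrite <- Hm. field; lra. }
  lra.
Qed.

(** [s] is the nonnegative root of a quadratic with leading coefficient 1 and negative constant term
    [- Y2]; where the quadratic is nonpositive, [t] has not passed the root. *)
Lemma ellipse_root_ge (X2 Y2 s t : R) : 0 < Y2 -> 0 <= s -> 0 <= t ->
  s * s + s * (1 - X2 - Y2) = Y2 -> t * (t + 1 - X2 - Y2) <= Y2 -> t <= s.
Proof.
  intros HY Hs Ht E H. destruct (Rle_lt_dec t s) as [|Hts]; auto.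
  assert (0 < s) by (destruct Hs as [|<-]; [auto|lra]).
  assert (Y2 * (t - s) + s * t * (t - s) <= 0).
  { replace (Y2 * (t - s) + s * t * (t - s)) with
      (s * (t * (t + 1 - X2 - Y2) - Y2) - t * (s * s + s * (1 - X2 - Y2) - Y2)) by ring.
    replace (s * s + s * (1 - X2 - Y2) - Y2) with 0 by lra. nra. }
  assert (0 < Y2 * (t - s)) by nra.
  assert (0 < s * t * (t - s)) by (repeat apply Rmult_lt_0_compat; lra). lra.
Qed.

Lemma sinh_le (x y : R) : x <= y -> sinh x <= sinh y.
Proof. intros [H| ->]; [left; now apply sinh_lt|lra]. Qed.

Lemma sinh_le_inv (x y : R) : sinh x <= sinh y -> x <= y.
Proof.
  intros H. destruct (Rle_lt_dec x y) as [|H1]; auto.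
  apply sinh_lt in H1. lra.
Qed.

Lemma sinh_nonneg (x : R) : 0 <= x -> 0 <= sinh x.
Proof. intros H. rewrite <- sinh_0. now apply sinh_le. Qed.

(** The last inequality places [y] on or outside the ellipse with semi-axes [sqrt (1 + b^2)] and
    [b]. Allowing [sinh a <= b] instead of equality lets the applications use polynomial bounds. *)
Lemma joukowski_root_le (y p : C) (a b : R) :
  (p * p - 2 * y * p + 1 = 0)%C -> Cmod p <= 1 -> Im y <> 0 ->
  0 <= b -> sinh a <= b ->
  b * b * (b * b + 1 - Re y * Re y - Im y * Im y) <= Im y * Im y ->
  Cmod p <= exp (- a).
Proof.
  intros H Hp HY Hb Hab HB.
  assert (Hp0 : 0 < Cmod p) by (apply Cmod_gt_0; eapply joukowski_root_neq_0; eauto).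
  assert (L : ln (Cmod p) <= 0).
  { rewrite <- ln_1. destruct Hp as [Hp|Hp]; [left; now apply ln_increasing|].
    rewrite Hp; lra. }
  assert (HS : b <= sinh (- ln (Cmod p))).
  { apply Rsqr_incr_0_var; [|apply sinh_nonneg; lra]. unfold Rsqr.
    rewrite sinh_opp, Rmult_opp_opp.
    apply (ellipse_root_ge (Re y * Re y) (Im y * Im y)); try nra.
    now apply (joukowski_root_ellipse y p). }
  assert (a <= - ln (Cmod p)) by (apply sinh_le_inv; lra).
  rewrite <- (exp_ln (Cmod p)) by auto. apply exp_le_compat; lra.
Qed.

Lemma joukowski_root_le_Re (y p : C) :
  (p * p - 2 * y * p + 1 = 0)%C -> Cmod p <= 1 -> Cmod p * Cmod y <= 1.
Proof.
  intros H Hp.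
  assert (E : (2 * (p * y) = p * p + 1)%C).
  { transitivity ((p * p - 2 * y * p + 1) * (-1) + (p * p + 1))%C; [|rewrite H]; ring. }
  apply (f_equal Cmod) in E.
  pose proof (Cmod_triangle (p * p) 1) as HT.
  assert (H2 : Cmod 2 = 2) by (apply Cmod_nonneg; lra).
  rewrite !Cmod_mult, H2 in E. rewrite Cmod_mult, Cmod_1 in HT.
  pose proof (Cmod_ge_0 p). nra.
Qed.

(** Since [1 - p p'] does not vanish when one root is strictly inside the disc, this identity gives
    both continuity and differentiability of [psi], whatever the choice made in its definition. *)
Lemma joukowski_root_diff (y y' p p' : C) :
  (p * p - 2 * y * p + 1 = 0)%C -> (p' * p' - 2 * y' * p' + 1 = 0)%C ->
  ((p' - p) * (1 - p * p') = - (2) * (y' - y) * (p * p'))%C.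
Proof.
  intros H H'.
  transitivity (- (2) * (y' - y) * (p * p') + p' * (p * p - 2 * y * p + 1)
    - p * (p' * p' - 2 * y' * p' + 1))%C; [ring|].
  rewrite H, H'; ring.
Qed.

(** * A discrete Cauchy theorem *)

(* The quadratic remainder is uniform because [grid_cauchy] adds it up over the cells
   of a grid. *)
Definition regular (S : C -> Prop) (f : C -> C) : Prop :=
  exists (f' : C -> C) (B : R), forall w, S w ->
    Cmod (f w) <= B /\ Cmod (f' w) <= B /\
    forall w', S w' ->
      Cmod (f w' - f w) <= B * Cmod (w' - w) /\
      Cmod (f w' - f w - f' w * (w' - w)) <= B * (Cmod (w' - w) * Cmod (w' - w)).

Lemma regular_ext (S : C -> Prop) (f g : C -> C) :
  (forall w, S w -> f w = g w) -> regular S f -> regular S g.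
Proof.
  intros E (f' & B & H). exists f', B. intros w Hw.
  destruct (H w Hw) as (H1 & H2 & H3). rewrite <- E by auto.
  repeat split; auto; rewrite <- E by auto; now apply H3.
Qed.

Lemma regular_const (S : C -> Prop) (c : C) : regular S (fun _ => c).
Proof.
  exists (fun _ => 0%C), (Cmod c). intros w Hw.
  rewrite Cmod_0. repeat split; try apply Cmod_ge_0; try lra.
  - replace (c - c)%C with (RtoC 0) by ring. rewrite Cmod_0.
    apply Rmult_le_pos; apply Cmod_ge_0.
  - replace (c - c - 0 * (w' - w))%C with (RtoC 0) by ring. rewrite Cmod_0.
    repeat apply Rmult_le_pos; apply Cmod_ge_0.
Qed.

Lemma Cmod_mult_le (x y : C) (a b : R) :
  Cmod x <= a -> Cmod y <= b -> Cmod (x * y)%C <= a * b.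
Proof.
  intros. rewrite Cmod_mult. apply Rmult_le_compat; auto using Cmod_ge_0.
Qed.

Lemma Cmod_add3 (a b c : C) : Cmod (a + b + c) <= Cmod a + Cmod b + Cmod c.
Proof.
  pose proof (Cmod_triangle (a + b) c). pose proof (Cmod_triangle a b). lra.
Qed.

Lemma regular_plus (S : C -> Prop) (f g : C -> C) :
  regular S f -> regular S g -> regular S (fun w => f w + g w)%C.
Proof.
  intros (f' & B1 & Hf) (g' & B2 & Hg).
  exists (fun w => f' w + g' w)%C, (B1 + B2). intros w Hw.
  destruct (Hf w Hw) as (F1 & F2 & F3). destruct (Hg w Hw) as (G1 & G2 & G3).
  split; [|split].
  - eapply Rle_trans; [apply Cmod_triangle|lra].
  - eapply Rle_trans; [apply Cmod_triangle|lra].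
  - intros w' Hw'. destruct (F3 w' Hw') as [F4 F5]. destruct (G3 w' Hw') as [G4 G5].
    split.
    + replace (f w' + g w' - (f w + g w))%C with ((f w' - f w) + (g w' - g w))%C by ring.
      eapply Rle_trans; [apply Cmod_triangle|]. lra.
    + replace (f w' + g w' - (f w + g w) - (f' w + g' w) * (w' - w))%C with
        ((f w' - f w - f' w * (w' - w)) + (g w' - g w - g' w * (w' - w)))%C by ring.
      eapply Rle_trans; [apply Cmod_triangle|]. lra.
Qed.

Lemma regular_mult (S : C -> Prop) (f g : C -> C) :
  regular S f -> regular S g -> regular S (fun w => f w * g w)%C.
Proof.
  intros (f' & B1 & Hf) (g' & B2 & Hg).
  exists (fun w => f' w * g w + f w * g' w)%C, (3 * (B1 * B2)). intros w Hw.
  destruct (Hf w Hw) as (F1 & F2 & F3). destruct (Hg w Hw) as (G1 & G2 & G3).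
  pose proof (Cmod_ge_0 (f w)). pose proof (Cmod_ge_0 (g w)).
  assert (0 <= B1 * B2) by nra.
  assert (P : forall x y u v, Cmod x <= B1 * u -> Cmod y <= B2 * v -> 0 <= u -> 0 <= v ->
    Cmod (x * y)%C <= B1 * B2 * (u * v)).
  { intros x y u v Hx Hy Hu Hv. rewrite Cmod_mult.
    replace (B1 * B2 * (u * v)) with ((B1 * u) * (B2 * v)) by ring.
    apply Rmult_le_compat; auto using Cmod_ge_0. }
  split; [|split].
  - assert (Cmod (f w * g w)%C <= B1 * B2 * (1 * 1)) by (apply P; lra). lra.
  - assert (Cmod (f' w * g w)%C <= B1 * B2 * (1 * 1)) by (apply P; lra).
    assert (Cmod (f w * g' w)%C <= B1 * B2 * (1 * 1)) by (apply P; lra).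
    pose proof (Cmod_triangle (f' w * g w) (f w * g' w)). lra.
  - intros w' Hw'. destruct (F3 w' Hw') as [F4 F5]. destruct (G3 w' Hw') as [G4 G5].
    destruct (Hf w' Hw') as (F1' & _). destruct (Hg w' Hw') as (G1' & _).
    set (h := Cmod (w' - w)) in *. assert (0 <= h) by apply Cmod_ge_0.
    split.
    + replace (f w' * g w' - f w * g w)%C with
        ((f w' - f w) * g w' + f w * (g w' - g w))%C by ring.
      assert (Cmod ((f w' - f w) * g w')%C <= B1 * B2 * (h * 1)) by (apply P; lra).
      assert (Cmod (f w * (g w' - g w))%C <= B1 * B2 * (1 * h)) by (apply P; lra).
      pose proof (Cmod_triangle ((f w' - f w) * g w') (f w * (g w' - g w))). nra.
    + replace (f w' * g w' - f w * g w - (f' w * g w + f w * g' w) * (w' - w))%C with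
        ((f w' - f w - f' w * (w' - w)) * g w + f w * (g w' - g w - g' w * (w' - w))
          + (f w' - f w) * (g w' - g w))%C by ring.
      assert (0 <= h * h) by nra.
      assert (Cmod ((f w' - f w - f' w * (w' - w)) * g w)%C <= B1 * B2 * (h * h * 1))
        by (apply P; lra).
      assert (Cmod (f w * (g w' - g w - g' w * (w' - w)))%C <= B1 * B2 * (1 * (h * h)))
        by (apply P; lra).
      assert (Cmod ((f w' - f w) * (g w' - g w))%C <= B1 * B2 * (h * h)) by (apply P; lra).
      eapply Rle_trans; [apply Cmod_add3|]. nra.
Qed.

Lemma regular_pow (S : C -> Prop) (f : C -> C) (n : nat) :
  regular S f -> regular S (fun w => f w ^ n)%C.
Proof.
  intros H. induction n as [|n IH].
  - exact (regular_const S 1%C).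
  - apply (regular_mult S f (fun w => f w ^ n)%C); auto.
Qed.

Lemma regular_inv (S : C -> Prop) (f : C -> C) (m : R) : 0 < m ->
  (forall w, S w -> m <= Cmod (f w)) -> regular S f -> regular S (fun w => / f w)%C.
Proof.
  intros Hm Hf (f' & B & H).
  exists (fun w => - f' w * (/ f w * / f w))%C.
  set (i := / m).
  (* The three terms bound the value, the derivative with the Lipschitz quotient, and the quadratic
     remainder. *)
  exists (i + B * (i * i) + 2 * (B * B) * (i * i * i)).
  assert (I : forall w, S w -> f w <> 0%C /\ Cmod (/ f w)%C <= i).
  { intros w Hw. specialize (Hf w Hw).
    assert (f w <> 0%C) by (apply Cmod_gt_0; lra).
    split; auto. rewrite Cmod_inv by auto. apply Rinv_le_contravar; auto. }
  intros w Hw. destruct (H w Hw) as (F1 & F2 & F3). destruct (I w Hw) as [N1 I1].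
  pose proof (Cmod_ge_0 (f w)).
  pose proof (Cmod_ge_0 (/ f w)%C) as J1.
  assert (0 <= B * (i * i)) by (apply Rmult_le_pos; nra).
  assert (0 <= B * B * (i * i * i)) by (apply Rmult_le_pos; [nra|]; repeat apply Rmult_le_pos; lra).
  split; [|split].
  - lra.
  - rewrite !Cmod_mult, Cmod_opp.
    assert (Cmod (f' w) * (Cmod (/ f w) * Cmod (/ f w)) <= B * (i * i)).
    { apply Rmult_le_compat; auto using Cmod_ge_0. nra. apply Rmult_le_compat; auto. }
    lra.
  - intros w' Hw'. destruct (F3 w' Hw') as [F4 F5]. destruct (I w' Hw') as [N2 I2].
    pose proof (Cmod_ge_0 (/ f w')%C) as J2.
    set (h := Cmod (w' - w)) in *. assert (0 <= h) by apply Cmod_ge_0.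
    split.
    + replace (/ f w' - / f w)%C with (- (f w' - f w) * (/ f w * / f w'))%C
        by (field; auto).
      rewrite !Cmod_mult, Cmod_opp.
      apply Rle_trans with (B * h * (i * i)).
      * apply Rmult_le_compat; auto using Cmod_ge_0. nra. apply Rmult_le_compat; auto.
      * nra.
    + replace (/ f w' - / f w - - f' w * (/ f w * / f w) * (w' - w))%C with
        ((- (f w' - f w - f' w * (w' - w)) * f w' + (f w' - f w) * (f w' - f w)) *
          (/ f w * (/ f w * / f w')))%C by (field; auto).
      rewrite Cmod_mult.
      destruct (H w' Hw') as (F1' & _).
      apply Rle_trans with (2 * (B * B) * (h * h) * (i * (i * i))).
      * apply Rmult_le_compat; auto using Cmod_ge_0.
        -- eapply Rle_trans; [apply Cmod_triangle|]. rewrite !Cmod_mult, Cmod_opp.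
           assert (Cmod (f w' - f w - f' w * (w' - w)) * Cmod (f w') <= B * (h * h) * B)
             by (apply Rmult_le_compat; auto using Cmod_ge_0).
           assert (Cmod (f w' - f w) * Cmod (f w' - f w) <= B * h * (B * h))
             by (apply Rmult_le_compat; auto using Cmod_ge_0).
           lra.
        -- rewrite !Cmod_mult. apply Rmult_le_compat; auto. nra.
           apply Rmult_le_compat; auto.
      * assert (0 <= h * h) by nra.
        replace (2 * (B * B) * (h * h) * (i * (i * i))) with
          (2 * (B * B * (i * i * i)) * (h * h)) by ring.
        apply Rmult_le_compat_r; auto. lra.
Qed.

(** The derivative [- 2 y' p^2 / (1 - p^2)] is the limit of [joukowski_root_diff]; the uniform bound
    [rho] keeps the denominators [1 - p p'] away from 0. *)
Lemma regular_psi (S : C -> Prop) (y : C -> C) (rho : R) : rho < 1 ->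
  (forall w, S w -> Cmod (psi (y w)) <= rho) -> regular S y ->
  regular S (fun w => psi (y w)).
Proof.
  intros Hr Hp (y' & B & H).
  set (i := / (1 - rho)). assert (Hi : 0 < i) by (apply Rinv_0_lt_compat; lra).
  exists (fun w => - (2) * y' w * (psi (y w) * psi (y w)) * / (1 - psi (y w) * psi (y w)))%C.
  exists (1 + 2 * B * i + 4 * (B * B) * (i * i * i)).
  assert (P2 : forall w w', S w -> S w' ->
    Cmod (psi (y w) * psi (y w'))%C <= 1 /\
    (1 - psi (y w) * psi (y w'))%C <> 0%C /\ Cmod (/ (1 - psi (y w) * psi (y w')))%C <= i).
  { intros w w' Hw Hw'. pose proof (Hp w Hw). pose proof (Hp w' Hw').
    pose proof (Cmod_ge_0 (psi (y w'))).
    assert (Cmod (psi (y w) * psi (y w'))%C <= rho) by (rewrite Cmod_mult; nra).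
    pose proof (Cmod_minus_ge 1 (psi (y w) * psi (y w'))) as HG. rewrite Cmod_1 in HG.
    assert (N : (1 - psi (y w) * psi (y w'))%C <> 0%C) by (apply Cmod_gt_0; lra).
    repeat split; auto; [lra|]. rewrite Cmod_inv by auto. apply Rinv_le_contravar; lra. }
  assert (H2 : Cmod (- (2))%C = 2) by (rewrite Cmod_opp; apply Cmod_nonneg; lra).
  intros w Hw. destruct (H w Hw) as (F1 & F2 & F3).
  pose proof (Cmod_ge_0 (y w)).
  destruct (P2 w w Hw Hw) as (Q1 & Q2 & Q3).
  set (p := psi (y w)) in *.
  assert (0 <= B * i) by nra.
  assert (0 <= B * B * (i * i * i)) by (apply Rmult_le_pos; [nra|]; repeat apply Rmult_le_pos; lra).
  split; [|split].
  - assert (Cmod p <= rho) by (apply Hp; auto). lra.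
  - assert (Cmod (- (2) * y' w * (p * p) * / (1 - p * p))%C <= 2 * B * 1 * i)
      by (repeat (apply Cmod_mult_le; auto); lra).
    lra.
  - intros w' Hw'. destruct (F3 w' Hw') as [F4 F5].
    destruct (P2 w w' Hw Hw') as (R1 & R2 & R3).
    pose proof (joukowski_root_diff (y w) (y w') p (psi (y w'))
      (psi_root _) (psi_root _)) as HD.
    fold p in R1, R2, R3. set (p' := psi (y w')) in *.
    set (h := Cmod (w' - w)) in *. assert (0 <= h) by apply Cmod_ge_0.
    assert (E : (p' - p = - (2) * (y w' - y w) * (p * p') * / (1 - p * p'))%C).
    { rewrite <- HD. field; auto. }
    assert (L : Cmod (p' - p)%C <= 2 * (B * h) * 1 * i).
    { rewrite E. repeat (apply Cmod_mult_le; auto); lra. }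
    split.
    + eapply Rle_trans; [exact L|].
      nra.
    + replace (p' - p - - (2) * y' w * (p * p) * / (1 - p * p) * (w' - w))%C with
       (- (2) * (y w' - y w - y' w * (w' - w)) * (p * p) * / (1 - p * p)
        + - (2) * (y w' - y w) * (p * (p' - p)) * (/ (1 - p * p') * / (1 - p * p)))%C.
      2:{ rewrite E at 2. field; auto. }
      eapply Rle_trans; [apply Cmod_triangle|].
      assert (Hpp : Cmod p <= 1) by apply psi_le_1.
      assert (A1 : Cmod (- (2) * (y w' - y w - y' w * (w' - w)) * (p * p) * / (1 - p * p))%C
        <= 2 * (B * (h * h)) * 1 * i).
      { repeat (apply Cmod_mult_le; auto); lra. }
      assert (A2 : Cmod (- (2) * (y w' - y w) * (p * (p' - p)) *
         (/ (1 - p * p') * / (1 - p * p)))%C <= 2 * (B * h) * (1 * (2 * (B * h) * 1 * i)) * (i * i)).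
      { repeat (apply Cmod_mult_le; auto); lra. }
      replace (2 * (B * h) * (1 * (2 * (B * h) * 1 * i)) * (i * i)) with
        (4 * (B * B * (i * i * i)) * (h * h)) in A2 by ring.
      nra.
Qed.

Definition rectangle (T : R) (w : C) : Prop := 0 <= Re w <= PI /\ 0 <= Im w <= T.

(** The midpoint rule around a cell annihilates affine functions, so each of the [N^2] cells
    contributes only a quadratic remainder times an edge length, of order [N^(-3)]. Summing over the
    cells cancels the interior edges and leaves an error of order [1 / N]. *)
Lemma grid_cauchy (T : R) (f : C -> C) (top side : R) : 0 < T ->
  regular (rectangle T) f ->
  (forall t, 0 <= t <= PI -> Cmod (f (t, T)) <= top) ->
  (forall u, 0 <= u <= T -> Cmod (f (0, u)) <= side /\ Cmod (f (PI, u)) <= side) ->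
  exists K, forall N, (0 < N)%nat ->
    Cmod (RtoC (PI / INR N) * csum (fun j => f (node_angle N j, 0)) N)%C
      <= PI * top + 2 * T * side + K / INR N.
Proof.
  intros HT (f' & B & H) Htop Hside.
  pose proof PI_RGT_0 as HPI.
  exists (B * PI * T * (PI + T) / 2). intros N HN.
  assert (HN0 : 0 < INR N) by now apply lt_0_INR.
  set (d1 := PI / INR N). set (d2 := T / INR N).
  assert (Hd1 : 0 < d1) by now apply Rdiv_lt_0_compat.
  assert (Hd2 : 0 < d2) by now apply Rdiv_lt_0_compat.
  assert (Nd1 : INR N * d1 = PI) by (unfold d1; field; lra).
  assert (Nd2 : INR N * d2 = T) by (unfold d2; field; lra).
  (* Edge midpoints; those of the bottom row [l = 0] are exactly the angles of the Gauss nodes. *)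
  set (bot := fun j l : nat => (INR j * d1 + d1 / 2, INR l * d2) : C).
  set (lef := fun j l : nat => (INR j * d1, INR l * d2 + d2 / 2) : C).
  assert (HI : forall j, (j < N)%nat -> 0 <= INR j /\ INR j + 1 <= INR N).
  { intros j Hj. split; [apply pos_INR|]. rewrite <- S_INR. apply le_INR; lia. }
  assert (Hcell : forall j l, (j < N)%nat -> (l < N)%nat ->
    Cmod (RtoC d1 * (f (bot j l) - f (bot j (S l)))
      + Ci * RtoC d2 * (f (lef (S j) l) - f (lef j l)))%C
      <= B * d1 * d2 * (d1 + d2) / 2).
  { intros j l Hj Hl. destruct (HI j Hj) as [J1 J2]. destruct (HI l Hl) as [L1 L2].
    set (w0 := (INR j * d1 + d1 / 2, INR l * d2 + d2 / 2) : C).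
    assert (R0 : rectangle T w0) by (unfold rectangle, w0; simpl; nra).
    assert (R1 : rectangle T (bot j l)) by (unfold rectangle, bot; simpl; nra).
    assert (R2 : rectangle T (bot j (S l)))
      by (unfold rectangle, bot; unfold Re, Im, fst, snd; rewrite S_INR; nra).
    assert (R3 : rectangle T (lef j l)) by (unfold rectangle, lef; simpl; nra).
    assert (R4 : rectangle T (lef (S j) l))
      by (unfold rectangle, lef; unfold Re, Im, fst, snd; rewrite S_INR; nra).
    destruct (H w0 R0) as (_ & _ & HR).
    set (h1 := (0, - d2 / 2) : C).
    assert (D1 : (bot j l - w0)%C = h1)
      by (unfold h1, bot, w0; apply injective_projections; simpl; field).
    set (h2 := (0, d2 / 2) : C).
    assert (D2 : (bot j (S l) - w0)%C = h2)
      by (unfold h2, bot, w0; rewrite S_INR; apply injective_projections; simpl; field).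
    set (h3 := (- d1 / 2, 0) : C).
    assert (D3 : (lef j l - w0)%C = h3)
      by (unfold h3, lef, w0; apply injective_projections; simpl; field).
    set (h4 := (d1 / 2, 0) : C).
    assert (D4 : (lef (S j) l - w0)%C = h4)
      by (unfold h4, lef, w0; rewrite S_INR; apply injective_projections; simpl; field).
    destruct (HR _ R1) as [_ E1]. destruct (HR _ R2) as [_ E2].
    destruct (HR _ R3) as [_ E3]. destruct (HR _ R4) as [_ E4].
    rewrite D1, sqr_Cmod in E1. rewrite D2, sqr_Cmod in E2.
    rewrite D3, sqr_Cmod in E3. rewrite D4, sqr_Cmod in E4. simpl in E1, E2, E3, E4.
    set (e1 := (f (bot j l) - f w0 - f' w0 * h1)%C) in *.
    set (e2 := (f (bot j (S l)) - f w0 - f' w0 * h2)%C) in *.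
    set (e3 := (f (lef j l) - f w0 - f' w0 * h3)%C) in *.
    set (e4 := (f (lef (S j) l) - f w0 - f' w0 * h4)%C) in *.
    replace (RtoC d1 * (f (bot j l) - f (bot j (S l)))
      + Ci * RtoC d2 * (f (lef (S j) l) - f (lef j l)))%C with
      (RtoC d1 * (e1 - e2) + Ci * RtoC d2 * (e4 - e3))%C.
    - eapply Rle_trans; [apply Cmod_triangle|].
      rewrite !Cmod_mult, Cmod_Ci, !Cmod_R, !Rabs_right by lra.
      pose proof (Cmod_triangle e1 (- e2)) as T1. pose proof (Cmod_triangle e4 (- e3)) as T2.
      rewrite Cmod_opp in T1, T2. fold (e1 - e2)%C in T1. fold (e4 - e3)%C in T2.
      assert (d1 * Cmod (e1 - e2)%C <= d1 * (B * (d2 * d2) / 2)) by (apply Rmult_le_compat_l; lra).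
      assert (d2 * Cmod (e4 - e3)%C <= d2 * (B * (d1 * d1) / 2)) by (apply Rmult_le_compat_l; lra).
      lra.
    - unfold e1, e2, e3, e4.
      match goal with |- ?L = ?Q => transitivity (Q + f' w0 * (RtoC d1 * (h2 - h1)
        + Ci * RtoC d2 * (h3 - h4)))%C; [ring|] end.
      (* The linear parts cancel: [d1 (h2 - h1) = i d1 d2] and [i d2 (h3 - h4) = - i d1 d2]. *)
      replace (RtoC d1 * (h2 - h1)
        + Ci * RtoC d2 * (h3 - h4))%C with (RtoC 0); [ring|].
      unfold h1, h2, h3, h4. apply injective_projections; simpl; field. }
  assert (Hsum : Cmod (csum (fun j => csum (fun l => RtoC d1 * (f (bot j l) - f (bot j (S l)))
      + Ci * RtoC d2 * (f (lef (S j) l) - f (lef j l))) N) N)%C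
      <= INR N * (INR N * (B * d1 * d2 * (d1 + d2) / 2))).
  { apply csum_Cmod_le. intros j Hj. apply csum_Cmod_le. intros l Hl. auto. }
  set (tops := csum (fun j => f (bot j N)) N).
  set (bots := csum (fun j => f (bot j O)) N).
  set (lefs := csum (fun l => f (lef O l)) N).
  set (rigs := csum (fun l => f (lef N l)) N).
  assert (E : csum (fun j => csum (fun l => RtoC d1 * (f (bot j l) - f (bot j (S l)))
      + Ci * RtoC d2 * (f (lef (S j) l) - f (lef j l))) N)%C N =
      (RtoC d1 * (bots - tops) + Ci * RtoC d2 * (rigs - lefs))%C).
  { rewrite (csum_ext _ (fun j => RtoC d1 * (f (bot j O) - f (bot j N)) +
      Ci * RtoC d2 * csum (fun l => f (lef (S j) l) - f (lef j l)) N)%C).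
    - rewrite csum_plus, !csum_scal, csum_minus. fold tops bots.
      f_equal. f_equal. rewrite csum_swap.
      rewrite (csum_ext _ (fun l => f (lef N l) - f (lef O l))%C).
      + now rewrite csum_minus.
      + intros l _. now rewrite (csum_telescope (fun j => f (lef j l))).
    - intros j _. rewrite csum_plus, !csum_scal. f_equal. f_equal.
      rewrite (csum_ext _ (fun l => (-1) * (f (bot j (S l)) - f (bot j l)))%C) by (intros; ring).
      rewrite csum_scal, (csum_telescope (fun l => f (bot j l))). ring. }
  rewrite E in Hsum.
  replace (INR N * (INR N * (B * d1 * d2 * (d1 + d2) / 2))) with
    (B * PI * T * (PI + T) / 2 / INR N) in Hsum by (unfold d1, d2; field; lra).
  assert (HB0 : csum (fun j => f (node_angle N j, 0)) N = bots).
  { apply csum_ext. intros j _. unfold bot, node_angle, d1. f_equal.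
    apply injective_projections; simpl; field; lra. }
  rewrite HB0.
  replace (RtoC d1 * bots)%C with ((RtoC d1 * (bots - tops) + Ci * RtoC d2 * (rigs - lefs))
    + RtoC d1 * tops + - (Ci * RtoC d2 * (rigs - lefs)))%C by ring.
  eapply Rle_trans; [apply Cmod_add3|].
  rewrite Cmod_opp, !Cmod_mult, Cmod_Ci, !Cmod_R, !Rabs_right by lra.
  assert (Ht : Cmod tops <= INR N * top).
  { apply csum_Cmod_le. intros j Hj. destruct (HI j Hj) as [J1 J2].
    unfold bot. rewrite Nd2. apply Htop. nra. }
  assert (Hl : Cmod lefs <= INR N * side).
  { apply csum_Cmod_le. intros j Hj. destruct (HI j Hj) as [J1 J2].
    unfold lef. simpl INR. rewrite Rmult_0_l. apply Hside. nra. }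
  assert (Hr : Cmod rigs <= INR N * side).
  { apply csum_Cmod_le. intros j Hj. destruct (HI j Hj) as [J1 J2].
    unfold lef. rewrite Nd1. apply Hside. nra. }
  pose proof (Cmod_triangle rigs (- lefs)) as HT2. rewrite Cmod_opp in HT2.
  fold (rigs - lefs)%C in HT2.
  assert (d1 * Cmod tops <= PI * top).
  { apply Rle_trans with (d1 * (INR N * top)); [apply Rmult_le_compat_l; lra|].
    rewrite <- Nd1; lra. }
  assert (1 * d2 * Cmod (rigs - lefs)%C <= 2 * T * side).
  { apply Rle_trans with (d2 * (2 * (INR N * side))).
    - rewrite Rmult_1_l. apply Rmult_le_compat_l; lra.
    - rewrite <- Nd2; lra. }
  lra.
Qed.

(** * Elementary estimates *)

Lemma cosh_ge_1 (x : R) : 1 <= cosh x.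
Proof.
  unfold cosh. rewrite exp_Ropp. pose proof (exp_pos x) as H.
  set (e := exp x) in *. clearbody e.
  assert (0 <= (e - 1) * (e - 1) * / e) by (apply Rmult_le_pos; [apply Rle_0_sqr|left; now apply Rinv_0_lt_compat]).
  replace ((e + / e) / 2) with (1 + (e - 1) * (e - 1) * / e / 2) by (field; lra). lra.
Qed.

Lemma cosh_le_2 (x : R) : 0 <= x <= 1 -> cosh x <= 2.
Proof.
  intros H. unfold cosh.
  assert (exp x <= 3) by (eapply Rle_trans; [apply exp_le_compat, H|apply exp_le_3]).
  assert (exp (- x) <= 1) by (rewrite <- exp_0; apply exp_le_compat; lra). lra.
Qed.

Lemma cosh_sqr (x : R) : cosh x * cosh x = 1 + sinh x * sinh x.
Proof.
  unfold cosh, sinh. rewrite exp_Ropp. pose proof (exp_pos x). field; lra.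
Qed.

Lemma sinh_diff_le (x h : R) : 0 <= x -> 0 <= h -> x + h <= 1 ->
  sinh (x + h) <= sinh x + 2 * h.
Proof.
  intros Hx [Hh|<-] H; [|rewrite Rplus_0_r; lra].
  destruct (MVT_cor2 sinh cosh x (x + h)) as [c [E Hc]]; [lra| |].
  - intros; apply derivable_pt_lim_sinh.
  - pose proof (cosh_le_2 c ltac:(lra)). nra.
Qed.

Lemma sinh_le_2x (x : R) : 0 <= x <= 1 -> sinh x <= 2 * x.
Proof.
  intros H. pose proof (sinh_diff_le 0 x ltac:(lra) ltac:(lra) ltac:(lra)) as E.
  rewrite Rplus_0_l, sinh_0 in E. lra.
Qed.

Lemma sin_abs_le (x : R) : Rabs (sin x) <= Rabs x.
Proof.
  assert (P : forall x, 0 <= x -> Rabs (sin x) <= x).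
  { clear x; intros x [Hx|<-]; [|rewrite sin_0, Rabs_R0; lra].
    pose proof (sin_lt_x x Hx). destruct (Rle_lt_dec 1 x).
    - apply Rle_trans with 1; auto. apply Rabs_le, SIN_bound.
    - rewrite Rabs_right; [lra|]. apply Rle_ge, sin_ge_0; [lra|].
      pose proof PI_RGT_0; pose proof PI2_1; lra. }
  unfold Rabs at 2; destruct (Rcase_abs x).
  - replace x with (- - x) at 1 by ring. rewrite sin_neg, Rabs_Ropp. apply P; lra.
  - apply P; lra.
Qed.

Lemma one_minus_cos_le (x : R) : 0 <= 1 - cos x <= x * x / 2.
Proof.
  replace x with (2 * (x / 2)) at 1 2 by field. rewrite cos_2a_sin.
  pose proof (sin_abs_le (x / 2)) as H.
  apply Rsqr_le_abs_1 in H. unfold Rsqr in H. nra.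
Qed.

Lemma sin_minus_x_le (x : R) : Rabs (sin x - x) <= x * x.
Proof.
  destruct (Req_dec x 0) as [->|Hx].
  - rewrite sin_0, Rminus_0_r, Rabs_R0; lra.
  - destruct (MVT_gen sin 0 x cos) as [c [Hc E]].
    + intros; apply is_derive_sin.
    + intros; apply continuity_pt_filterlim, (continuous_sin _).
    + rewrite sin_0, !Rminus_0_r in E. rewrite E.
      replace (cos c * x - x) with (- ((1 - cos c) * x)) by ring.
      rewrite Rabs_Ropp, Rabs_mult.
      assert (Hc1 : Rabs (1 - cos c) <= Rabs c).
      { replace c with (2 * (c / 2)) at 1 by field. rewrite cos_2a_sin.
        pose proof (sin_abs_le (c / 2)) as S1.
        replace (1 - (1 - 2 * sin (c / 2) * sin (c / 2))) with
          (2 * (sin (c / 2) * sin (c / 2))) by ring.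
        rewrite !Rabs_mult, (Rabs_right 2) by lra.
        unfold Rdiv in S1 at 2. rewrite Rabs_mult, (Rabs_right (/ 2)) in S1 by lra.
        pose proof (Rabs_pos (sin (c / 2))).
        assert (Rabs (sin (c / 2)) <= 1) by (apply Rabs_le, SIN_bound). nra. }
      assert (Hc2 : Rabs c <= Rabs x).
      { unfold Rmin, Rmax in Hc. destruct (Rle_dec 0 x).
        - rewrite !Rabs_right; lra.
        - rewrite !Rabs_left1; lra. }
      replace (x * x) with (Rabs x * Rabs x) by (rewrite <- Rabs_mult, Rabs_right; nra).
      apply Rmult_le_compat_r; [apply Rabs_pos|lra].
Qed.

Lemma exp_remainder (x : R) : Rabs x <= / 4 ->
  0 <= exp x - 1 - x <= 2 * (x * x) /\ Rabs (exp x - 1) <= 2 * Rabs x.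
Proof.
  intros H. apply Rabs_le_between in H.
  pose proof (exp_ineq1_le x) as H1. pose proof (exp_ineq1_le (- x)) as H2.
  rewrite exp_Ropp in H2.
  assert (H4 : exp x * (1 - x) <= 1).
  { apply (Rmult_le_compat_l (exp x)) in H2; [|lra]. rewrite Rinv_r in H2; lra. }
  split; [split|]; [lra| nra |].
  apply Rabs_le. unfold Rabs; destruct (Rcase_abs x); nra.
Qed.

(** * The complex cosine on a half strip *)

(** The entire function [e^(i w)]. *)
Definition expi (w : C) : C := (exp (- Im w) * cos (Re w), exp (- Im w) * sin (Re w)).

Lemma expi_plus (w h : C) : expi (w + h)%C = (expi w * expi h)%C.
Proof.
  destruct w as [a b], h as [u v]. unfold expi; simpl.
  rewrite Ropp_plus_distr, exp_plus, cos_plus, sin_plus.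
  apply injective_projections; simpl; ring.
Qed.

Lemma Cmod_expi (w : C) : Cmod (expi w) = exp (- Im w).
Proof.
  pose proof (sqr_Cmod (expi w)) as H. unfold expi in H at 3 4 5 6; simpl in H.
  pose proof (sin2_cos2 (Re w)) as S. unfold Rsqr in S.
  pose proof (exp_pos (- Im w)). pose proof (Cmod_ge_0 (expi w)).
  apply Rsqr_inj; [auto|lra|]. unfold Rsqr. rewrite H.
  transitivity (exp (- Im w) * exp (- Im w) *
    (sin (Re w) * sin (Re w) + cos (Re w) * cos (Re w))); [ring|rewrite S; ring].
Qed.

Lemma expi_opp (w : C) : (expi w * expi (- w) = 1)%C.
Proof.
  rewrite <- expi_plus. replace (w + - w)%C with (RtoC 0) by ring.
  unfold expi; simpl. rewrite Ropp_0, exp_0, cos_0, sin_0.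
  apply injective_projections; simpl; ring.
Qed.

Lemma expi_small (h : C) : Rabs (Im h) <= / 4 ->
  Cmod (expi h - 1 - Ci * h)%C <= 4 * (Cmod h * Cmod h).
Proof.
  destruct h as [a b]; simpl. intros Hb.
  rewrite sqr_Cmod; simpl.
  eapply Rle_trans; [apply Cmod_le_abs|]. unfold expi; simpl.
  rewrite <- Rabs_Ropp in Hb. destruct (exp_remainder (- b) Hb) as [E1 E2].
  rewrite Rabs_Ropp in E2, Hb.
  set (e := exp (- b)) in *.
  assert (He : 0 < e <= 2).
  { split; [apply exp_pos|]. apply Rabs_le_between in E2. lra. }
  pose proof (one_minus_cos_le a) as C1. pose proof (sin_minus_x_le a) as S1.
  assert (A1 : Rabs (e * cos a + - (1) + - (0 * a - 1 * b)) <= a * a + 2 * (b * b)).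
  { replace (e * cos a + - (1) + - (0 * a - 1 * b)) with
      (- (e * (1 - cos a)) + (e - 1 - - b)) by ring.
    eapply Rle_trans; [apply Rabs_triang|]. rewrite Rabs_Ropp.
    rewrite Rabs_right by nra. rewrite Rabs_right by lra. nra. }
  assert (A2 : Rabs (e * sin a + - 0 + - (0 * b + 1 * a)) <= 2 * (a * a) + (a * a + b * b)).
  { replace (e * sin a + - 0 + - (0 * b + 1 * a)) with
      (e * (sin a - a) + (e - 1) * a) by ring.
    eapply Rle_trans; [apply Rabs_triang|]. rewrite !Rabs_mult, (Rabs_right e) by lra.
    pose proof (Rabs_pos (sin a - a)). pose proof (Rabs_pos a).
    assert (Rabs a * Rabs a = a * a) by (rewrite <- Rabs_mult, Rabs_right; nra).
    assert (Rabs b * Rabs b = b * b) by (rewrite <- Rabs_mult, Rabs_right; nra).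
    pose proof (Rle_0_sqr (Rabs a - Rabs b)) as HQ. unfold Rsqr in HQ. nra. }
  replace (0 * a - 1 * b) with (0 * a - 1 * b) in A1 by ring.
  eapply Rle_trans; [apply Rplus_le_compat; [exact A1|exact A2]|]. nra.
Qed.

Lemma regular_expi (T : R) : T <= / 4 -> regular (rectangle T) expi.
Proof.
  (* Increments within the rectangle have modulus at most 6, so the remainder [4 |h|^2] and the
     linear term [|h|] add up to at most [25 |h|]. *)
  intros HT. exists (fun w => Ci * expi w)%C, 25.
  assert (P : forall w, rectangle T w -> Cmod (expi w) <= 1).
  { intros w [_ Hw]. rewrite Cmod_expi, <- exp_0. apply exp_le_compat; lra. }
  intros w Hw. pose proof (P w Hw) as Pw.
  split; [lra|split].
  - rewrite Cmod_mult, Cmod_Ci; lra.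
  - intros w' Hw'.
    replace (expi w' ) with (expi w * expi (w' - w))%C
      by (rewrite <- expi_plus; f_equal; ring).
    set (h := (w' - w)%C).
    destruct Hw as [Hw1 Hw2], Hw' as [Hw1' Hw2'].
    assert (Hh : Rabs (Im h) <= / 4) by (unfold h; simpl; apply Rabs_le; unfold Im in *; lra).
    assert (Hh2 : Cmod h <= 6).
    { eapply Rle_trans; [apply Cmod_le_abs|].
      assert (Rabs (Re h) <= 4); [|lra].
      unfold h; simpl; apply Rabs_le; unfold Re in *; pose proof PI_4; lra. }
    pose proof (expi_small h Hh) as Hs. pose proof (Cmod_ge_0 h) as Hh0.
    assert (0 <= Cmod h * Cmod h) by nra.
    split.
    + replace (expi w * expi h - expi w)%C with
        (expi w * ((expi h - 1 - Ci * h) + Ci * h))%C by ring.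
      replace (25 * Cmod h) with (1 * (25 * Cmod h)) by ring.
      apply Cmod_mult_le; auto.
      eapply Rle_trans; [apply Cmod_triangle|].
      rewrite (Cmod_mult Ci), Cmod_Ci. nra.
    + replace (expi w * expi h - expi w - Ci * expi w * h)%C with
        (expi w * (expi h - 1 - Ci * h))%C by ring.
      replace (25 * (Cmod h * Cmod h)) with (1 * (25 * (Cmod h * Cmod h))) by ring.
      apply Cmod_mult_le; auto. lra.
Qed.

Lemma regular_expi_opp (T : R) : T <= / 4 -> regular (rectangle T) (fun w => expi (- w))%C.
Proof.
  intros HT.
  apply (regular_ext _ (fun w => / expi w)%C).
  - intros w _. assert (H : expi w <> 0%C)
      by (apply Cmod_gt_0; rewrite Cmod_expi; apply exp_pos).
    rewrite <- (Cmult_1_l (/ expi w)), <- (expi_opp w). field; auto.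
  - apply (regular_inv _ _ (exp (- (/ 4)))); [apply exp_pos| |now apply regular_expi].
    intros w [_ Hw]. rewrite Cmod_expi. apply exp_le_compat; lra.
Qed.

Definition ccos (w : C) : C := (RtoC (/ 2) * (expi w + expi (- w)))%C.

Lemma ccos_pair (t u : R) : ccos (t, u) = (cos t * cosh u, - (sin t * sinh u)).
Proof.
  unfold ccos, expi; simpl. rewrite cos_neg, sin_neg, Ropp_involutive.
  unfold cosh, sinh. apply injective_projections; simpl; field.
Qed.

Lemma ccos_real (t : R) : ccos (t, 0) = RtoC (cos t).
Proof.
  rewrite ccos_pair. rewrite sinh_0, cosh_0. apply injective_projections; simpl; ring.
Qed.

(** For these [t] and [u], [cos (t + i u)] lies in the closed lower half plane, so subtracting
    [i eta] pushes it away from the real axis and out of its ellipse, with a gain of order [eta] in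
    the parameter. The real shift by [omega] may push it inwards; the hypothesis on [T] keeps that
    loss dominated. Where [sin t = 0], the distance [eta] from the real axis alone puts the point
    outside the ellipse of parameter [T]. *)
Lemma psi_shifted_cos_le (eta omega d T t u : R) :
  0 < eta -> 0 < d <= T -> T <= / 4 -> 8 * d <= eta ->
  1024 * (T * T) * (eta + Rabs omega) <= eta * eta ->
  0 <= t <= PI -> 0 <= u <= T ->
  Cmod (psi (ccos (t, u) - (omega, eta))%C) <= exp (- (u + 2 * d)) /\
  (sin t = 0 -> Cmod (psi (ccos (t, u) - (omega, eta))%C) <= exp (- T)).
Proof.
  intros He Hd HT Hde HTe Ht Hu.
  set (y := (ccos (t, u) - (omega, eta))%C).
  assert (HX : Re y = cos t * cosh u - omega) by (unfold y; rewrite ccos_pair; simpl; ring).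
  assert (HY : Im y = - (sin t * sinh u + eta)) by (unfold y; rewrite ccos_pair; simpl; ring).
  set (q := sin t) in *. set (S := sinh u) in *. set (Ch := cosh u) in *.
  assert (Hq : 0 <= q) by (apply sin_ge_0; lra).
  assert (Hq1 : q <= 1) by apply SIN_bound.
  assert (HS : 0 <= S) by (apply sinh_nonneg; lra).
  assert (HS2 : S <= 2 * u) by (apply sinh_le_2x; lra).
  assert (HC : 1 <= Ch <= 2) by (split; [apply cosh_ge_1|apply cosh_le_2; lra]).
  assert (HCS : Ch * Ch = 1 + S * S) by apply cosh_sqr.
  assert (Hcq : cos t * cos t = 1 - q * q).
  { pose proof (sin2_cos2 t) as H. unfold Rsqr in H. unfold q. lra. }
  assert (Hc1 : -1 <= cos t <= 1) by apply COS_bound.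
  assert (HqS : 0 <= q * S) by nra.
  assert (HX2 : Re y * Re y + Im y * Im y = 1 - q * q + S * S
     - 2 * omega * (cos t * Ch) + omega * omega + 2 * eta * (q * S) + eta * eta).
  { rewrite HX, HY.
    transitivity (cos t * cos t * (Ch * Ch) + q * q * (S * S) - 2 * omega * (cos t * Ch)
      + omega * omega + 2 * eta * (q * S) + eta * eta); [ring|].
    rewrite Hcq, HCS. ring. }
  assert (Hom : 2 * omega * (cos t * Ch) <= 4 * Rabs omega).
  { pose proof (Rle_abs omega) as K1.
    pose proof (Rle_abs (- omega)) as K2. rewrite Rabs_Ropp in K2.
    assert (-2 <= cos t * Ch <= 2) by nra. nra. }
  assert (Hbr : 1 - Re y * Re y - Im y * Im y <= q * q - S * S + 4 * Rabs omega) by nra.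
  assert (HY2 : Im y * Im y = q * q * (S * S) + 2 * eta * (q * S) + eta * eta)
    by (rewrite HY; ring).
  assert (Hab : 0 <= Rabs omega) by apply Rabs_pos.
  assert (HTT : 0 < T * T) by nra.
  assert (HTa : 1024 * (T * T) * Rabs omega <= eta * eta) by nra.
  assert (HTb : 1024 * (T * T) * (T * T) <= eta * eta).
  {
    assert (1024 * (T * T) <= eta) by nra.
    nra. }
  split.
  (* On [[0, 1]] the derivative [cosh] of [sinh] is at most 2, so [S + 4 * d] bounds
     [sinh (u + 2 * d)]. *)
  - apply (joukowski_root_le y _ (u + 2 * d) (S + 4 * d)).
    + apply psi_root.
    + apply psi_le_1.
    + rewrite HY. nra.
    + lra.
    + unfold S. replace (4 * d) with (2 * (2 * d)) by ring. apply sinh_diff_le; lra.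
    + set (D := 4 * d). set (b := S + D).
      assert (HD : 0 < D <= eta / 2) by (unfold D; lra).
      assert (Hb : 0 < b <= 6 * T) by (unfold b, D; lra).
      assert (Hbb : 0 <= b * b <= 36 * (T * T)) by nra.
      (* The term [b^2 q^2] is absorbed by half of the cross term and a quarter of [eta^2] in
         [(q S + eta)^2]; the other two are of order [T^4] and [T^2 |omega|], small against
         [eta^2]. *)
      apply Rle_trans with (b * b * (q * q + (b * b - S * S) + 4 * Rabs omega)).
      { apply Rmult_le_compat_l; [lra|]. lra. }
      rewrite HY2.
      assert (b * b * (4 * Rabs omega) <= 36 * (T * T) * (4 * Rabs omega)) by nra.
      assert (b * b * (b * b - S * S) <= 36 * (T * T) * (36 * (T * T))).
      { assert (0 <= b * b - S * S) by (unfold b; nra).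
        pose proof (Rle_0_sqr S) as HSS. unfold Rsqr in HSS.
        apply Rmult_le_compat; lra. }
      assert (b * b * (q * q) <= q * q * (S * S) + eta * (q * S) + eta * eta / 4).
      { replace (b * b) with (S * S + 2 * (S * D) + D * D) by (unfold b; ring).
        assert (q * q <= q) by nra. assert (q * q <= 1) by nra.
        assert (D * D <= eta * eta / 4) by nra.
        assert (S * D * (q * q) <= S * (eta / 2) * q).
        { apply Rmult_le_compat; nra. }
        nra. }
      assert (0 <= eta * (q * S)) by nra. nra.
  - intros Hq0.
    apply (joukowski_root_le y _ T (2 * T)).
    + apply psi_root.
    + apply psi_le_1.
    + rewrite HY. nra.
    + lra.
    + apply sinh_le_2x; lra.
    + rewrite HY2, Hq0. rewrite Hq0 in Hbr.
      apply Rle_trans with (2 * T * (2 * T) * (2 * T * (2 * T) + 4 * Rabs omega)).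
      * apply Rmult_le_compat_l; nra.
      * nra.
Qed.

(** * Coefficients of the relaxation factor *)

Definition relaxation_factor (eta omega : R) (x1 x2 : R) : C :=
  (/ (RtoC x1 - RtoC x2 + (omega, eta)))%C.

Lemma relaxation_factor_le (eta omega x1 x2 : R) : 0 < eta ->
  Cmod (relaxation_factor eta omega x1 x2) <= / eta.
Proof.
  intros He. unfold relaxation_factor. set (w := (_ + _)%C).
  assert (HI : Im w = eta) by (unfold w; simpl; ring).
  assert (Hw : eta <= Cmod w).
  { pose proof (Cmod_ge_0 w). pose proof (sqr_Cmod w) as HS. rewrite HI in HS.
    pose proof (Rle_0_sqr (Re w)) as HQ. unfold Rsqr in HQ. nra. }
  rewrite Cmod_inv by (apply Cmod_gt_0; lra). apply Rinv_le_contravar; lra.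
Qed.

(* Twice (for [k = 0]) or once the [k]-th Chebyshev coefficient in [x1]. *)
Definition relaxation_coef (eta omega : R) (k : nat) (x : R) : C :=
  let p := psi (RtoC x - (omega, eta))%C in (- (4) * p ^ S k / (1 - p * p))%C.

(** With [y = x2 - s], the factor is [- 1 / (y - x1)]. Its resolvent series truncated after [N]
    terms has degree below [N], so the coefficient in [x1] is extracted without aliasing and only
    the geometric tail remains. *)
Lemma gauss2_relaxation_factor (eta omega rho : R) (N k1 k2 : nat) :
  rho < 1 -> (k1 < N)%nat ->
  (forall x, -1 <= x <= 1 -> Cmod (psi (RtoC x - (omega, eta))%C) <= rho) ->
  Cmod (gauss2 N k1 k2 (relaxation_factor eta omega) -
    gauss N k2 (relaxation_coef eta omega k1))%C
  <= 4 * (8 / ((1 - rho) * ((1 - rho) * (1 - rho))) * rho ^ (N - 1)).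
Proof.
  intros Hr HN Hpsi.
  assert (E : forall x2, -1 <= x2 <= 1 ->
    let p := psi (RtoC x2 - (omega, eta))%C in
    (1 - p * p)%C <> 0%C /\
    gauss N k1 (fun x1 => - csum (fun k => resolvent_coef p k *
      RtoC (chebyshev_T k x1)) N)%C = (- (4) * p ^ S k1 / (1 - p * p))%C).
  { intros x2 Hx2 p.
    assert (Hp1 : Cmod p <= rho) by (apply Hpsi; auto).
    assert (Hp2 : (1 - p * p)%C <> 0%C).
    { apply Cmod_lt_1_neq. rewrite Cmod_mult. pose proof (Cmod_ge_0 p). nra. }
    split; auto.
    rewrite (gauss_ext _ _ _ (fun x1 => csum (fun k => (- resolvent_coef p k) *
      RtoC (chebyshev_T k x1)) N)%C).
    - rewrite gauss_csum, (csum_single _ _ k1); [|lia|].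
      + rewrite gauss_scal, gauss_T by lia. destruct (Nat.eq_dec k1 k1); [|lia].
        destruct k1 as [|k1]; simpl; field; auto.
      + intros i Hi Hik. rewrite gauss_scal, gauss_T by lia.
        destruct (Nat.eq_dec k1 i); [lia|ring].
    - intros x1 _. transitivity ((-1) * csum (fun k => resolvent_coef p k *
      RtoC (chebyshev_T k x1)) N)%C; [ring|]. rewrite <- csum_scal.
      apply csum_ext; intros; ring. }
  unfold gauss2.
  rewrite (gauss_ext N k2 (relaxation_coef eta omega k1) (fun x2 => gauss N k1 (fun x1 =>
     - csum (fun k => resolvent_coef (psi (RtoC x2 - (omega, eta))) k *
      RtoC (chebyshev_T k x1)) N)%C)).
  2:{ intros x Hx. symmetry. apply (E x Hx). }
  change (Cmod (gauss2 N k1 k2 (relaxation_factor eta omega) -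
    gauss2 N k1 k2 (fun x1 x2 => - csum (fun k => resolvent_coef (psi (RtoC x2 - (omega, eta))) k *
      RtoC (chebyshev_T k x1)) N))%C <=
    4 * (8 / ((1 - rho) * ((1 - rho) * (1 - rho))) * rho ^ (N - 1))).
  rewrite <- gauss2_minus.
  apply gauss2_bound; [lia|]. intros x1 x2 Hx1 Hx2.
  set (y := (RtoC x2 - (omega, eta))%C).
  pose proof (resolvent_approx (psi y) y x1 rho (N - 1) (psi_root y) (Hpsi x2 Hx2) Hr Hx1) as HA.
  replace (S (N - 1)) with N in HA by lia.
  rewrite <- Cmod_opp.
  match goal with |- Cmod ?L <= _ => match type of HA with Cmod ?Q <= _ =>
    replace L with Q; [exact HA|] end end.
  unfold relaxation_factor.
  assert (Hyx : (y - x1)%C <> 0%C).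
  { intros H0. pose proof (quadratic_ge (psi y) x1 Hx1 (psi_le_1 y)) as HQ.
    rewrite (resolvent_eq _ y x1 (psi_root y)), H0, Cmult_0_r, Cmod_0 in HQ.
    pose proof (Hpsi x2 Hx2). fold y in H. nra. }
  replace (RtoC x1 - RtoC x2 + (omega, eta))%C with (- (y - x1))%C by (unfold y; ring).
  field. auto.
Qed.

Lemma gauss_psi_bound (eta omega d T : R) :
  0 < eta -> 0 < d <= T -> T <= / 4 -> 8 * d <= eta ->
  1024 * (T * T) * (eta + Rabs omega) <= eta * eta ->
  exists M, 0 <= M /\ forall k1 k2, (k2 <= k1)%nat -> exists K, forall N, (0 < N)%nat ->
    Cmod (gauss N k2 (relaxation_coef eta omega k1))
    <= M * weight d (T - d) k1 k2 + K / INR N.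
Proof.
  intros He Hd HT Hde HTe.
  set (y := fun w => (ccos w - (omega, eta))%C).
  set (rho := exp (- (2 * d))).
  assert (Hrho : rho < 1) by (unfold rho; rewrite <- exp_0; apply exp_increasing; lra).
  pose proof (psi_shifted_cos_le eta omega d T) as Hpsi.
  assert (Hpr : forall w, rectangle T w -> Cmod (psi (y w)) <= rho).
  { intros [t u] [Ht Hu]. simpl in Ht, Hu. unfold y, rho.
    destruct (Hpsi t u) as [P1 _]; auto.
    eapply Rle_trans; [exact P1|]. apply exp_le_compat; lra. }
  assert (Hreg_y : regular (rectangle T) y).
  { apply (regular_plus _ ccos (fun _ => - (omega, eta))%C); [|apply regular_const].
    apply (regular_mult _ (fun _ => RtoC (/ 2)) (fun w => expi w + expi (- w))%C);
      [apply regular_const|].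
    apply (regular_plus _ expi (fun w => expi (- w))%C);
      [now apply regular_expi|now apply regular_expi_opp]. }
  pose proof (regular_psi _ _ rho Hrho Hpr Hreg_y) as Hreg_p.
  set (i := / (1 - rho)).
  assert (Hi : 0 < i) by (apply Rinv_0_lt_compat; lra).
  assert (Hden : forall w, rectangle T w -> 1 - rho <= Cmod (1 - psi (y w) * psi (y w))%C).
  { intros w Hw. eapply Rle_trans; [|apply one_minus_sqr_ge].
    pose proof (Hpr w Hw). pose proof (Cmod_ge_0 (psi (y w))). nra. }
  set (q := fun k w => (- (4) * psi (y w) ^ S k * / (1 - psi (y w) * psi (y w)))%C).
  assert (Hreg_q : forall k, regular (rectangle T) (q k)).
  { intros k. apply (regular_mult _ (fun w => - (4) * psi (y w) ^ S k)%C
      (fun w => / (1 - psi (y w) * psi (y w)))%C).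
    - apply (regular_mult _ (fun _ => - (4))%C (fun w => psi (y w) ^ S k)%C);
        [apply regular_const|]. now apply (regular_pow _ (fun w => psi (y w))).
    - apply (regular_inv _ (fun w => 1 - psi (y w) * psi (y w))%C (1 - rho)); [lra|auto|].
      apply (regular_ext _ (fun w => RtoC 1 + (-1) * (psi (y w) * psi (y w)))%C);
        [intros; ring|].
      apply (regular_plus _ (fun _ => RtoC 1) (fun w => (-1) * (psi (y w) * psi (y w)))%C);
        [apply regular_const|].
      apply (regular_mult _ (fun _ => RtoC (-1)) (fun w => psi (y w) * psi (y w))%C);
        [apply regular_const|].
      now apply (regular_mult _ (fun w => psi (y w)) (fun w => psi (y w))). }
  assert (Hq : forall k w, rectangle T w -> Cmod (q k w) <= 4 * Cmod (psi (y w)) ^ k * i).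
  { intros k w Hw. unfold q. pose proof (Hden w Hw) as HD.
    assert (H4 : Cmod (- (4))%C = 4) by (rewrite Cmod_opp; apply Cmod_nonneg; lra).
    apply Cmod_mult_le; [apply Cmod_mult_le; [lra|]|].
    - rewrite Cmod_pow. simpl. pose proof (psi_le_1 (y w)).
      pose proof (Cmod_ge_0 (psi (y w))).
      pose proof (pow_le (Cmod (psi (y w))) k ltac:(auto)). nra.
    - rewrite Cmod_inv by (apply Cmod_gt_0; lra). apply Rinv_le_contravar; lra. }
  (* Here [4 * i] bounds the prefactor of [psi ^ k1]; the 2 accounts for the top edge under both
     exponentials, and [2 * T] for the vertical sides, after division by [pi >= 2]. *)
  exists ((2 + 2 * T) * (4 * i)). split; [apply Rmult_le_pos; lra|].
  intros k1 k2 Hk.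
  set (W := weight d (T - d) k1 k2).
  assert (HW : W = exp (- (T * (INR k1 - INR k2)) - 2 * d * INR k2)).
  { unfold W, weight. apply le_INR in Hk. rewrite Rabs_right by lra. f_equal; ring. }
  apply le_INR in Hk as HkR. pose proof (pos_INR k2) as Hk20.
  (* The decay of [psi] beats the growth [exp (u * k2)] of the Fourier factor. *)
  assert (Htop : forall t, 0 <= t <= PI ->
    Cmod (psi (y (t, T))) ^ k1 * exp (T * INR k2) <= W).
  { intros t Ht. destruct (Hpsi t T) as [P1 _]; auto; try lra. fold (y (t, T)) in P1.
    apply Rle_trans with (exp (- (T + 2 * d)) ^ k1 * exp (T * INR k2)).
    - apply Rmult_le_compat_r; [left; apply exp_pos|]. apply pow_incr; split; auto using Cmod_ge_0.
    - rewrite exp_pow_INR, <- exp_plus, HW. apply exp_le_compat. nra. }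
  assert (Hside : forall t u, 0 <= t <= PI -> 0 <= u <= T -> sin t = 0 ->
    Cmod (psi (y (t, u))) ^ k1 * exp (u * INR k2) <= W).
  { intros t u Ht Hu Hs. destruct (Hpsi t u) as [P1 P2]; auto; try lra.
    fold (y (t, u)) in P1, P2. specialize (P2 Hs).
    (* The first [k2] factors use the bound depending on [u], which cancels [exp (u * k2)]; the
       remaining ones use the stronger side bound [exp (- T)]. *)
    replace k1 with (k2 + (k1 - k2))%nat by lia. rewrite pow_add.
    apply Rle_trans with (exp (- (u + 2 * d)) ^ k2 * exp (- T) ^ (k1 - k2) * exp (u * INR k2)).
    - apply Rmult_le_compat_r; [left; apply exp_pos|].
      apply Rmult_le_compat; try (apply pow_le, Cmod_ge_0);
        apply pow_incr; split; auto using Cmod_ge_0.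
    - rewrite !exp_pow_INR, <- !exp_plus, HW. apply exp_le_compat.
      rewrite minus_INR by lia. nra. }
  assert (Hfactor : forall (s : bool) u t, 0 <= u ->
    Cmod (expi (if s then (t, u) else - (t, u)))%C ^ k2 <= exp (u * INR k2)).
  { intros s u t Hu. rewrite Cmod_expi, exp_pow_INR. apply exp_le_compat.
    destruct s; simpl; nra. }
  (* The factor [2 cos (k2 w)] is split into its two exponentials, each moved to the same shifted
     contour. *)
  set (H := fun (s : bool) w => (q k1 w * expi (if s then w else - w) ^ k2)%C).
  assert (HC : forall s, exists K, forall N, (0 < N)%nat ->
    Cmod (RtoC (PI / INR N) * csum (fun j => H s (node_angle N j, 0)) N)%C
      <= PI * (4 * i * W) + 2 * T * (4 * i * W) + K / INR N).
  { intros s. apply grid_cauchy; [lra| | |].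
    - apply (regular_mult _ (q k1) (fun w => expi (if s then w else - w) ^ k2)%C); auto.
      apply (regular_pow _ (fun w => expi (if s then w else - w))%C).
      destruct s; [now apply regular_expi|now apply regular_expi_opp].
    - intros t Ht. unfold H. rewrite Cmod_mult, Cmod_pow.
      assert (HR : rectangle T (t, T)) by (unfold rectangle; simpl; lra).
      apply Rle_trans with (4 * Cmod (psi (y (t, T))) ^ k1 * i * exp (T * INR k2)).
      + apply Rmult_le_compat; auto using Cmod_ge_0. apply pow_le, Cmod_ge_0.
        apply Hfactor; lra.
      + pose proof (Htop t Ht). nra.
    - assert (B : forall t u, 0 <= t <= PI -> 0 <= u <= T -> sin t = 0 ->
        Cmod (H s (t, u)) <= 4 * i * W).
      { intros t u Ht Hu Hs. unfold H. rewrite Cmod_mult, Cmod_pow.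
        assert (HR : rectangle T (t, u)) by (unfold rectangle; simpl; lra).
        apply Rle_trans with (4 * Cmod (psi (y (t, u))) ^ k1 * i * exp (u * INR k2)).
        + apply Rmult_le_compat; auto using Cmod_ge_0. apply pow_le, Cmod_ge_0.
          apply Hfactor; lra.
        + pose proof (Hside t u Ht Hu Hs). nra. }
      pose proof PI_RGT_0.
      intros u Hu. split; apply B; auto using sin_0, sin_PI; lra. }
  destruct (HC true) as [K1 HK1]. destruct (HC false) as [K2 HK2].
  exists ((K1 + K2) / PI). intros N HN. specialize (HK1 N HN). specialize (HK2 N HN).
  pose proof PI_RGT_0 as HPI. pose proof PI2_1 as HPI1.
  assert (HN0 : 0 < INR N) by now apply lt_0_INR.
  assert (E : (RtoC PI * gauss N k2 (relaxation_coef eta omega k1) =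
    RtoC (PI / INR N) * csum (fun j => H true (node_angle N j, 0%R)) N +
    RtoC (PI / INR N) * csum (fun j => H false (node_angle N j, 0%R)) N)%C).
  { unfold gauss. rewrite <- Cmult_plus_distr_l, <- csum_plus, <- !csum_scal.
    apply csum_ext. intros j _. unfold relaxation_coef, H, q, y. rewrite !ccos_real.
    change (cos (node_angle N j)) with (node N j).
    assert (EC : (RtoC 2 * RtoC (chebyshev_T k2 (node N j)) =
      expi (node_angle N j, 0%R) ^ k2 + expi (- (node_angle N j, 0%R)) ^ k2)%C).
    { assert (EP : forall t k, (expi (t, 0%R) ^ k)%C = (cos (INR k * t), sin (INR k * t))).
      { intros t k. induction k as [|k IH].
        - simpl. rewrite Rmult_0_l, cos_0, sin_0. reflexivity.
        - rewrite Cpow_S, IH, S_INR, Rmult_plus_distr_r, Rmult_1_l.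
          rewrite (Rplus_comm _ t), cos_plus, sin_plus.
          unfold expi; simpl. rewrite Ropp_0, exp_0.
          apply injective_projections; simpl; ring. }
      replace (- (node_angle N j, 0%R))%C with ((- node_angle N j, 0) : C)
        by (apply injective_projections; simpl; ring).
      rewrite !EP. unfold node. rewrite chebyshev_T_cos.
      rewrite Ropp_mult_distr_r_reverse, cos_neg, sin_neg.
      apply injective_projections; simpl; ring. }
    set (P := psi _).
    transitivity ((RtoC PI * RtoC (/ INR N) * (- (4) * P ^ S k1 / (1 - P * P))) *
      (RtoC 2 * RtoC (chebyshev_T k2 (node N j))))%C.
    - unfold Rdiv. rewrite RtoC_mult. unfold Cdiv. ring.
    - rewrite EC. unfold Rdiv. rewrite RtoC_mult. unfold Cdiv. ring. }
  apply (f_equal Cmod) in E. rewrite Cmod_mult, Cmod_R, Rabs_right in E by lra.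
  set (g := Cmod (gauss N k2 _)) in *.
  assert (HW0 : 0 < W) by (rewrite HW; apply exp_pos).
  assert (HE : PI * g <= 2 * (PI * (4 * i * W) + 2 * T * (4 * i * W)) + (K1 + K2) / INR N).
  { rewrite E. eapply Rle_trans; [apply Cmod_triangle|].
    replace ((K1 + K2) / INR N) with (K1 / INR N + K2 / INR N) by (field; lra). lra. }
  apply Rmult_le_reg_l with PI; auto.
  replace (PI * ((2 + 2 * T) * (4 * i) * W + (K1 + K2) / PI / INR N)) with
   (PI * (2 + 2 * T) * (4 * i * W) + (K1 + K2) / INR N) by (field; lra).
  assert (0 <= T * (4 * i * W) * (PI - 2))
    by (repeat apply Rmult_le_pos; lra).
  lra.
Qed.

Lemma chebyshev_T_opp (k : nat) (x : R) :
  chebyshev_T k (- x) = (-1) ^ k * chebyshev_T k x.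
Proof.
  enough (H : chebyshev_T k (- x) = (-1) ^ k * chebyshev_T k x /\
    chebyshev_T (S k) (- x) = (-1) ^ S k * chebyshev_T (S k) x) by apply H.
  induction k as [|k [IH1 IH2]]; [simpl; lra|]. split; [exact IH2|].
  rewrite !chebyshev_T_SS, IH1, IH2. simpl. ring.
Qed.

Lemma gauss_reflect (N k : nat) (h : R -> C) :
  gauss N k (fun x => h (- x)) = (RtoC ((-1) ^ k) * gauss N k h)%C.
Proof.
  unfold gauss. rewrite csum_rev, <- !csum_scal. apply csum_ext. intros j Hj.
  rewrite node_rev, chebyshev_T_opp, Ropp_involutive, RtoC_mult by auto. ring.
Qed.

Lemma Cmod_sign (k : nat) : Cmod (RtoC ((-1) ^ k)) = 1.
Proof. rewrite Cmod_R. apply pow_1_abs. Qed.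

(* [1 / (x1 - x2 + s)] is invariant under [(x1, x2) -> (- x2, - x1)]. *)
Lemma gauss2_relaxation_factor_sym (eta omega : R) (N k1 k2 : nat) :
  Cmod (gauss2 N k1 k2 (relaxation_factor eta omega)) =
  Cmod (gauss2 N k2 k1 (relaxation_factor eta omega)).
Proof.
  transitivity (Cmod (RtoC ((-1) ^ k2) * (RtoC ((-1) ^ k1) *
    gauss2 N k1 k2 (fun x1 x2 => relaxation_factor eta omega (- x1) (- x2))))%C).
  - assert (E : gauss2 N k1 k2 (relaxation_factor eta omega) =
      (RtoC ((-1) ^ k2) * (RtoC ((-1) ^ k1) *
    gauss2 N k1 k2 (fun x1 x2 => relaxation_factor eta omega (- x1) (- x2))))%C).
    { unfold gauss2.
      rewrite <- (gauss_scal N k2 _ (fun x2 => gauss N k1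
        (fun x1 => relaxation_factor eta omega (- x1) (- x2)))).
      rewrite <- (gauss_reflect N k2 (fun x2 => (RtoC ((-1) ^ k1) *
        gauss N k1 (fun x1 => relaxation_factor eta omega (- x1) (- x2)))%C)).
      apply gauss_ext; intros x2 _.
      rewrite <- (gauss_reflect N k1 (fun x1 => relaxation_factor eta omega (- x1) (- - x2))).
      apply gauss_ext; intros x1 _. now rewrite !Ropp_involutive. }
    now rewrite E at 1.
  - rewrite !Cmod_mult, !Cmod_sign, !Rmult_1_l. unfold gauss2 at 2. rewrite gauss_swap.
    f_equal. unfold gauss2. apply gauss_ext; intros x2 _. apply gauss_ext; intros x1 _.
    unfold relaxation_factor. f_equal. rewrite !RtoC_opp. ring.
Qed.

(** The geometric term is the truncation error of the resolvent series, the other one the error of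
    [grid_cauchy]. *)
Lemma eventually_small (A B rho eps : R) : 0 <= rho < 1 -> 0 < eps ->
  exists N0 : nat, (0 < N0)%nat /\
    forall N, (N0 <= N)%nat -> A * rho ^ (N - 1) + B / INR N <= eps.
Proof.
  intros Hr He.
  destruct (pow_lt_1_zero rho) with (y := eps / (2 * (Rabs A + 1))) as [n Hn].
  - rewrite Rabs_right; lra.
  - apply Rdiv_lt_0_compat; [lra|]. pose proof (Rabs_pos A); lra.
  - destruct (archimed_cor1 (eps / (2 * (Rabs B + 1)))) as [m [Hm Hm0]].
    { apply Rdiv_lt_0_compat; [lra|]. pose proof (Rabs_pos B); lra. }
    exists (n + m + 1)%nat. split; [lia|]. intros N HN.
    assert (HN0 : 0 < INR m) by now apply lt_0_INR.
    assert (HNm : INR m <= INR N) by (apply le_INR; lia).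
    specialize (Hn (N - 1)%nat ltac:(lia)).
    assert (Hp : 0 <= rho ^ (N - 1)) by (apply pow_le; lra).
    rewrite Rabs_right in Hn by lra.
    pose proof (Rabs_pos A). pose proof (Rabs_pos B).
    assert (A * rho ^ (N - 1) <= eps / 2).
    { apply Rle_trans with ((Rabs A + 1) * (eps / (2 * (Rabs A + 1)))).
      - apply Rle_trans with ((Rabs A + 1) * rho ^ (N - 1)).
        + apply Rmult_le_compat_r; auto. pose proof (Rle_abs A); lra.
        + apply Rmult_le_compat_l; lra.
      - right; field; lra. }
    assert (B / INR N <= eps / 2).
    { assert (/ INR N <= / INR m) by (apply Rinv_le_contravar; lra).
      assert (0 < / INR N) by (apply Rinv_0_lt_compat; lra).
      apply Rle_trans with ((Rabs B + 1) * (eps / (2 * (Rabs B + 1)))).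
      - apply Rle_trans with ((Rabs B + 1) * / INR N).
        + apply Rmult_le_compat_r; [lra|]. pose proof (Rle_abs B); lra.
        + apply Rmult_le_compat_l; lra.
      - right; field; lra. }
    lra.
Qed.

Lemma coef_bound_relaxation_factor (eta omega d T : R) :
  0 < eta -> 0 < d <= T -> T <= / 4 -> 8 * d <= eta ->
  1024 * (T * T) * (eta + Rabs omega) <= eta * eta ->
  exists M, 0 <= M /\ coef_bound d (T - d) (relaxation_factor eta omega) M.
Proof.
  intros He Hd HT Hde HTe.
  destruct (gauss_psi_bound eta omega d T) as [M [HM HG]]; auto.
  set (rho := exp (- (2 * d))).
  assert (Hrho : 0 <= rho < 1).
  { unfold rho; split; [left; apply exp_pos|].
    rewrite <- exp_0; apply exp_increasing; lra. }
  assert (Hpsi : forall x, -1 <= x <= 1 -> Cmod (psi (RtoC x - (omega, eta))%C) <= rho).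
  { intros x Hx. destruct (cos_acos_mod x Hx) as [t [Ht <-]].
    rewrite <- ccos_real.
    destruct (psi_shifted_cos_le eta omega d T t 0) as [P _]; auto; try lra.
    unfold rho. now rewrite Rplus_0_l in P. }
  set (A := 4 * (8 / ((1 - rho) * ((1 - rho) * (1 - rho))))).
  assert (HB : forall k1 k2 eps, (k2 <= k1)%nat -> 0 < eps ->
    exists N0 : nat, forall N, (N0 <= N)%nat ->
    Cmod (gauss2 N k1 k2 (relaxation_factor eta omega)) <= M * weight d (T - d) k1 k2 + eps).
  { intros k1 k2 eps Hk Heps. destruct (HG k1 k2 Hk) as [K HK].
    destruct (eventually_small A K rho eps Hrho Heps) as [N0 [HN0 HN]].
    exists (N0 + k1 + 1)%nat. intros N HNN.
    specialize (HN N ltac:(lia)). specialize (HK N ltac:(lia)).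
    pose proof (gauss2_relaxation_factor eta omega rho N k1 k2 ltac:(lra) ltac:(lia) Hpsi) as HD.
    set (a := gauss2 N k1 k2 (relaxation_factor eta omega)) in *.
    set (b := gauss N k2 (relaxation_coef eta omega k1)) in *.
    pose proof (Cmod_minus_ge a b) as HC.
    unfold A in HN. lra. }
  exists M. split; auto. intros k1 k2 eps Heps.
  destruct (Nat.le_ge_cases k2 k1) as [Hk|Hk]; [now apply HB|].
  destruct (HB k2 k1 eps Hk Heps) as [N0 HN]. exists N0. intros N HN0.
  rewrite gauss2_relaxation_factor_sym, weight_sym. now apply HN.
Qed.

(** * Rational approximation of the Fermi function *)

(* The [N]-th roots of [-1]. *)
Definition zeta (N j : nat) : C := expi ((2 * INR j + 1) * PI / INR N, 0).

Lemma expi_pow (w : C) (n : nat) : (expi w ^ n)%C = expi (RtoC (INR n) * w)%C.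
Proof.
  induction n as [|n IH].
  - change (INR 0) with 0. replace (RtoC 0 * w)%C with (RtoC 0) by ring.
    unfold expi; simpl. rewrite Ropp_0, exp_0, cos_0, sin_0.
    apply injective_projections; simpl; ring.
  - rewrite Cpow_S, IH, <- expi_plus. f_equal. rewrite S_INR, RtoC_plus. ring.
Qed.

Lemma Cmod_zeta (N j : nat) : Cmod (zeta N j) = 1.
Proof. unfold zeta. rewrite Cmod_expi; simpl. now rewrite Ropp_0, exp_0. Qed.

Lemma zeta_neq_0 (N j : nat) : zeta N j <> 0%C.
Proof. apply Cmod_gt_0. rewrite Cmod_zeta; lra. Qed.

Lemma zeta_inv (N j : nat) : (/ zeta N j)%C = expi (- ((2 * INR j + 1) * PI / INR N, 0)%R)%C.
Proof.
  pose proof (expi_opp ((2 * INR j + 1) * PI / INR N, 0)) as E. fold (zeta N j) in E.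
  pose proof (zeta_neq_0 N j) as H.
  rewrite <- (Cmult_1_r (/ zeta N j)), <- E. field; auto.
Qed.

Lemma expi_real (t : R) : expi (t, 0) = (cos t, sin t).
Proof. unfold expi; simpl. rewrite Ropp_0, exp_0. f_equal; ring. Qed.

Lemma zeta_inv_pow (N j m : nat) : (0 < N)%nat ->
  (/ zeta N j ^ m)%C = (expi (- INR m * PI / INR N, 0)%R ^ (2 * j + 1))%C.
Proof.
  intros HN. assert (INR N <> 0) by (apply not_0_INR; lia).
  rewrite <- Cpow_inv, zeta_inv, !expi_pow by apply zeta_neq_0. f_equal.
  rewrite plus_INR, mult_INR. simpl (INR 2). simpl (INR 1).
  apply injective_projections; simpl; field; auto.
Qed.

(** A geometric sum of ratio [z^2], with [z = exp (- i pi m / N)] and [z^(2 N) = 1]. In this range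
    the ratio is 1 only for [m = N], where every term equals [-1]. *)
Lemma zeta_power_sum (N m : nat) : (0 < m < 2 * N)%nat ->
  csum (fun j => / zeta N j ^ m)%C N =
  if Nat.eq_dec m N then (- RtoC (INR N))%C else 0%C.
Proof.
  intros Hm. assert (HN : INR N <> 0) by (apply not_0_INR; lia).
  set (z := expi (- INR m * PI / INR N, 0)).
  rewrite (csum_ext _ (fun j => z * (z * z) ^ j)%C).
  2:{ intros j _. rewrite zeta_inv_pow by lia. fold z.
      replace (2 * j + 1)%nat with (S (2 * j)) by lia.
      rewrite Cpow_S, Cpow_mult_r. f_equal. f_equal. simpl. ring. }
  rewrite csum_scal.
  destruct (Nat.eq_dec m N) as [->|HmN].
  - assert (Ez : z = (-1)%C).
    { unfold z. rewrite expi_real.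
      replace (- INR N * PI / INR N) with (- PI) by (field; auto).
      rewrite cos_neg, sin_neg, cos_PI, sin_PI. apply injective_projections; simpl; ring. }
    rewrite Ez.
    assert (E : forall n, csum (fun i => ((-1) * (-1)) ^ i)%C n = RtoC (INR n)).
    { intros n. induction n as [|n IH]; [reflexivity|].
      change (csum (fun i => ((-1) * (-1)) ^ i)%C (S n)) with
       (csum (fun i => ((-1) * (-1)) ^ i) n + ((-1) * (-1)) ^ n)%C.
      rewrite IH, S_INR, RtoC_plus. replace ((-1) * (-1))%C with (RtoC 1)
        by (apply injective_projections; simpl; ring).
      now rewrite Cpow_1_l. }
    rewrite E. apply injective_projections; simpl; ring.
  - assert (Hz : (z * z)%C <> 1%C).
    { intros E. apply (f_equal Re) in E. unfold z in E. rewrite expi_real in E. simpl in E.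
      set (t := - INR m * PI / INR N) in *.
      pose proof (sin2_cos2 t) as S2. unfold Rsqr in S2.
      assert (S0 : sin t = 0) by (apply Rsqr_0_uniq; unfold Rsqr; lra).
      apply sin_eq_0_0 in S0. destruct S0 as [k Hk].
      assert (Hk2 : IZR (- k * Z.of_nat N) = IZR (Z.of_nat m)).
      { rewrite mult_IZR, opp_IZR, <- !INR_IZR_INZ.
        pose proof PI_RGT_0. unfold t in Hk.
        apply Rmult_eq_reg_r with PI; [|lra].
        transitivity (- (IZR k * PI) * INR N); [ring|]. rewrite <- Hk. field; auto. }
      apply eq_IZR in Hk2.
      assert (0 < - k < 2)%Z by nia.
      assert (Hk1 : (- k = 1)%Z) by lia. rewrite Hk1 in Hk2. lia. }
    assert (E : forall n, ((1 - z * z) * csum (fun i => (z * z) ^ i) n = 1 - (z * z) ^ n)%C).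
    { induction n as [|n IH]; [simpl; ring|].
      change (csum (fun i => (z * z) ^ i)%C (S n)) with
       (csum (fun i => (z * z) ^ i) n + (z * z) ^ n)%C.
      rewrite Cmult_plus_distr_l, IH, Cpow_S. ring. }
    assert (EN : ((z * z) ^ N = 1)%C).
    { unfold z. rewrite <- expi_plus, expi_pow.
      replace (RtoC (INR N) * ((- INR m * PI / INR N, 0)%R + (- INR m * PI / INR N, 0)%R))%C
        with ((- (0 + 2 * INR m * PI), 0) : C) by (apply injective_projections; simpl; field; auto).
      rewrite expi_real, cos_neg, sin_neg, cos_period, sin_period, cos_0, sin_0.
      apply injective_projections; simpl; ring. }
    specialize (E N). rewrite EN in E.
    assert (H0 : (1 - z * z)%C <> 0%C).
    { intros H0. apply Hz. transitivity (1 - (1 - z * z))%C; [ring|]. rewrite H0; ring. }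
    change (csum (Cpow (z * z)) N) with (csum (fun i => (z * z) ^ i)%C N).
    assert (csum (fun i => (z * z) ^ i)%C N = 0%C) as ->; [|ring].
    transitivity ((1 - z * z) * csum (fun i => (z * z) ^ i) N / (1 - z * z))%C; [field; auto|].
    rewrite E. field; auto.
Qed.

Lemma zeta_geometric (N j : nat) (p : C) : (0 < N)%nat ->
  ((zeta N j - p) * csum (fun m => p ^ m * / zeta N j ^ S m) N = 1 + p ^ N)%C.
Proof.
  intros HN. pose proof (zeta_neq_0 N j) as Hz.
  assert (E : forall n, ((zeta N j - p) * csum (fun m => p ^ m * / zeta N j ^ S m) n
    = 1 - p ^ n * / zeta N j ^ n)%C).
  { induction n as [|n IH]; [simpl; field|].
    change (csum (fun m => p ^ m * / zeta N j ^ S m)%C (S n)) with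
      (csum (fun m => p ^ m * / zeta N j ^ S m) n + p ^ n * / zeta N j ^ S n)%C.
    rewrite Cmult_plus_distr_l, IH, !Cpow_S.
    pose proof (Cpow_nz (zeta N j) n Hz). field; auto. }
  rewrite E. rewrite zeta_inv_pow by auto.
  assert (INR N <> 0) by (apply not_0_INR; lia).
  replace (- INR N * PI / INR N) with (- PI) by (field; auto).
  rewrite expi_real, cos_neg, sin_neg, cos_PI, sin_PI.
  replace ((-1, - 0) : C) with (-(1))%C by (apply injective_projections; simpl; ring).
  assert (E2 : forall i, ((- (1)) ^ (2 * i + 1) = - (1))%C).
  { intros i. rewrite Cpow_add_r, Cpow_mult_r.
    replace ((- (1)) ^ 2)%C with (RtoC 1) by (simpl; ring). rewrite Cpow_1_l. simpl; ring. }
  rewrite E2. ring.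
Qed.

(** Expanding both fractions by [zeta_geometric], the sum over the roots of [-1] keeps only the
    exponent [m + n + 1 = N]. The right-hand side is [N] times the difference quotient of
    [1 / (1 + p^N)], written as a sum so that [p = q] is allowed. *)
Lemma zeta_double_resolvent_sum (N : nat) (p q : C) : (0 < N)%nat ->
  (1 + p ^ N)%C <> 0%C -> (1 + q ^ N)%C <> 0%C ->
  csum (fun j => zeta N j / ((zeta N j - p) * (zeta N j - q)))%C N =
  (- RtoC (INR N) * csum (fun m => p ^ m * q ^ (N - 1 - m)) N
    / ((1 + p ^ N) * (1 + q ^ N)))%C.
Proof.
  intros HN Hp Hq.
  rewrite (csum_ext _ (fun j => / ((1 + p ^ N) * (1 + q ^ N)) *
    csum (fun m => csum (fun n => p ^ m * q ^ n * / zeta N j ^ (S (m + n))) N) N)%C).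
  - rewrite csum_scal, csum_swap.
    rewrite (csum_ext _ (fun m => - RtoC (INR N) * (p ^ m * q ^ (N - 1 - m)))%C).
    + rewrite csum_scal. field; auto.
    + intros m Hm. rewrite csum_swap.
      rewrite (csum_single _ _ (N - 1 - m)%nat); [|lia|].
      * rewrite csum_scal, zeta_power_sum by lia.
        destruct (Nat.eq_dec _ N); [ring|lia].
      * intros n Hn Hnm. rewrite csum_scal, zeta_power_sum by lia.
        destruct (Nat.eq_dec _ N); [lia|ring].
  - intros j _. pose proof (zeta_neq_0 N j) as Hz.
    pose proof (zeta_geometric N j p HN) as Gp. pose proof (zeta_geometric N j q HN) as Gq.
    assert (Np : (zeta N j - p)%C <> 0%C) by (intros E; rewrite E in Gp; apply Hp; rewrite <- Gp; ring).
    assert (Nq : (zeta N j - q)%C <> 0%C) by (intros E; rewrite E in Gq; apply Hq; rewrite <- Gq; ring).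
    replace (csum (fun m => csum (fun n => p ^ m * q ^ n * / zeta N j ^ (S (m + n))) N) N)%C
      with (zeta N j * (csum (fun m => p ^ m * / zeta N j ^ S m) N *
        csum (fun m => q ^ m * / zeta N j ^ S m) N))%C.
    + set (a := csum (fun m => p ^ m * / zeta N j ^ S m)%C N) in *.
      set (b := csum (fun m => q ^ m * / zeta N j ^ S m)%C N) in *.
      assert (a <> 0%C) by (intros E; apply Hp; rewrite <- Gp, E; ring).
      assert (b <> 0%C) by (intros E; apply Hq; rewrite <- Gq, E; ring).
      rewrite <- Gp, <- Gq. field. auto.
    + set (B := csum (fun m => q ^ m * / zeta N j ^ S m)%C N).
      transitivity (csum (fun m => (zeta N j * B) * (p ^ m * / zeta N j ^ S m)) N)%C.
      { rewrite csum_scal. ring. }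
      apply csum_ext. intros m _.
      transitivity (csum (fun n => (zeta N j * (p ^ m * / zeta N j ^ S m)) *
        (q ^ n * / zeta N j ^ S n)) N)%C.
      { rewrite csum_scal. fold B. ring. }
      apply csum_ext. intros n _.
      rewrite !Cpow_S, Cpow_add_r.
      pose proof (Cpow_nz (zeta N j) m Hz). pose proof (Cpow_nz (zeta N j) n Hz).
      field. auto.
Qed.

(** The conjugate of a number [z] of modulus 1 is [1 / z], so [|z - 1|^2 z = (z - 1) (1 - z)]. *)
Lemma Cmod_sqr_zeta_minus_1 (N j : nat) :
  (RtoC (Cmod (zeta N j - 1) * Cmod (zeta N j - 1)) * zeta N j =
   - ((zeta N j - 1) * (zeta N j - 1)))%C.
Proof.
  rewrite sqr_Cmod. unfold zeta. rewrite expi_real.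
  set (t := _ / _). pose proof (sin2_cos2 t) as H. unfold Rsqr in H.
  set (r := _ + _).
  assert (Hr : r = 2 - 2 * cos t) by (unfold r; simpl; lra).
  rewrite Hr. apply injective_projections; simpl; lra.
Qed.

(* The case [p = q = 1] of [zeta_double_resolvent_sum]. *)
Lemma zeta_distance_sum (N : nat) : (0 < N)%nat ->
  (forall j, 0 < Cmod (zeta N j - 1)%C) /\
  rsum (fun j => / (Cmod (zeta N j - 1)%C * Cmod (zeta N j - 1)%C)) N
    = INR N * INR N / 4.
Proof.
  intros HN.
  assert (H2 : (1 + 1 ^ N)%C <> 0%C).
  { rewrite Cpow_1_l. intros E. apply (f_equal Re) in E. simpl in E. lra. }
  assert (Hpos : forall j, 0 < Cmod (zeta N j - 1)%C).
  { intros j. apply Cmod_gt_0. intros E.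
    pose proof (zeta_geometric N j 1 HN) as G. rewrite E in G. apply H2. rewrite <- G. ring. }
  split; auto.
  apply RtoC_inj. rewrite <- rsum_csum.
  pose proof (zeta_double_resolvent_sum N 1 1 HN H2 H2) as E.
  rewrite (csum_ext (fun m => 1 ^ m * 1 ^ (N - 1 - m))%C (fun _ => RtoC 1)) in E
    by (intros; rewrite !Cpow_1_l; ring).
  rewrite (rsum_csum (fun _ => 1)), rsum_const, !Cpow_1_l in E.
  transitivity ((-1) * csum (fun j => zeta N j / ((zeta N j - 1) * (zeta N j - 1))) N)%C.
  - rewrite <- csum_scal. apply csum_ext. intros j _.
    pose proof (Hpos j) as Hj. pose proof (zeta_neq_0 N j) as Hz.
    pose proof (Cmod_sqr_zeta_minus_1 N j) as HC.
    set (r := Cmod (zeta N j - 1)%C * Cmod (zeta N j - 1)%C) in *.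
    assert (Hr : RtoC r <> 0%C).
    { intros E0. apply RtoC_inj in E0. unfold r in E0. nra. }
    rewrite RtoC_inv by (intros E0; apply Hr; now rewrite E0).
    replace ((zeta N j - 1) * (zeta N j - 1))%C with (- (RtoC r * zeta N j))%C
      by (rewrite HC; ring).
    field. auto.
  - rewrite E. rewrite Rmult_1_r.
    unfold Rdiv. rewrite !RtoC_mult, RtoC_inv by lra.
    replace (RtoC 4) with ((1 + 1) * (1 + 1))%C by (apply injective_projections; simpl; ring).
    field.
Qed.

(* The zeros in [x] of [1 + (1 + b (x - e) / N)^N]. *)
Definition pole (b e : R) (N j : nat) : C :=
  (RtoC e + RtoC (INR N / b) * (zeta N j - 1))%C.

(** The first bound makes the resolvents of the poles compatible with the weight; the second one,
    with [zeta_distance_sum], makes the [|psi y_j|^2] summable uniformly in [N]. *)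
Lemma psi_pole_le (b e T : R) (N j : nat) : 0 < b -> 0 < T <= / 4 -> 4 * T * b <= 1 ->
  (j < N)%nat -> b * (Rabs e + 2) <= INR N ->
  Cmod (psi (pole b e N j)) <= exp (- (2 * T)) /\
  Cmod (psi (pole b e N j)) * Cmod (zeta N j - 1)%C <= (1 + Rabs e) * b / INR N.
Proof.
  intros Hb HT HTb Hj HN.
  assert (HN0 : 0 < INR N) by (apply lt_0_INR; lia).
  destruct (zeta_distance_sum N ltac:(lia)) as [Hpos Hsum].
  set (y := pole b e N j). set (k := Cmod (zeta N j - 1)%C).
  assert (Hk : 0 < k) by apply Hpos.
  (* A single term of [zeta_distance_sum] is at most the whole sum, hence [|zeta - 1| >= 2 / N]. *)
  assert (Hk2 : 4 <= INR N * INR N * (k * k)).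
  { assert (/ (k * k) <= INR N * INR N / 4).
    { rewrite <- Hsum. apply (rsum_term_le (fun j => / (Cmod (zeta N j - 1)%C *
        Cmod (zeta N j - 1)%C))); auto.
      intros i _. pose proof (Hpos i). left. apply Rinv_0_lt_compat. nra. }
    assert (0 < k * k) by nra.
    apply (Rmult_le_compat_r (k * k)) in H; [|lra]. rewrite Rinv_l in H by lra. lra. }
  pose proof (psi_root y) as Hroot. pose proof (psi_le_1 y) as H1.
  pose proof (joukowski_root_le_Re y (psi y) Hroot H1) as Hy.
  pose proof (Cmod_ge_0 (psi y)) as H0. pose proof (Rabs_pos e) as He.
  set (v := INR N / b).
  assert (Hv : 0 < v) by now apply Rdiv_lt_0_compat.
  assert (Hvb : v * b = INR N) by (unfold v; field; lra).
  split.
  - set (t := (2 * INR j + 1) * PI / INR N).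
    assert (Hzt : zeta N j = (cos t, sin t)) by (unfold zeta; now rewrite expi_real).
    pose proof (sin2_cos2 t) as S2. unfold Rsqr in S2.
    assert (Hkt : k * k = 2 * (1 - cos t)).
    { unfold k. rewrite sqr_Cmod, Hzt. simpl. lra. }
    assert (HRe : Re y = e + v * (cos t - 1)).
    { unfold y, pole. fold v. rewrite Hzt. simpl. ring. }
    assert (HIm : Im y = v * sin t).
    { unfold y, pole. fold v. rewrite Hzt. simpl. ring. }
    (* In the left half plane the pole has real part at most [-2], as [N / b >= |e| + 2]; in the
       right half plane [sin^2 t >= k^2 / 2] keeps its imaginary part at least [sqrt 2 / b] in
       modulus. *)
    destruct (Rle_lt_dec (cos t) 0) as [Hc|Hc].
    +
      assert (Re y <= -2) by (rewrite HRe; pose proof (Rle_abs e); nra).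
      assert (2 <= Cmod y).
      { pose proof (re_le_Cmod y) as HR. rewrite Rabs_left in HR; lra. }
      assert (Cmod (psi y) <= / 2) by nra.
      pose proof (exp_ineq1_le (- (2 * T))). lra.
    + assert (HY2 : 2 / (b * b) <= Im y * Im y).
      { rewrite HIm. apply Rmult_le_reg_r with (b * b); [nra|].
        replace (2 / (b * b) * (b * b)) with 2 by (field; lra).
        replace (v * sin t * (v * sin t) * (b * b)) with (v * b * (v * b) * (sin t * sin t)) by ring.
        rewrite Hvb. assert (k * k / 2 <= sin t * sin t).
        { rewrite Hkt. nra. }
        nra. }
      assert (HTT : 4 * T * (4 * T) <= / (b * b)).
      { apply Rmult_le_reg_r with (b * b); [nra|]. rewrite Rinv_l by nra.
        replace (4 * T * (4 * T) * (b * b)) with ((4 * T * b) * (4 * T * b)) by ring.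
        assert (0 <= 4 * T * b) by nra. nra. }
      assert (Hbb : 0 < / (b * b)) by (apply Rinv_0_lt_compat; nra).
      unfold Rdiv in HY2.
      apply (joukowski_root_le y _ (2 * T) (4 * T)); auto.
      * intros E. rewrite E in HY2. lra.
      * lra.
      * replace (4 * T) with (2 * (2 * T)) by ring. apply sinh_le_2x; lra.
      * pose proof (Rle_0_sqr (Re y)) as HX. unfold Rsqr in HX.
        nra.
  - assert (Hyk : v * k - Rabs e <= Cmod y).
    { unfold y, pole. fold v.
      pose proof (Cmod_minus_ge (RtoC v * (zeta N j - 1)) (- RtoC e)) as HM.
      rewrite Cmod_opp, Cmod_mult, !Cmod_R in HM. fold k in HM.
      rewrite (Rabs_right v) in HM by lra.
      replace (RtoC v * (zeta N j - 1) - - RtoC e)%C with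
        (RtoC e + RtoC v * (zeta N j - 1))%C in HM by ring. exact HM. }
    assert (Cmod (psi y) * (v * k) <= 1 + Rabs e) by nra.
    apply Rmult_le_reg_r with v; auto.
    replace ((1 + Rabs e) * b / INR N * v) with (1 + Rabs e) by (unfold v; field; lra).
    lra.
Qed.

Definition fermi_quotient_approx (b e : R) (N : nat) (x1 x2 : R) : C :=
  (RtoC (/ b) * csum (fun j => zeta N j *
    (/ (pole b e N j - RtoC x1) * / (pole b e N j - RtoC x2))) N)%C.

Lemma coef_bound_fermi_approx (b e eta omega d T : R) :
  0 < b -> 0 < eta -> 0 < d <= T -> T <= / 4 -> 4 * T * b <= 1 -> 8 * d <= eta ->
  1024 * (T * T) * (eta + Rabs omega) <= eta * eta ->
  exists M, forall N, b * (Rabs e + 2) <= INR N ->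
    coef_bound d (T - d) (fun x1 x2 =>
      fermi_quotient_approx b e N x1 x2 * relaxation_factor eta omega x1 x2)%C M.
Proof.
  intros Hb He Hd HT HTb Hde HTe.
  destruct (coef_bound_relaxation_factor eta omega d T) as [M [HM HG]]; auto.
  set (rho := exp (- T)).
  assert (Hrho : rho < 1) by (unfold rho; rewrite <- exp_0; apply exp_increasing; lra).
  set (A := 4 / ((1 - rho) * (1 - rho))).
  assert (HA : 0 < A) by (unfold A; apply Rdiv_lt_0_compat; [lra|]; nra).
  set (B := (1 + Rabs e) * b).
  (* Each pole costs [A * |psi y_j|] in either variable, and the sum of the [|psi y_j|^2] is at most
     [(B / N)^2 * N^2 / 4]. *)
  exists (/ b * (A * A * M * (B * B / 4))).
  intros N HN.
  assert (HR : forall x1 x2, Cmod (relaxation_factor eta omega x1 x2) <= / eta).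
  { intros. now apply relaxation_factor_le. }
  destruct N as [|N'] eqn:EN.
  { simpl in HN. pose proof (Rabs_pos e). nra. }
  rewrite <- EN in *.
  assert (HN0 : 0 < INR N) by (apply lt_0_INR; lia).
  destruct (zeta_distance_sum N ltac:(lia)) as [Hpos Hsum].
  apply (coef_bound_ext _ _ (fun x1 x2 => RtoC (/ b) * csum (fun j => zeta N j *
    (/ (pole b e N j - x1) * (/ (pole b e N j - x2) * relaxation_factor eta omega x1 x2))) N)%C).
  { intros x1 x2 _ _. unfold fermi_quotient_approx.
    rewrite <- Cmult_assoc. f_equal. rewrite Cmult_comm, <- csum_scal.
    apply csum_ext; intros; ring. }
  apply (coef_bound_weaken _ _ _ (Cmod (RtoC (/ b)) *
    rsum (fun j => Cmod (zeta N j) * (A * Cmod (psi (pole b e N j)) *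
      (A * Cmod (psi (pole b e N j)) * M))) N)).
  - rewrite Cmod_R, Rabs_right by (apply Rle_ge, Rlt_le, Rinv_0_lt_compat; auto).
    apply Rmult_le_compat_l; [left; now apply Rinv_0_lt_compat|].
    apply Rle_trans with (rsum (fun j => A * A * M * (B * B / (INR N * INR N)) *
      / (Cmod (zeta N j - 1)%C * Cmod (zeta N j - 1)%C)) N).
    + apply rsum_le. intros j Hj. rewrite Cmod_zeta.
      destruct (psi_pole_le b e T N j) as [_ P2]; auto; try lra.
      pose proof (Hpos j) as Hk. set (k := Cmod (zeta N j - 1)%C) in *.
      pose proof (Cmod_ge_0 (psi (pole b e N j))) as Hp. set (p := Cmod (psi _)) in *.
      fold B in P2.
      assert (Hpp : p * p <= B * B / (INR N * INR N) * / (k * k)).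
      { replace (B * B / (INR N * INR N) * / (k * k)) with
          (B / INR N / k * (B / INR N / k)) by (field; lra).
        assert (p <= B / INR N / k).
        { apply Rmult_le_reg_r with k; auto. unfold Rdiv at 1.
          rewrite (Rmult_assoc (B / INR N)), Rinv_l, Rmult_1_r by lra. lra. }
        apply Rmult_le_compat; lra. }
      replace (1 * (A * p * (A * p * M))) with (A * A * M * (p * p)) by ring.
      rewrite (Rmult_assoc (A * A * M)). apply Rmult_le_compat_l; auto.
      apply Rmult_le_pos; nra.
    + rewrite rsum_scal, Hsum. right. field. lra.
  - apply coef_bound_scal, coef_bound_csum. intros j Hj.
    destruct (psi_pole_le b e T N j) as [P1 _]; auto; try lra.
    set (y := pole b e N j) in *.
    (* Of the decay [exp (- 2 T)] one half pays for the weight, the other half leaves the ratio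
       [rho < 1]. *)
    assert (P3 : Cmod (psi y) * exp (d + (T - d)) <= rho).
    { unfold rho. replace (d + (T - d)) with T by ring.
      replace (- T) with (- (2 * T) + T) by ring. rewrite exp_plus.
      apply Rmult_le_compat_r; [left; apply exp_pos|auto]. }
    assert (P4 : Cmod (psi y) <= rho).
    { eapply Rle_trans; [exact P1|]. apply exp_le_compat; lra. }
    apply coef_bound_scal.
    apply (coef_bound_resolvent _ _ _ _ rho (2 / ((1 - rho) * (1 - rho)) * / eta));
      auto using psi_root; try lra.
    { pose proof (Cmod_ge_0 (psi y)). assert (0 <= A * Cmod (psi y)) by nra. nra. }
    + apply (coef_bound_swap _ _ (fun x1 x2 => / (y - x1) * relaxation_factor eta omega x2 x1)%C).
      apply (coef_bound_resolvent _ _ _ _ rho (/ eta)); auto using psi_root; try lra.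
      now apply coef_bound_swap.
    + intros x1 x2 Hx1 Hx2. apply Cmod_mult_le; auto.
      apply (resolvent_bound (psi y)); auto using psi_root.
Qed.

(** * Convergence of the approximation *)

Lemma one_minus_pow_ge (t : R) (n : nat) : 0 <= t <= 1 -> 1 - INR n * t <= (1 - t) ^ n.
Proof.
  intros Ht. induction n as [|n IH]; [simpl; lra|].
  rewrite S_INR. simpl. pose proof (pos_INR n).
  nra.
Qed.

(** The lower estimate raises [(1 - x^2) exp x <= 1 + x] to the power [N] and applies the Bernoulli
    inequality. The exponent [N - 1] is that of the derivative of [(1 + c / N)^N] in [c]. *)
Lemma exp_compound_approx (U c : R) (N : nat) : 0 <= U -> Rabs c <= U ->
  2 * U + 1 <= INR N ->
  Rabs ((1 + c / INR N) ^ N - exp c) <= exp U * (U * U + 2 * U) / INR N /\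
  Rabs ((1 + c / INR N) ^ (N - 1) - exp c) <= exp U * (U * U + 2 * U) / INR N /\
  0 <= (1 + c / INR N) ^ N.
Proof.
  intros HU Hc HN. apply Rabs_le_between in Hc.
  assert (HN0 : 0 < INR N) by lra.
  set (x := c / INR N).
  assert (Hx : c = INR N * x) by (unfold x; field; lra).
  assert (Hx2 : - / 2 <= x <= / 2) by nra.
  assert (Hp : (1 + x) ^ N <= exp c).
  { rewrite Hx, <- exp_pow_INR. apply pow_incr. split; [lra|]. apply exp_ineq1_le. }
  assert (Hp0 : 0 < (1 + x) ^ N) by (apply pow_lt; lra).
  assert (HcU : exp c <= exp U) by (apply exp_le_compat; lra).
  assert (Hlow : (1 - INR N * (x * x)) * exp c <= (1 + x) ^ N).
  { apply Rle_trans with ((1 - x * x) ^ N * exp c).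
    - apply Rmult_le_compat_r; [lra|]. apply one_minus_pow_ge. split; [apply Rle_0_sqr|nra].
    - rewrite Hx, <- exp_pow_INR, <- Rpow_mult_distr. apply pow_incr.
      pose proof (exp_pos x) as Hex. split; [apply Rmult_le_pos; nra|].
      pose proof (exp_ineq1_le (- x)) as H1. rewrite exp_Ropp in H1.
      apply (Rmult_le_compat_l (exp x)) in H1; [|lra]. rewrite Rinv_r in H1 by lra.
      replace ((1 - x * x) * exp x) with ((1 + x) * (exp x * (1 + - x))) by ring.
      rewrite <- (Rmult_1_r (1 + x)) at 2. apply Rmult_le_compat_l; lra. }
  assert (HxU : INR N * (x * x) <= U * U / INR N).
  { unfold x. replace (INR N * (c / INR N * (c / INR N))) with (c * c / INR N) by (field; lra).
    apply Rmult_le_compat_r; [left; now apply Rinv_0_lt_compat|]. nra. }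
  assert (Hi : 0 < / INR N) by now apply Rinv_0_lt_compat.
  assert (HE1 : exp c * (U * U / INR N) <= exp U * (U * U / INR N)).
  { apply Rmult_le_compat_r; [|auto]. unfold Rdiv. nra. }
  assert (Hgap : exp c - (1 + x) ^ N <= exp U * (U * U / INR N)) by nra.
  assert (Hs : (1 + x) ^ N = (1 + x) * (1 + x) ^ (N - 1)).
  { replace N with (S (N - 1)) at 1; [reflexivity|].
    assert (N <> O) by (intros ->; simpl in HN0; lra). lia. }
  assert (Hq0 : 0 < (1 + x) ^ (N - 1)) by (apply pow_lt; lra).
  assert (HxN : Rabs x <= U / INR N).
  { unfold x, Rdiv. rewrite Rabs_mult, (Rabs_right (/ INR N)) by lra.
    apply Rmult_le_compat_r; [lra|]. apply Rabs_le; lra. }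
  assert (Hdiff : Rabs ((1 + x) ^ (N - 1) - (1 + x) ^ N) <= 2 * exp U * (U / INR N)).
  { rewrite Hs. replace ((1 + x) ^ (N - 1) - (1 + x) * (1 + x) ^ (N - 1))
      with (- x * (1 + x) ^ (N - 1)) by ring.
    rewrite Rabs_mult, Rabs_Ropp, (Rabs_right (_ ^ _)) by lra.
    rewrite Rmult_comm. apply Rmult_le_compat; try lra; [apply Rabs_pos|]. nra. }
  replace (exp U * (U * U + 2 * U) / INR N) with
    (exp U * (U * U / INR N) + 2 * exp U * (U / INR N)) by (field; lra).
  assert (0 <= 2 * exp U * (U / INR N)).
  { apply Rmult_le_pos; [lra|]. unfold Rdiv. apply Rmult_le_pos; nra. }
  split; [|split].
  - apply Rabs_le. lra.
  - apply Rabs_le. apply Rabs_le_between in Hdiff. lra.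
  - lra.
Qed.

Lemma pow_sum_telescope (p q : R) (n : nat) :
  (p - q) * rsum (fun m => p ^ m * q ^ (n - 1 - m)) n = p ^ n - q ^ n.
Proof.
  induction n as [|n IH]; [simpl; ring|].
  change (rsum (fun m => p ^ m * q ^ (S n - 1 - m)) (S n)) with
    (rsum (fun m => p ^ m * q ^ (S n - 1 - m)) n + p ^ n * q ^ (S n - 1 - n)).
  rewrite (rsum_ext _ (fun m => q * (p ^ m * q ^ (n - 1 - m)))).
  - rewrite rsum_scal, Rmult_plus_distr_l.
    replace (S n - 1 - n)%nat with O by lia.
    transitivity (q * ((p - q) * rsum (fun m => p ^ m * q ^ (n - 1 - m)) n)
      + (p - q) * p ^ n); [simpl; ring|]. rewrite IH. simpl; ring.
  - intros m Hm. replace (S n - 1 - m)%nat with (S (n - 1 - m)) by lia. simpl; ring.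
Qed.

Definition exp_quotient (u v : R) : R :=
  if Req_EM_T u v then exp u else (exp u - exp v) / (u - v).

(** The difference quotient of [c |-> (1 + c / N)^N], as a sum that remains meaningful for
    [u = v]. *)
Definition compound_quotient (N : nat) (u v : R) : R :=
  rsum (fun m => (1 + u / INR N) ^ m * (1 + v / INR N) ^ (N - 1 - m)) N / INR N.

(** Applying the mean value theorem to [(1 + t / N)^N - exp t], rather than estimating numerator and
    denominator separately, gives an error uniform up to the diagonal. *)
Lemma compound_quotient_approx (U u v : R) (N : nat) : 0 <= U -> Rabs u <= U ->
  Rabs v <= U -> 2 * U + 1 <= INR N ->
  Rabs (compound_quotient N u v - exp_quotient u v) <= exp U * (U * U + 2 * U) / INR N
  /\ Rabs (exp_quotient u v) <= exp U.
Proof.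
  intros HU Hu Hv HN.
  unfold compound_quotient, exp_quotient.
  destruct (Req_EM_T u v) as [<-|Huv].
  - rewrite (rsum_ext _ (fun _ => (1 + u / INR N) ^ (N - 1))).
    2:{ intros m Hm. rewrite <- pow_add. f_equal. lia. }
    rewrite rsum_const.
    replace (INR N * (1 + u / INR N) ^ (N - 1) / INR N) with ((1 + u / INR N) ^ (N - 1))
      by (field; lra).
    split; [now apply exp_compound_approx|].
    rewrite Rabs_right by (apply Rle_ge, Rlt_le, exp_pos).
    apply exp_le_compat. eapply Rle_trans; [apply Rle_abs|auto].
  - pose proof (pow_sum_telescope (1 + u / INR N) (1 + v / INR N) N) as E.
    set (s := rsum _ N) in *.
    assert (Es : s / INR N = ((1 + u / INR N) ^ N - (1 + v / INR N) ^ N) / (u - v)).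
    { rewrite <- E. field. split; lra. }
    rewrite Es.
    assert (Hmid : forall c, Rmin v u <= c <= Rmax v u -> Rabs c <= U).
    { intros c Hc. apply Rabs_le_between in Hu. apply Rabs_le_between in Hv.
      apply Rabs_le. unfold Rmin, Rmax in Hc. destruct (Rle_dec v u); lra. }
    split.
    + destruct (MVT_gen (fun t => (1 + t / INR N) ^ N - exp t) v u
        (fun t => (1 + t / INR N) ^ (N - 1) - exp t)) as [c [Hc Ec]].
      * intros t _. auto_derive; auto.
        unfold Rdiv. replace (Init.Nat.pred N) with (N - 1)%nat by lia. field; lra.
      * intros t _. apply continuity_pt_filterlim.
        apply (ex_derive_continuous (fun t => (1 + t / INR N) ^ N - exp t)).
        auto_derive; auto.
      * simpl in Ec.
        replace (((1 + u / INR N) ^ N - (1 + v / INR N) ^ N) / (u - v) - (exp u - exp v) / (u - v))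
          with (((1 + u / INR N) ^ N - exp u - ((1 + v / INR N) ^ N - exp v)) / (u - v))
          by (field; lra).
        rewrite Ec. unfold Rdiv at 1. rewrite Rmult_assoc, Rinv_r, Rmult_1_r by lra.
        apply exp_compound_approx; auto.
    + destruct (MVT_gen exp v u exp) as [c [Hc Ec]].
      * intros t _. apply is_derive_exp.
      * intros t _. apply continuity_pt_filterlim, (continuous_exp t).
      * rewrite Ec. unfold Rdiv. rewrite Rmult_assoc, Rinv_r, Rmult_1_r by lra.
        rewrite Rabs_right by (apply Rle_ge, Rlt_le, exp_pos).
        apply exp_le_compat. eapply Rle_trans; [apply Rle_abs|auto].
Qed.

Lemma fermi_quotient_eq (b e x1 x2 : R) :
  let f := fun E => fermi b (E - e) in
  (if Req_EM_T x1 x2 then Derive f x1 else (f x1 - f x2) / (x1 - x2)) =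
  - b * exp_quotient (b * (x1 - e)) (b * (x2 - e)) /
    ((1 + exp (b * (x1 - e))) * (1 + exp (b * (x2 - e)))).
Proof.
  intros f. pose proof (exp_pos (b * (x1 - e))) as H1. pose proof (exp_pos (b * (x2 - e))) as H2.
  unfold exp_quotient. destruct (Req_EM_T x1 x2) as [<-|Hx].
  - destruct (Req_EM_T _ _) as [_|C]; [|now destruct C].
    apply is_derive_unique. unfold f, fermi. auto_derive; [unfold Rminus in *; lra|].
    unfold Rminus. field. unfold Rminus in *; lra.
  - unfold f, fermi. destruct (Req_EM_T (b * (x1 - e)) _) as [C|C].
    + assert (Hb : b = 0).
      { assert (E : b * (x1 - x2) = 0) by lra. apply Rmult_integral in E. destruct E; lra. }
      rewrite Hb, !Rmult_0_l, exp_0. field. lra.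
    + set (a := exp (b * (x1 - e))) in *. set (c := exp (b * (x2 - e))) in *.
      clearbody a c. field. repeat split; lra.
Qed.

Lemma RtoC_pow_nat (x : R) (n : nat) : (RtoC x ^ n)%C = RtoC (x ^ n).
Proof.
  induction n as [|n IH]; [reflexivity|]. rewrite Cpow_S, IH. simpl.
  now rewrite RtoC_mult.
Qed.

(** The poles are placed so that [y_j - x = (N / b) (zeta_j - p)] with [p = 1 + b (x - e) / N]; this
    reduces the claim to [zeta_double_resolvent_sum]. *)
Lemma fermi_quotient_approx_eq (b e x1 x2 : R) (N : nat) : 0 < b -> (0 < N)%nat ->
  let u := b * (x1 - e) in let v := b * (x2 - e) in
  0 <= (1 + u / INR N) ^ N -> 0 <= (1 + v / INR N) ^ N ->
  fermi_quotient_approx b e N x1 x2 = RtoC (- b * compound_quotient N u v /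
    ((1 + (1 + u / INR N) ^ N) * (1 + (1 + v / INR N) ^ N))).
Proof.
  intros Hb HN u v Hu Hv. assert (HN0 : 0 < INR N) by now apply lt_0_INR.
  set (p := 1 + u / INR N) in *. set (q := 1 + v / INR N) in *.
  assert (Np : (1 + RtoC p ^ N)%C <> 0%C).
  { rewrite RtoC_pow_nat, <- RtoC_plus. intros E. apply RtoC_inj in E. lra. }
  assert (Nq : (1 + RtoC q ^ N)%C <> 0%C).
  { rewrite RtoC_pow_nat, <- RtoC_plus. intros E. apply RtoC_inj in E. lra. }
  pose proof (zeta_double_resolvent_sum N p q HN Np Nq) as E.
  unfold fermi_quotient_approx.
  assert (Hpole : forall j x, (pole b e N j - RtoC x)%C =
    (RtoC (INR N / b) * (zeta N j - RtoC (1 + b * (x - e) / INR N)))%C).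
  { intros j x. unfold pole.
    assert (Ex : RtoC x = (RtoC e + RtoC (INR N / b) * RtoC (b * (x - e) / INR N))%C).
    { rewrite <- RtoC_mult, <- RtoC_plus. f_equal. field; lra. }
    rewrite Ex at 1. rewrite (RtoC_plus 1). ring. }
  assert (Hnz : forall j x, 0 <= (1 + b * (x - e) / INR N) ^ N ->
    (zeta N j - RtoC (1 + b * (x - e) / INR N))%C <> 0%C).
  { intros j x Hx H0. pose proof (zeta_geometric N j (RtoC (1 + b * (x - e) / INR N)) HN) as G.
    rewrite H0, RtoC_pow_nat, <- RtoC_plus in G.
    replace (0 * csum (fun m => RtoC (1 + b * (x - e) / INR N) ^ m * / zeta N j ^ S m) N)%C
      with (RtoC 0) in G by ring.
    apply RtoC_inj in G. lra. }
  assert (Hr : INR N / b <> 0).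
  { assert (0 < INR N / b) by now apply Rdiv_lt_0_compat. lra. }
  assert (HrC : RtoC (INR N / b) <> 0%C) by (intros H0; apply RtoC_inj in H0; auto).
  rewrite (csum_ext _ (fun j => RtoC (b / INR N * (b / INR N)) *
    (zeta N j / ((zeta N j - p) * (zeta N j - q))))%C).
  2:{ intros j _. rewrite !Hpole.
      pose proof (Hnz j x1 Hu) as H1. pose proof (Hnz j x2 Hv) as H2.
      change (1 + b * (x1 - e) / INR N) with p in *. change (1 + b * (x2 - e) / INR N) with q in *.
      replace (RtoC (b / INR N * (b / INR N))) with (/ RtoC (INR N / b) * / RtoC (INR N / b))%C.
      - field. auto.
      - rewrite <- RtoC_inv, <- RtoC_mult by auto. f_equal. field. lra. }
  rewrite csum_scal, E.
  assert (Ec : csum (fun m => RtoC p ^ m * RtoC q ^ (N - 1 - m))%C N =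
    RtoC (INR N * compound_quotient N u v)).
  { rewrite (csum_ext _ (fun m => RtoC (p ^ m * q ^ (N - 1 - m)))).
    - rewrite rsum_csum. f_equal. unfold compound_quotient. fold p q. field. lra.
    - intros m _. now rewrite RtoC_mult, !RtoC_pow_nat. }
  rewrite Ec, !RtoC_pow_nat, <- !RtoC_plus, <- RtoC_opp, <- !RtoC_mult, <- RtoC_div.
  - rewrite <- !RtoC_mult. f_equal. field. lra.
  - apply Rmult_integral_contrapositive_currified; lra.
Qed.

Lemma Rabs_mult_le (x y a b : R) : Rabs x <= a -> Rabs y <= b -> Rabs (x * y) <= a * b.
Proof. intros. rewrite Rabs_mult. apply Rmult_le_compat; auto using Rabs_pos. Qed.

Lemma fermi_quotient_approx_cvg (b e eps : R) : 0 < b -> 0 < eps ->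
  exists N0 : nat, forall N, (N0 <= N)%nat -> forall x1 x2, -1 <= x1 <= 1 -> -1 <= x2 <= 1 ->
    let f := fun E => fermi b (E - e) in
    Cmod (RtoC (if Req_EM_T x1 x2 then Derive f x1 else (f x1 - f x2) / (x1 - x2))
      - fermi_quotient_approx b e N x1 x2)%C <= eps.
Proof.
  intros Hb Heps. set (U := b * (Rabs e + 1)).
  assert (HU : 0 <= U) by (unfold U; pose proof (Rabs_pos e); nra).
  set (K := exp U * (U * U + 2 * U)).
  pose proof (exp_pos U) as HeU.
  assert (HK : 0 <= K) by (unfold K; nra).
  (* There are three errors of size [K / N]: one in the exponential quotient, and one in each
     denominator, multiplied by the bound [exp U] on that quotient. *)
  set (A := b * (K * (1 + 2 * exp U))).
  assert (HA : 0 <= A) by (unfold A; apply Rmult_le_pos; nra).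
  destruct (archimed_cor1 (eps / (A + 1))) as [m [Hm Hm0]].
  { apply Rdiv_lt_0_compat; lra. }
  destruct (INR_unbounded (2 * U + 1)) as [m2 Hm2].
  exists (m + m2)%nat. intros N HN x1 x2 Hx1 Hx2 f.
  assert (HN1 : INR m <= INR N) by (apply le_INR; lia).
  assert (HN2 : INR m2 <= INR N) by (apply le_INR; lia).
  assert (HN0 : 0 < INR N) by lra.
  assert (Hm0' : 0 < INR m) by now apply lt_0_INR.
  unfold f. rewrite (fermi_quotient_eq b e x1 x2).
  set (u := b * (x1 - e)). set (v := b * (x2 - e)).
  assert (HxU : forall x, -1 <= x <= 1 -> Rabs (b * (x - e)) <= U).
  { intros x Hx. unfold U. rewrite Rabs_mult, (Rabs_right b) by lra.
    apply Rmult_le_compat_l; [lra|].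
    unfold Rminus. eapply Rle_trans; [apply Rabs_triang|]. rewrite Rabs_Ropp.
    assert (Rabs x <= 1) by (apply Rabs_le; lra). lra. }
  pose proof (HxU x1 Hx1) as Hu. fold u in Hu. pose proof (HxU x2 Hx2) as Hv. fold v in Hv.
  destruct (exp_compound_approx U u N HU Hu ltac:(lra)) as (P1 & _ & P2).
  destruct (exp_compound_approx U v N HU Hv ltac:(lra)) as (Q1 & _ & Q2).
  destruct (compound_quotient_approx U u v N HU Hu Hv ltac:(lra)) as [D1 D2].
  rewrite fermi_quotient_approx_eq; auto.
  2:{ destruct N; [simpl in HN0; lra|lia]. }
  fold u v. rewrite <- RtoC_minus, Cmod_R.
  set (P := (1 + u / INR N) ^ N) in *. set (Q := (1 + v / INR N) ^ N) in *.
  set (D := exp_quotient u v) in *. set (Dn := compound_quotient N u v) in *.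
  pose proof (exp_pos u) as Eu. pose proof (exp_pos v) as Ev.
  set (a := exp u) in *. set (c := exp v) in *.
  fold K in P1, Q1, D1. set (k := K / INR N) in *.
  assert (Hk : A / INR N <= eps).
  { assert (/ INR N <= / INR m) by (apply Rinv_le_contravar; lra).
    apply Rle_trans with ((A + 1) * (eps / (A + 1))); [|right; field; lra].
    unfold Rdiv at 1. apply Rmult_le_compat; try lra.
    left; now apply Rinv_0_lt_compat. }
  eapply Rle_trans; [|exact Hk].
  replace (A / INR N) with (b * (k * 1 + exp U * ((k + k) * 1))) by (unfold A, k; field; lra).
  assert (I1 : forall t, 0 <= t -> 0 < / (1 + t) <= 1).
  { intros t Ht. split; [apply Rinv_0_lt_compat; lra|].
    rewrite <- Rinv_1. apply Rinv_le_contravar; lra. }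
  assert (I2 : forall s t, 0 <= s -> 0 <= t -> Rabs (/ (1 + s) * / (1 + t)) <= 1).
  { intros s t Hs Ht. destruct (I1 s Hs), (I1 t Ht). rewrite Rabs_right; nra. }
  replace (- b * D / ((1 + a) * (1 + c)) - - b * Dn / ((1 + P) * (1 + Q))) with
    (b * ((Dn - D) * (/ (1 + P) * / (1 + Q)) +
      D * ((a - P) * (/ (1 + P) * / (1 + Q)) * / (1 + a)
        + (c - Q) * (/ (1 + a) * / (1 + Q)) * / (1 + c)))) by (field; repeat split; lra).
  rewrite Rabs_mult, (Rabs_right b) by lra. apply Rmult_le_compat_l; [lra|].
  eapply Rle_trans; [apply Rabs_triang|]. apply Rplus_le_compat.
  - apply Rabs_mult_le; auto.
  - apply Rabs_mult_le; auto.
    eapply Rle_trans; [apply Rabs_triang|]. rewrite Rmult_1_r.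
    assert (B : forall s t r, Rabs (t - s) <= k -> Rabs r <= 1 -> 0 <= s -> 0 <= t ->
      forall w, 0 <= w -> Rabs ((s - t) * r * / (1 + w)) <= k).
    { intros s t r H1 H2 H3 H4 w Hw. replace k with (k * 1 * 1) by ring.
      apply Rabs_mult_le; [apply Rabs_mult_le; auto; now rewrite Rabs_minus_sym|].
      destruct (I1 w Hw). rewrite Rabs_right; lra. }
    apply Rplus_le_compat; apply B; auto; try lra; apply I2; lra.
Qed.

Lemma coefficient_decay (z : parameters) (d T : R) (c : nat -> nat -> C) :
  0 < beta z -> 0 < eta z -> 0 < d <= T -> T <= / 4 -> 4 * T * beta z <= 1 ->
  8 * d <= eta z ->
  1024 * (T * T) * (eta z + Rabs (omega z)) <= eta z * eta z ->
  chebyshev_coefficients (F_cond z) c ->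
  exists M : R, forall k1 k2 : nat,
    Cmod (c k1 k2) <= M * exp (- d * (INR k1 + INR k2) - (T - d) * Rabs (INR k1 - INR k2)).
Proof.
  intros Hb He Hd HT HTb Hde HTe Hc.
  set (b := beta z) in *. set (e := EF z).
  destruct (coef_bound_fermi_approx b e (eta z) (omega z) d T) as [M HM]; auto.
  exists M. intros k1 k2.
  apply (chebyshev_coefficient_bound d (T - d) (F_cond z)); auto.
  apply coef_bound_limit. intros eps Heps.
  (* The tolerance anticipates the bound [1 / eta] on the relaxation factor. *)
  destruct (fermi_quotient_approx_cvg b e (eps * eta z)) as [N0 HN0]; auto.
  { apply Rmult_lt_0_compat; auto. }
  destruct (INR_unbounded (b * (Rabs e + 2))) as [N1 HN1].
  set (N := (N0 + N1)%nat).
  assert (INR N1 <= INR N) by (apply le_INR; lia).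
  exists (fun x1 x2 => fermi_quotient_approx b e N x1 x2 *
    relaxation_factor (eta z) (omega z) x1 x2)%C.
  split; [apply HM; lra|]. intros x1 x2 Hx1 Hx2.
  specialize (HN0 N ltac:(lia) x1 x2 Hx1 Hx2).
  unfold F_cond. fold b e.
  set (Q := RtoC (if Req_EM_T x1 x2 then _ else _)) in *.
  unfold Cdiv. change (/ (RtoC x1 - RtoC x2 + shift z))%C with
    (relaxation_factor (eta z) (omega z) x1 x2).
  set (r := relaxation_factor (eta z) (omega z) x1 x2).
  replace (Q * r - fermi_quotient_approx b e N x1 x2 * r)%C with
    ((Q - fermi_quotient_approx b e N x1 x2) * r)%C by ring.
  replace eps with (eps * eta z * / eta z) by (field; lra).
  apply Cmod_mult_le; auto. now apply relaxation_factor_le.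
Qed.

(** * Neighbourhoods and continuity in terms of the modulus *)

Local Notation locallyC := (locally (T := C_UniformSpace)).
Local Notation continuousC :=
  (continuous (T := C_UniformSpace) (U := C_UniformSpace)).

Lemma locally_Cmod (x : C) (P : C -> Prop) :
  locallyC x P <->
  exists del, 0 < del /\ forall y, Cmod (y - x) < del -> P y.
Proof.
  split.
  - intros [del H]. exists del. split; [apply cond_pos|].
    intros y Hy. apply H. now apply C_NormedModule_mixin_compat1.
  (* The balls of [C_UniformSpace] are squares, compared with discs up to a factor [sqrt 2 <= 2]. *)
  - intros (del & Hd & H). exists (mkposreal (del / 2) ltac:(lra)).
    intros y Hy. apply H. apply C_NormedModule_mixin_compat2 in Hy. simpl in Hy.
    change (minus y x) with (y - x)%C in Hy.
    assert (sqrt 2 <= 2).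
    { rewrite <- (sqrt_square 2) at 2 by lra. apply sqrt_le_1; lra. }
    nra.
Qed.

Lemma continuous_Cmod (g : C -> C) (x : C) :
  continuousC g x <->
  forall eps, 0 < eps -> exists del, 0 < del /\
    forall y, Cmod (y - x) < del -> Cmod (g y - g x) < eps.
Proof.
  split.
  - intros H eps He.
    assert (HL : locallyC (g x) (fun z => Cmod (z - g x) < eps)).
    { apply locally_Cmod. exists eps; auto. }
    specialize (H _ HL). now apply locally_Cmod in H.
  - intros H P HP. apply locally_Cmod in HP. destruct HP as (eps & He & HP).
    apply locally_Cmod. destruct (H eps He) as (del & Hd & HD).
    exists del. split; auto.
Qed.

Lemma continuousC_plus (f g : C -> C) (x : C) : continuousC f x -> continuousC g x ->
  continuousC (fun y => f y + g y)%C x.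
Proof. apply (continuous_plus (U := C_UniformSpace) (V := C_R_NormedModule) f g). Qed.

Lemma continuousC_opp (f : C -> C) (x : C) : continuousC f x ->
  continuousC (fun y => - f y)%C x.
Proof. apply (continuous_opp (U := C_UniformSpace) (V := C_R_NormedModule) f). Qed.

Lemma Cmod_sub_lip (a b : C) : Rabs (Cmod a - Cmod b) <= Cmod (a - b).
Proof.
  apply Rabs_le. pose proof (Cmod_minus_ge a b). pose proof (Cmod_minus_ge b a) as H1.
  rewrite <- (Cmod_opp (b - a)) in H1. replace (- (b - a))%C with (a - b)%C in H1 by ring. lra.
Qed.

Lemma im_le_Cmod (c : C) : Rabs (Im c) <= Cmod c.
Proof. eapply Rle_trans; [apply Rmax_r|apply Rmax_Cmod]. Qed.

(** * The modulus of the two roots *)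

(** The function [A] of the overview; [alpha_segment] identifies it with [alpha segment]. *)
Definition outer_log (x : C) : R := - ln (Cmod (psi x)).

Lemma psi_pos (x : C) : 0 < Cmod (psi x).
Proof. apply Cmod_gt_0. eapply joukowski_root_neq_0, psi_root. Qed.

Lemma outer_log_nonneg (x : C) : 0 <= outer_log x.
Proof.
  unfold outer_log. pose proof (psi_pos x). pose proof (psi_le_1 x).
  assert (ln (Cmod (psi x)) <= 0); [|lra].
  rewrite <- ln_1. destruct H0 as [H0|H0]; [left; now apply ln_increasing|rewrite H0; lra].
Qed.

Lemma exp_outer_log (x : C) : exp (outer_log x) = / Cmod (psi x).
Proof. unfold outer_log. rewrite exp_Ropp, exp_ln; auto using psi_pos. Qed.

Lemma sqrt_root_joukowski (x g : C) : (g * g = x * x - 1)%C ->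
  ((x + g) * (x + g) - 2 * x * (x + g) + 1 = 0)%C.
Proof. intros H. transitivity (g * g - (x * x - 1))%C; [ring|]. rewrite H; ring. Qed.

Lemma sqrt_root_Cmod (x g : C) : (g * g = x * x - 1)%C ->
  (1 <= Cmod (x + g)%C -> Cmod (x + g)%C = exp (outer_log x)) /\
  (Cmod (x + g)%C <= 1 -> Cmod (x + g)%C = exp (- outer_log x)).
Proof.
  intros H. pose proof (sqrt_root_joukowski x g H) as Hr.
  set (f := (x + g)%C) in *. pose proof (psi_root x) as Hp.
  pose proof (psi_pos x) as P0. pose proof (psi_le_1 x) as P1.
  assert (E : ((f - psi x) * (f * psi x - 1) = 0)%C).
  { transitivity (psi x * (f * f - 2 * x * f + 1) - f * (psi x * psi x - 2 * x * psi x + 1))%C;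
      [ring|]. rewrite Hp, Hr; ring. }
  apply (f_equal Cmod) in E. rewrite Cmod_mult, Cmod_0 in E.
  assert (EE : exp (- outer_log x) = Cmod (psi x)).
  { rewrite exp_Ropp, exp_outer_log. field; lra. }
  rewrite EE, exp_outer_log.
  apply Rmult_integral in E. destruct E as [E|E]; apply Cmod_eq_0 in E.
  - assert (Ef : f = psi x) by (transitivity (f - psi x + psi x)%C; [ring|rewrite E; ring]).
    rewrite Ef. split; intros; [|reflexivity].
    assert (Cmod (psi x) = 1) by lra. rewrite H1. field.
  - assert (Ef : (f * psi x = 1)%C) by (transitivity (f * psi x - 1 + 1)%C; [ring|rewrite E; ring]).
    apply (f_equal Cmod) in Ef. rewrite Cmod_mult, Cmod_1 in Ef.
    assert (Ef2 : Cmod f = / Cmod (psi x)).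
    { apply Rmult_eq_reg_r with (Cmod (psi x)); [|lra]. rewrite Rinv_l by lra. auto. }
    split; intros; auto. assert (Cmod (psi x) = 1) by nra. rewrite Ef2, H1. field.
Qed.

(* Writing [f = x + g], so that [x - g = / f], both [2 Im x] and [2 Im g] are
   multiples of [Im f]. *)
Lemma sqrt_root_Im (x g : C) : (g * g = x * x - 1)%C ->
  Im x * (Cmod (x + g)%C * Cmod (x + g)%C + 1) = Im g * (Cmod (x + g)%C * Cmod (x + g)%C - 1).
Proof.
  intros H. rewrite sqr_Cmod. destruct x as [X Y], g as [u v].
  apply (f_equal Re) in H as H1. apply (f_equal Im) in H as H2. simpl in *.
  assert (K1 : u * u - v * v = X * X - Y * Y - 1) by lra.
  assert (K2 : u * v = X * Y) by lra.
  apply (f_equal (Rmult v)) in K1 as L1. apply (f_equal (Rmult Y)) in K1 as L2.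
  apply (f_equal (Rmult u)) in K2 as L3. apply (f_equal (Rmult X)) in K2 as L4.
  lra.
Qed.

Lemma sqrt_root_Im_eq_0 (x g : C) : (g * g = x * x - 1)%C -> Im g = 0 ->
  Im x = 0 /\ 1 <= Rabs (Re x).
Proof.
  intros H Hg. destruct x as [X Y], g as [u v]. simpl in *. subst v.
  apply (f_equal Re) in H as H1. apply (f_equal Im) in H as H2. simpl in *.
  assert (HX : 1 <= X * X) by nra.
  assert (HX1 : 1 <= Rabs X).
  { destruct (Rle_lt_dec 1 (Rabs X)) as [|HX2]; auto.
    apply Rabs_lt_between in HX2. nra. }
  split; auto.
  assert (X * Y = 0) by lra. apply Rmult_integral in H0. destruct H0; auto.
  subst X. lra.
Qed.

Lemma sqrt_root_Cmod_1 (x g : C) : (g * g = x * x - 1)%C -> Cmod (x + g)%C = 1 -> segment x.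
Proof.
  intros H H1. pose proof (sqrt_root_Im x g H) as HI. rewrite H1 in HI.
  assert (HY : Im x = 0) by lra. split; auto.
  apply Rabs_le_between.
  pose proof (sqrt_root_joukowski x g H) as Hr.
  pose proof (joukowski_root_le_Re x (x + g) Hr ltac:(lra)) as HC.
  rewrite H1, Rmult_1_l in HC. eapply Rle_trans; [apply re_le_Cmod|auto].
Qed.

Lemma outer_sqrt_root (x : C) : ((x - psi x) * (x - psi x) = x * x - 1)%C.
Proof.
  transitivity ((psi x * psi x - 2 * x * psi x + 1) + (x * x - 1))%C; [ring|].
  rewrite psi_root; ring.
Qed.

Lemma psi_segment (x : C) : Cmod (psi x) = 1 -> segment x.
Proof.
  intros H. apply (sqrt_root_Cmod_1 x (psi x - x)%C).
  - rewrite <- outer_sqrt_root. ring.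
  - replace (x + (psi x - x))%C with (psi x) by ring. auto.
Qed.

(** Off the segment [|psi x| < 1], so [|1 - psi x * psi y|] is bounded below for all [y], and
    [joukowski_root_diff] gives a Lipschitz estimate at [x]. *)
Lemma psi_continuous (x : C) : ~ segment x ->
  continuousC psi x.
Proof.
  intros Hs. apply continuous_Cmod. intros eps He.
  pose proof (psi_le_1 x) as P1. set (p := psi x) in *.
  assert (Hp : Cmod p < 1).
  { destruct P1 as [|P1]; auto. exfalso. now apply Hs, psi_segment. }
  exists (eps * (1 - Cmod p) / 2). split; [apply Rdiv_lt_0_compat; [apply Rmult_lt_0_compat|]; lra|].
  intros y Hy. pose proof (joukowski_root_diff x y p (psi y) (psi_root x) (psi_root y)) as HD.
  pose proof (psi_le_1 y) as Q1. set (q := psi y) in *.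
  pose proof (Cmod_ge_0 p).
  apply (f_equal Cmod) in HD. rewrite !Cmod_mult, Cmod_opp, Cmod_R, Rabs_right in HD by lra.
  pose proof (Cmod_minus_ge 1 (p * q)) as HG. rewrite Cmod_1, Cmod_mult in HG.
  assert (Cmod p * Cmod q <= Cmod p) by nra.
  pose proof (Cmod_ge_0 (q - p)%C). pose proof (Cmod_ge_0 (y - x)%C).
  assert (Cmod (q - p)%C * (1 - Cmod p) <= 2 * Cmod (y - x)%C).
  { apply Rle_trans with (Cmod (q - p)%C * Cmod (1 - p * q)%C).
    - apply Rmult_le_compat_l; lra.
    - rewrite HD. nra. }
  apply Rmult_lt_reg_r with (1 - Cmod p); lra.
Qed.

Lemma upper_sqrt_root_exists (x : C) : exists g : C, (g * g = x * x - 1)%C /\ 0 <= Im g.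
Proof.
  destruct (csqrt_exists (x * x - 1)%C) as [g Hg].
  destruct (Rle_lt_dec 0 (Im g)) as [H|H].
  - exists g; auto.
  - exists (- g)%C. split; [rewrite <- Hg; ring|simpl; unfold Im in H; lra].
Qed.

(** This root is continuous across the open segment and can jump only on the real rays [|x| >= 1],
    so it can continue the outer branch from above to below the segment. *)
Definition upper_sqrt_root (x : C) : C :=
  proj1_sig (constructive_indefinite_description _ (upper_sqrt_root_exists x)).

Lemma upper_sqrt_root_spec (x : C) :
  (upper_sqrt_root x * upper_sqrt_root x = x * x - 1)%C /\ 0 <= Im (upper_sqrt_root x).
Proof.
  unfold upper_sqrt_root. now destruct (constructive_indefinite_description _ _).
Qed.

Lemma upper_sqrt_root_continuous (x : C) : 0 < Im (upper_sqrt_root x) ->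
  continuousC upper_sqrt_root x.
Proof.
  intros H0. apply continuous_Cmod. intros eps He.
  destruct (upper_sqrt_root_spec x) as [Hx _]. set (g := upper_sqrt_root x) in *.
  set (M := 2 * Cmod x + 1). assert (HM : 0 < M) by (unfold M; pose proof (Cmod_ge_0 x); lra).
  exists (Rmin 1 (eps * Im g / M)).
  assert (Hq : 0 < eps * Im g / M) by (apply Rdiv_lt_0_compat; [apply Rmult_lt_0_compat|]; lra).
  split; [apply Rmin_glb_lt; lra|].
  intros y Hy. destruct (upper_sqrt_root_spec y) as [Hy1 Hy2].
  set (k := upper_sqrt_root y) in *.
  assert (E : ((k - g) * (k + g) = (y - x) * (y + x))%C).
  { transitivity (k * k - g * g)%C; [ring|]. rewrite Hy1, Hx; ring. }
  apply (f_equal Cmod) in E. rewrite !Cmod_mult in E.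
  assert (H1 : Cmod (y - x)%C < 1) by (eapply Rlt_le_trans; [exact Hy|apply Rmin_l]).
  assert (H2 : Cmod (y - x)%C < eps * Im g / M) by (eapply Rlt_le_trans; [exact Hy|apply Rmin_r]).
  assert (H3 : Cmod (y + x)%C <= M).
  { replace (y + x)%C with ((y - x) + 2 * x)%C by ring.
    eapply Rle_trans; [apply Cmod_triangle|].
    rewrite (Cmod_mult 2), Cmod_R, Rabs_right by lra. unfold M; lra. }
  assert (H4 : Im g <= Cmod (k + g)%C).
  { pose proof (im_le_Cmod (k + g)%C) as HI. simpl in HI.
    pose proof (Rle_abs (snd k + snd g)) as HA. unfold Im in *. lra. }
  pose proof (Cmod_ge_0 (k - g)%C). pose proof (Cmod_ge_0 (y - x)%C).
  assert (Cmod (k - g)%C * Im g < eps * Im g).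
  { apply Rle_lt_trans with (Cmod (y - x)%C * M).
    - rewrite <- (Rmult_comm M). apply Rle_trans with (Cmod (k - g)%C * Cmod (k + g)%C).
      + apply Rmult_le_compat_l; lra.
      + rewrite E, Rmult_comm. apply Rmult_le_compat_r; lra.
    - apply (Rmult_lt_compat_r M) in H2; auto.
      replace (eps * Im g / M * M) with (eps * Im g) in H2 by (field; lra). auto. }
  apply Rmult_lt_reg_r with (Im g); auto.
Qed.

(** Were the two roots opposite, the outer one would have nonpositive imaginary part, against
    [sqrt_root_Im] with [Im x > 0]. This agreement allows the two branches to be glued along the
    segment. *)
Lemma upper_sqrt_root_eq_outer (x : C) : 0 < Im x -> upper_sqrt_root x = (x - psi x)%C.
Proof.
  intros Hx. destruct (upper_sqrt_root_spec x) as [Hg Hi].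
  set (g := upper_sqrt_root x) in *. pose proof (outer_sqrt_root x) as Ho.
  set (h := (x - psi x)%C) in *.
  assert (E : ((g - h) * (g + h) = 0)%C).
  { transitivity (g * g - h * h)%C; [ring|]. rewrite Hg, Ho; ring. }
  apply (f_equal Cmod) in E. rewrite Cmod_mult, Cmod_0 in E.
  apply Rmult_integral in E. destruct E as [E|E]; apply Cmod_eq_0 in E.
  { transitivity (g - h + h)%C; [ring|]. rewrite E; ring. }
  exfalso.
  assert (Ehg : h = (- g)%C) by (transitivity (g + h - g)%C; [ring|rewrite E; ring]).
  pose proof (sqrt_root_Im x h Ho) as HI.
  assert (Hxh : 1 <= Cmod (x + h)%C).
  { pose proof (psi_outer x) as Eh. fold h in Eh.
    apply (f_equal Cmod) in Eh. rewrite Cmod_mult, Cmod_1 in Eh.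
    pose proof (psi_le_1 x). pose proof (Cmod_ge_0 (x + h)%C). nra. }
  assert (HIm : Im h = - Im g) by (rewrite Ehg; reflexivity).
  rewrite HIm in HI. set (m := Cmod (x + h)%C) in *.
  assert (0 <= Im g * (m * m - 1)) by (apply Rmult_le_pos; nra).
  assert (0 < Im x * (m * m + 1)) by (apply Rmult_lt_0_compat; nra). lra.
Qed.

(** * Existence of branches *)

Lemma continuous_ext_locally (f g : C -> C) (x : C) :
  locallyC x (fun y => f y = g y) ->
  continuousC f x ->
  continuousC g x.
Proof.
  intros HL HC. apply continuous_ext_loc with f; auto.
Qed.

Lemma locally_Im_pos (x : C) : 0 < Im x -> locallyC x (fun y => 0 < Im y).
Proof.
  intros H. apply locally_Cmod. exists (Im x). split; auto. intros y Hy.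
  pose proof (im_le_Cmod (y - x)%C) as HI. simpl in HI. unfold Im in *.
  pose proof (Rle_abs (- (snd y + - snd x))) as HA. rewrite Rabs_Ropp in HA. lra.
Qed.

(* The cut is obtained from the segment by flipping the branch on [D], a region
   hanging below the segment. *)
Lemma sqrt_branch_exists (b D : C -> Prop) (R0 : R) :
  (forall x, segment x -> ~ D x -> b x) ->
  (forall x, ~ b x -> Im x < 0 -> locallyC x D \/
     locallyC x (fun y => ~ D y)) ->
  (forall x, D x -> Im x <= 0) ->
  (forall x, D x -> Im x = 0 -> Rabs (Re x) < 1 /\
     locallyC x (fun y => Im y <= 0 -> D y)) ->
  (forall x, Im x = 0 -> 1 < Rabs (Re x) -> locallyC x (fun y => ~ D y)) ->
  (forall x, D x -> Cmod x <= R0) ->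
  exists g, is_sqrt_branch b g.
Proof.
  intros H1 H2 H3 H4 H5 H6.
  set (go := fun x => (x - psi x)%C).
  exists (fun x => if excluded_middle_informative (D x) then upper_sqrt_root x else go x).
  assert (Cgo : forall x, ~ segment x -> continuousC go x).
  { intros x Hx. apply (continuousC_plus (fun y => y)); [apply continuous_id|].
    now apply continuousC_opp, psi_continuous. }
  assert (Kgo : forall x, ~ segment x -> locallyC x (fun y => ~ D y) ->
    continuousC
      (fun x => if excluded_middle_informative (D x) then upper_sqrt_root x else go x) x).
  { intros x Hx HL. apply continuous_ext_locally with go; auto.
    revert HL. apply filter_imp. intros y Hy.
    destruct (excluded_middle_informative (D y)); [contradiction|reflexivity]. }
  assert (Cup : forall x, ~ (Im x = 0 /\ 1 <= Rabs (Re x)) ->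
    continuousC upper_sqrt_root x).
  { intros x Hx. apply upper_sqrt_root_continuous.
    destruct (upper_sqrt_root_spec x) as [Hg [Hi|Hi]]; auto.
    exfalso. apply Hx. eapply sqrt_root_Im_eq_0; eauto. }
  split; [|split].
  - intros x. destruct (excluded_middle_informative (D x)).
    + apply upper_sqrt_root_spec.
    + apply outer_sqrt_root.
  - intros x Hb. destruct (Rtotal_order (Im x) 0) as [HI|[HI|HI]].
    + assert (Hx : ~ segment x) by (intros [_ Hs]; lra).
      destruct (H2 x Hb HI) as [HL|HL]; [|now apply Kgo].
      apply continuous_ext_locally with upper_sqrt_root.
      * revert HL. apply filter_imp. intros y Hy.
        destruct (excluded_middle_informative (D y)); [reflexivity|contradiction].
      * apply Cup. lra.
    + destruct (classic (segment x)) as [Hs|Hs].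
      (* Around such a point the branch is [upper_sqrt_root] throughout: below and on the axis by
         membership in [D], above because the roots agree there. *)
      * assert (HD : D x) by (apply NNPP; intros HD; apply Hb; auto).
        destruct (H4 x HD HI) as [HR HL].
        apply continuous_ext_locally with upper_sqrt_root; [|apply Cup; lra].
        revert HL. apply filter_imp. intros y Hy.
        destruct (excluded_middle_informative (D y)) as [HDy|HDy]; [reflexivity|].
        apply upper_sqrt_root_eq_outer.
        destruct (Rle_lt_dec (Im y) 0); [now destruct HDy; apply Hy|auto].
      * apply Kgo; auto. apply H5; auto.
        destruct (Rle_lt_dec (Rabs (Re x)) 1) as [Hr|]; auto.
        exfalso. apply Hs. split; auto. now apply Rabs_le_between.
    + apply Kgo; [intros [_ Hs]; lra|].
      generalize (locally_Im_pos x HI). apply filter_imp. intros y Hy HD.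
      apply H3 in HD. lra.
  - intros M. exists (Rmax R0 M). intros x Hx.
    assert (Hx1 : R0 < Cmod x) by (eapply Rle_lt_trans; [apply Rmax_l|exact Hx]).
    assert (Hx2 : M < Cmod x) by (eapply Rle_lt_trans; [apply Rmax_r|exact Hx]).
    destruct (excluded_middle_informative (D x)) as [HD|HD].
    + apply H6 in HD. lra.
    + unfold go.
      pose proof (psi_outer x) as Eh.
      apply (f_equal Cmod) in Eh. rewrite Cmod_mult, Cmod_1 in Eh.
      pose proof (joukowski_root_le_Re x (psi x) (psi_root x) (psi_le_1 x)) as HJ.
      pose proof (psi_pos x). nra.
Qed.

(** * Evaluation of branches *)

Lemma sqrt_branch_spec (b : C -> Prop) :
  (exists g, is_sqrt_branch b g) -> is_sqrt_branch b (sqrt_branch b).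
Proof. intros H. unfold sqrt_branch. now apply epsilon_spec. Qed.

Lemma path_continuity (h : C -> R) (u v : C) (t : R) :
  (forall eps, 0 < eps -> exists del, 0 < del /\ forall y,
     Cmod (y - (u + t * v))%C < del -> Rabs (h y - h (u + t * v)%C) < eps) ->
  continuity_pt (fun t => h (u + RtoC t * v)%C) t.
Proof.
  intros H eps He. destruct (H eps He) as (del & Hd & HD).
  exists (del / (Cmod v + 1)).
  assert (Hv : 0 < Cmod v + 1) by (pose proof (Cmod_ge_0 v); lra).
  split; [now apply Rdiv_lt_0_compat|].
  intros s [_ Hs]. simpl in Hs |- *. unfold R_dist in *. apply HD.
  replace (u + s * v - (u + t * v))%C with (RtoC (s - t) * v)%C by (rewrite RtoC_minus; ring).
  rewrite Cmod_mult, Cmod_R. pose proof (Cmod_ge_0 v).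
  apply (Rmult_lt_compat_r (Cmod v + 1)) in Hs; auto.
  replace (del / (Cmod v + 1) * (Cmod v + 1)) with del in Hs by (field; lra). nra.
Qed.

Lemma no_sign_change (h : R -> R) (a c : R) : a < c ->
  (forall t, a <= t <= c -> continuity_pt h t) ->
  (forall t, a <= t <= c -> h t <> 0) -> 0 < h c -> 0 < h a.
Proof.
  intros Hac Hc Hn Hpos. destruct (Rtotal_order (h a) 0) as [H|[H|H]]; auto.
  - destruct (IVT_interv h a c Hc Hac H Hpos) as [t [Ht E]]. now apply Hn in Ht.
  - exfalso. apply (Hn a); auto; lra.
Qed.

(* Moving out radially, [|x + g x|] never takes the value 1. *)
Lemma branch_outer (b : C -> Prop) (g : C -> C) (x : C) : is_sqrt_branch b g ->
  x <> 0%C -> (forall t, 1 <= t -> ~ b (RtoC t * x)%C /\ ~ segment (RtoC t * x)%C) ->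
  Cmod (x + g x)%C = exp (outer_log x) /\ 1 < Cmod (x + g x)%C.
Proof.
  intros (G1 & G2 & G3) Hx Hb.
  set (h := fun y => Cmod (y + g y)%C - 1).
  destruct (G3 1) as [N HN].
  assert (Hx0 : 0 < Cmod x) by now apply Cmod_gt_0.
  (* At [c * x] the growth clause of [is_sqrt_branch] already gives modulus above 1. *)
  set (c := Rmax 2 ((Rabs N + 1) / Cmod x)).
  assert (Hc2 : 2 <= c) by apply Rmax_l.
  assert (HcN : N < Cmod (RtoC c * x)%C).
  { rewrite Cmod_mult, Cmod_R, Rabs_right by lra.
    assert (Hc3 : (Rabs N + 1) / Cmod x <= c) by apply Rmax_r.
    apply (Rmult_le_compat_r (Cmod x)) in Hc3; [|lra].
    replace ((Rabs N + 1) / Cmod x * Cmod x) with (Rabs N + 1) in Hc3 by (field; lra).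
    pose proof (Rle_abs N). lra. }
  assert (Hpos : 0 < h (0 + RtoC 1 * x)%C).
  { apply (no_sign_change (fun t => h (0 + RtoC t * x)%C) 1 c); [lra| | |].
    - intros t Ht. apply path_continuity. rewrite Cplus_0_l.
      destruct (Hb t) as [Hbt _]; [lra|].
      assert (HC : continuousC (fun y => y + g y)%C (t * x)%C)
        by (apply (continuousC_plus (fun y => y)); [apply continuous_id|auto]).
      rewrite continuous_Cmod in HC.
      intros eps He. destruct (HC eps He) as (del & Hd & HD). exists del. split; auto.
      intros y Hy. eapply Rle_lt_trans; [|apply (HD y Hy)]. unfold h.
      replace (Cmod (y + g y) - 1 - (Cmod (t * x + g (t * x)%C) - 1)) with
        (Cmod (y + g y) - Cmod (t * x + g (t * x)%C)) by ring.
      apply Cmod_sub_lip.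
    - intros t Ht. rewrite Cplus_0_l. destruct (Hb t) as [_ Hs]; [lra|].
      intros E. apply Hs. apply (sqrt_root_Cmod_1 _ (g (t * x)%C)); auto.
      unfold h in E. lra.
    - rewrite Cplus_0_l. unfold h. specialize (HN _ HcN). lra. }
  replace (0 + 1 * x)%C with x in Hpos by ring. unfold h in Hpos.
  split; [|lra]. apply sqrt_root_Cmod; auto. lra.
Qed.

Lemma branch_upper (b : C -> Prop) (g : C -> C) (x : C) : is_sqrt_branch b g ->
  (forall y, b y -> Im y <= 0) -> 0 < Im x ->
  Cmod (x + g x)%C = exp (outer_log x) /\ 0 < Im (g x).
Proof.
  intros Hg Hb Hx.
  destruct (branch_outer b g x Hg) as [E1 E2].
  - intros ->. simpl in Hx. lra.
  - intros t Ht.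
    assert (0 < Im (RtoC t * x)%C) by (simpl; unfold Im in Hx; nra).
    split; [intros Hbt; apply Hb in Hbt; lra|intros [_ Hs]; lra].
  - split; auto. destruct Hg as (G1 & _).
    pose proof (sqrt_root_Im x (g x) (G1 x)) as HI.
    set (m := Cmod (x + g x)%C) in *.
    assert (0 < m * m - 1) by nra. nra.
Qed.

(* Moving up vertically, [Im (g x)] never vanishes. *)
Lemma branch_flipped (b : C -> Prop) (g : C -> C) (x : C) : is_sqrt_branch b g ->
  (forall y, b y -> Im y <= 0) -> Im x < 0 -> Rabs (Re x) < 1 ->
  (forall t, 0 <= t -> ~ b (x + (0, t))%C) ->
  Cmod (x + g x)%C = exp (- outer_log x).
Proof.
  intros Hg Hb Hx HX Hray. pose proof Hg as (G1 & G2 & _).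
  assert (Et : forall t, (x + RtoC t * Ci)%C = (x + (0, t)%R)%C).
  { intros t. apply injective_projections; simpl; ring. }
  assert (Hpos : 0 < Im (g (x + RtoC 0 * Ci)%C)).
  { apply (no_sign_change (fun t => Im (g (x + RtoC t * Ci)%C)) 0 (1 - Im x)); [lra| | |].
    - intros t Ht. apply (path_continuity (fun y => Im (g y)) x Ci). rewrite Et.
      pose proof (G2 _ (Hray t ltac:(lra))) as HC. rewrite continuous_Cmod in HC.
      intros eps He. destruct (HC eps He) as (del & Hd & HD). exists del. split; auto.
      intros y Hy. eapply Rle_lt_trans; [|apply (HD y Hy)].
      set (u := g y). set (v := g _). replace (Im u - Im v) with (Im (u - v)%C)
        by (simpl; unfold Im; ring).
      apply im_le_Cmod.
    - intros t Ht E. destruct (sqrt_root_Im_eq_0 _ _ (G1 _) E) as [_ HR].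
      rewrite Et in HR. simpl in HR. unfold Re in HX. rewrite Rplus_0_r in HR. lra.
    - apply (branch_upper b g); auto. rewrite Et. simpl. unfold Im. lra. }
  replace (x + 0 * Ci)%C with x in Hpos by ring.
  apply sqrt_root_Cmod; auto.
  pose proof (sqrt_root_Im x (g x) (G1 x)) as HI.
  set (m := Cmod (x + g x)%C) in *. pose proof (Cmod_ge_0 (x + g x)%C) as Hm. fold m in Hm.
  destruct (Rle_lt_dec m 1); auto.
  assert (0 < m * m - 1) by nra. nra.
Qed.

Lemma outer_log_segment (x : C) : segment x -> outer_log x = 0.
Proof.
  intros [HX HY].
  pose proof (joukowski_root_ellipse x (psi x) _ (psi_root x) eq_refl) as E.
  rewrite HY in E. set (s := sinh (ln (Cmod (psi x))) * sinh (ln (Cmod (psi x)))) in *.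
  assert (Hs : 0 <= s) by apply Rle_0_sqr.
  assert (Hs0 : s = 0).
  { assert (0 <= s * (1 - Re x * Re x)) by (apply Rmult_le_pos; nra). nra. }
  apply Rsqr_0_uniq in Hs0. rewrite <- sinh_0 in Hs0.
  unfold outer_log. assert (ln (Cmod (psi x)) = 0); [|lra].
  apply Rle_antisym; apply sinh_le_inv; lra.
Qed.

Lemma alpha_segment (x : C) : alpha segment x = outer_log x.
Proof.
  (* The plain segment is the case of an empty flipped region. *)
  assert (HB : is_sqrt_branch segment (sqrt_branch segment)).
  { apply sqrt_branch_spec, (sqrt_branch_exists _ (fun _ => False) 0); auto; try tauto.
    - intros. right. now apply filter_forall.
    - intros. now apply filter_forall. }
  (* On the cut the sign of the root is unspecified, but both values of [x + g x] have modulus 1. *)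
  unfold alpha. destruct (classic (segment x)) as [Hs|Hs].
  - pose proof HB as (G1 & _).
    destruct (sqrt_root_Cmod x _ (G1 x)) as [E1 E2].
    rewrite outer_log_segment in * by auto. rewrite Ropp_0 in E2.
    destruct (Rle_lt_dec 1 (Cmod (x + sqrt_branch segment x)%C)) as [H|H].
    + rewrite E1, ln_exp; auto.
    + rewrite E2, ln_exp; lra.
  - destruct (branch_outer segment (sqrt_branch segment) x HB) as [E _].
    + intros ->. apply Hs. split; simpl; lra.
    + intros t Ht.
      assert (~ segment (RtoC t * x)%C); [|auto].
      intros [H1 H2]. apply Hs. simpl in H1, H2. unfold segment, Re, Im in *.
      assert (Hx2 : snd x = 0) by nra. split; auto. rewrite Hx2 in H1. nra.
    + now rewrite E, ln_exp.
Qed.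

(** The parallelogram law for [x + g] and [x - g], whose moduli are [exp (A x)] and [exp (- A x)].
    The resulting formula is free of [psi], and so yields continuity also on the segment, where
    [psi] may jump. *)
Lemma sinh_outer_log_sqr (x : C) :
  sinh (outer_log x) * sinh (outer_log x) =
  (Re x * Re x + Im x * Im x - 1 + Cmod (x * x - 1)%C) / 2.
Proof.
  pose proof (psi_pos x) as H0.
  pose proof (psi_outer x) as Eh.
  replace (x + (x - psi x))%C with (2 * x - psi x)%C in Eh by ring.
  apply (f_equal Cmod) in Eh. rewrite Cmod_mult, Cmod_1 in Eh.
  assert (Hg : Cmod (x * x - 1)%C = Cmod (x - psi x)%C * Cmod (x - psi x)%C).
  { rewrite <- Cmod_mult, outer_sqrt_root. reflexivity. }
  rewrite Hg.
  assert (HP : Cmod (2 * x - psi x)%C * Cmod (2 * x - psi x)%C + Cmod (psi x) * Cmod (psi x)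
    = 2 * (Re x * Re x + Im x * Im x) + 2 * (Cmod (x - psi x)%C * Cmod (x - psi x)%C)).
  { rewrite !sqr_Cmod. destruct x as [X Y], (psi _) as [u v]. simpl. ring. }
  unfold outer_log. rewrite <- (Rmult_1_r (sinh _)).
  rewrite sinh_opp, sinh_ln by auto.
  set (r := Cmod (psi x)) in *. set (m := Cmod (2 * x - psi x)%C) in *.
  assert (Em : m = / r) by (apply Rmult_eq_reg_r with r; [rewrite Rinv_l|]; lra).
  rewrite Em in HP.
  set (G := Cmod (x - psi x)%C * Cmod (x - psi x)%C) in *.
  set (X2 := Re x * Re x + Im x * Im x) in *.
  replace ((X2 - 1 + G) / 2) with ((2 * X2 + 2 * G - 2) / 4) by field.
  rewrite <- HP. field. lra.
Qed.

Lemma outer_log_formula (x : C) : outer_log x =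
  arcsinh (sqrt ((Re x * Re x + Im x * Im x - 1 + Cmod (x * x - 1)%C) / 2)).
Proof.
  rewrite <- sinh_outer_log_sqr, sqrt_square, arcsinh_sinh; auto.
  apply sinh_nonneg, outer_log_nonneg.
Qed.

Lemma outer_log_path_continuous (X Y : R -> R) (t : R) :
  continuous X t -> continuous Y t -> continuous (fun t => outer_log (X t, Y t)) t.
Proof.
  intros HX HY.
  apply (continuous_ext (fun t => arcsinh (sqrt ((X t * X t + Y t * Y t - 1 +
     sqrt ((X t * X t - Y t * Y t - 1) ^ 2 + (2 * (X t * Y t)) ^ 2)) / 2)))).
  { intros s. rewrite outer_log_formula. symmetry. unfold Cmod.
    simpl Re; simpl Im; simpl fst; simpl snd.
    assert (E1 : forall u v : R, u * u - v * v + - (1) = u * u - v * v - 1) by (intros; ring).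
    assert (E2 : forall u v : R, u * v + v * u + - 0 = 2 * (u * v)) by (intros; ring).
    now rewrite E1, E2. }
  assert (CX : continuous (fun t => X t * X t) t) by now apply (continuous_mult X X).
  assert (CY : continuous (fun t => Y t * Y t) t) by now apply (continuous_mult Y Y).
  assert (CXY : continuous (fun t => 2 * (X t * Y t)) t).
  { apply (continuous_mult (fun _ => 2) (fun t => X t * Y t)); [apply continuous_const|].
    now apply (continuous_mult X Y). }
  assert (C1 : continuous (fun t => X t * X t - Y t * Y t - 1) t).
  { apply (continuous_minus (fun t => X t * X t - Y t * Y t) (fun _ => 1));
      [|apply continuous_const].
    now apply (continuous_minus (fun t => X t * X t) (fun t => Y t * Y t)). }
  assert (Sq : forall f, continuous f t -> continuous (fun t => (f t) ^ 2) t).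
  { intros f Hf. apply (continuous_ext (fun t => f t * f t)); [intros; simpl; rewrite Rmult_1_r; reflexivity|].
    now apply (continuous_mult f f). }
  apply (continuous_comp _ arcsinh).
  - apply (continuous_comp _ sqrt); [|apply continuous_sqrt].
    unfold Rdiv. apply (continuous_mult _ (fun _ => / 2)); [|apply continuous_const].
    apply (continuous_plus (fun t => X t * X t + Y t * Y t - 1)).
    + apply (continuous_minus (fun t => X t * X t + Y t * Y t) (fun _ => 1));
        [|apply continuous_const].
      now apply (continuous_plus (fun t => X t * X t) (fun t => Y t * Y t)).
    + apply (continuous_comp _ sqrt); [|apply continuous_sqrt].
      apply (continuous_plus (fun t => (X t * X t - Y t * Y t - 1) ^ 2)); now apply Sq.
  - apply continuity_pt_filterlim. apply derivable_continuous_pt.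
    eexists. apply derivable_pt_lim_arcsinh.
Qed.

(** * Bernstein ellipses *)

Definition ell (t : R) (x : C) : R := t * (Re x * Re x) + (1 + t) * (Im x * Im x).

(* The sign of the left-hand side tells on which side of the ellipse with semi-axes
   [sqrt (1 + t)] and [sqrt t] the point [x] lies. *)
Lemma outer_log_factor (x : C) (t : R) :
  let s := sinh (outer_log x) * sinh (outer_log x) in
  s * (t * (t + 1 - Re x * Re x - Im x * Im x) - Im x * Im x)
    = (t - s) * (s * t + Im x * Im x).
Proof.
  intros s.
  assert (E : s * s + s * (1 - Re x * Re x - Im x * Im x) = Im x * Im x).
  { apply (joukowski_root_ellipse x (psi x)); [apply psi_root|].
    unfold s, outer_log. now rewrite sinh_opp, Rmult_opp_opp. }
  transitivity (s * t * t + t * (s * (1 - Re x * Re x - Im x * Im x))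
    - s * (Im x * Im x)); [ring|].
  replace (s * (1 - Re x * Re x - Im x * Im x)) with (Im x * Im x - s * s) by lra. ring.
Qed.

Lemma outer_log_lt_iff (a : R) (x : C) : 0 < a ->
  let t := sinh a * sinh a in outer_log x < a <-> ell t x < t * (1 + t).
Proof.
  intros Ha t. unfold ell.
  assert (HS : 0 < sinh a) by (rewrite <- sinh_0; now apply sinh_lt).
  assert (Ht : 0 < t) by (unfold t; nra).
  pose proof (outer_log_nonneg x) as HA.
  pose proof (sinh_nonneg _ HA) as HSA.
  set (S := sinh (outer_log x)) in *. set (s := S * S).
  pose proof (outer_log_factor x t) as F. fold S s in F. cbv zeta in F.
  set (X2 := Re x * Re x) in *. set (Y2 := Im x * Im x) in *.
  assert (HY2 : 0 <= Y2) by apply Rle_0_sqr.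
  replace (t * (t + 1 - X2 - Y2) - Y2) with
    (t * (1 + t) - (t * X2 + (1 + t) * Y2)) in F by ring.
  destruct HSA as [HSA|HSA].
  - assert (Hs : 0 < s) by (unfold s; nra).
    assert (Hst : 0 < s * t + Y2) by nra.
    split; intros H.
    + assert (S < sinh a) by now apply sinh_lt.
      assert (s < t) by (unfold s, t; nra).
      destruct (Rle_lt_dec (t * (1 + t)) (t * X2 + (1 + t) * Y2)); nra.
    +
      assert (s < t) by (destruct (Rle_lt_dec t s); nra).
      destruct (Rlt_le_dec (outer_log x) a) as [|Hle]; auto.
      assert (sinh a <= S) by now apply sinh_le.
      assert (t <= s) by (unfold s, t; nra). lra.
  (* In the degenerate case [outer_log_factor] carries no information; [x] then lies on the segment,
     inside every ellipse. *)
  - assert (HA0 : outer_log x = 0).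
    { apply Rle_antisym; auto. apply sinh_le_inv. rewrite sinh_0. fold S. lra. }
    rewrite HA0. split; auto. intros _.
    assert (Hs0 : s = 0) by (unfold s; rewrite <- HSA; ring).
    assert (HY0 : Y2 = 0) by (rewrite Hs0 in F; nra).
    assert (Hseg : segment x).
    { apply psi_segment. unfold outer_log in HA0.
      rewrite <- (exp_ln (Cmod (psi x))) by apply psi_pos.
      replace (ln (Cmod (psi x))) with 0 by lra. apply exp_0. }
    destruct Hseg as [HX _].
    assert (X2 <= 1) by (unfold X2; nra). rewrite HY0. nra.
Qed.

Lemma ell_continuous (t : R) (s x : C) :
  continuous (T := C_UniformSpace) (U := R_UniformSpace) (fun y => ell t (y - s)%C) x.
Proof.
  unfold ell.
  assert (CR : continuous (T := C_UniformSpace) (U := R_UniformSpace)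
    (fun y => Re (y - s)%C) x).
  { simpl. apply (continuous_plus (U := C_UniformSpace) (V := R_NormedModule) fst (fun _ => - fst s)).
    - apply continuous_fst.
    - apply continuous_const. }
  assert (CI : continuous (T := C_UniformSpace) (U := R_UniformSpace)
    (fun y => Im (y - s)%C) x).
  { simpl. apply (continuous_plus (U := C_UniformSpace) (V := R_NormedModule) snd (fun _ => - snd s)).
    - apply continuous_snd.
    - apply continuous_const. }
  apply (continuous_plus (U := C_UniformSpace) (V := R_NormedModule)
    (fun y => t * (Re (y - s)%C * Re (y - s)%C))
    (fun y => (1 + t) * (Im (y - s)%C * Im (y - s)%C))).
  - apply (continuous_mult (U := C_UniformSpace) (K := R_AbsRing) (fun _ => t)
      (fun y => Re (y - s)%C * Re (y - s)%C)); [apply continuous_const|].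
    now apply (continuous_mult (U := C_UniformSpace) (K := R_AbsRing)
      (fun y => Re (y - s)%C) (fun y => Re (y - s)%C)).
  - apply (continuous_mult (U := C_UniformSpace) (K := R_AbsRing) (fun _ => 1 + t)
      (fun y => Im (y - s)%C * Im (y - s)%C)); [apply continuous_const|].
    now apply (continuous_mult (U := C_UniformSpace) (K := R_AbsRing)
      (fun y => Im (y - s)%C) (fun y => Im (y - s)%C)).
Qed.

Lemma locally_ell_lt (t c : R) (s x : C) : ell t (x - s)%C < c ->
  locallyC x (fun y => ell t (y - s)%C < c).
Proof. intros H. exact (ell_continuous t s x (fun v => v < c) (open_lt c _ H)). Qed.

Lemma locally_ell_gt (t c : R) (s x : C) : c < ell t (x - s)%C ->
  locallyC x (fun y => c < ell t (y - s)%C).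
Proof. intros H. exact (ell_continuous t s x (fun v => c < v) (open_gt c _ H)). Qed.

Lemma boundary_bernstein (a : R) (x : C) : 0 < a ->
  let t := sinh a * sinh a in boundary (bernstein a) x <-> ell t x = t * (1 + t).
Proof.
  intros Ha t.
  assert (HS : 0 < sinh a) by (rewrite <- sinh_0; now apply sinh_lt).
  assert (Ht : 0 < t) by (unfold t; nra).
  assert (HB : forall y, bernstein a y <-> ell t (y - 0)%C < t * (1 + t)).
  { intros y. unfold bernstein. rewrite alpha_segment.
    replace (y - 0)%C with y by ring. now apply outer_log_lt_iff. }
  replace x with (x - 0)%C at 2 by ring.
  split.
  - intros [H1 H2]. destruct (Rtotal_order (ell t (x - 0)%C) (t * (1 + t))) as [H|[H|H]]; auto.
    + destruct H1. generalize (locally_ell_lt _ _ _ _ H). apply filter_imp.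
      intros y Hy. now apply HB.
    + destruct H2. generalize (locally_ell_gt _ _ _ _ H). apply filter_imp.
      intros y Hy Hb. apply HB in Hb. lra.
  - intros H. split; intros HL.
    + apply locally_singleton, HB in HL. lra.
    + apply locally_Cmod in HL. destruct HL as (del & Hd & HL).
      (* Shrinking [x] radially by [1 - e] enters the open ellipse, since [ell t] is homogeneous of
         degree 2, and moves the point by less than [del]. *)
      set (e := Rmin (/ 2) (del / (2 * (Cmod x + 1)))).
      pose proof (Cmod_ge_0 x) as Hx.
      assert (Hq : 0 < del / (2 * (Cmod x + 1))) by (apply Rdiv_lt_0_compat; lra).
      assert (He : 0 < e <= / 2) by (unfold e; split; [apply Rmin_glb_lt; lra|apply Rmin_l]).
      assert (He2 : e * (2 * (Cmod x + 1)) <= del).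
      { assert (H3 : e <= del / (2 * (Cmod x + 1))) by apply Rmin_r.
        apply (Rmult_le_compat_r (2 * (Cmod x + 1))) in H3; [|lra].
        replace (del / (2 * (Cmod x + 1)) * (2 * (Cmod x + 1))) with del in H3 by (field; lra).
        auto. }
      apply (HL (RtoC (1 - e) * x)%C).
      * replace (RtoC (1 - e) * x - x)%C with (RtoC (- e) * x)%C
          by (rewrite RtoC_minus, RtoC_opp; ring).
        rewrite Cmod_mult, Cmod_R, Rabs_Ropp, Rabs_right by lra. nra.
      * apply HB. replace (ell t (RtoC (1 - e) * x - 0)%C) with ((1 - e) * (1 - e) * ell t (x - 0)%C)
          by (unfold ell; destruct x; simpl; ring).
        rewrite H.
        assert ((1 - e) * (1 - e) < 1) by nra. nra.
Qed.

(** * The flipped cut *)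

Definition admissible (z : parameters) : Prop :=
  0 < eta z /\ Rabs (omega z) < 1 /\ 0 < alpha_max z.

(** The vertical semi-axis of the ellipse; the horizontal one is [sqrt (1 + height^2)]. *)
Definition height (z : parameters) : R := sinh (alpha_max z).

Definition ellipse_form (z : parameters) (x : C) : R :=
  ell (height z * height z) (x - shift z)%C.

Definition ellipse_level (z : parameters) : R :=
  height z * height z * (1 + height z * height z).

Lemma height_pos (z : parameters) : admissible z -> 0 < height z.
Proof. intros (_ & _ & H). unfold height. rewrite <- sinh_0. now apply sinh_lt. Qed.

Lemma bernstein_shift_iff (z : parameters) (x : C) : admissible z ->
  translate (shift z) (bernstein (alpha_max z)) x <-> ellipse_form z x < ellipse_level z.
Proof.
  intros (_ & _ & H). unfold translate, bernstein. rewrite alpha_segment.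
  now apply outer_log_lt_iff.
Qed.

Lemma D_set_iff (z : parameters) (x : C) : admissible z ->
  D_set z x <-> ellipse_form z x < ellipse_level z /\ Im x <= 0.
Proof. intros H. unfold D_set. rewrite bernstein_shift_iff by auto. tauto. Qed.

Lemma ellipse_boundary_iff (z : parameters) (x : C) : admissible z ->
  translate (shift z) (boundary (bernstein (alpha_max z))) x <->
  ellipse_form z x = ellipse_level z.
Proof. intros (_ & _ & H). unfold translate. now apply boundary_bernstein. Qed.

Lemma ellipse_form_eq (z : parameters) (x : C) : ellipse_form z x =
  height z * height z * ((Re x - omega z) * (Re x - omega z)) +
  (1 + height z * height z) * ((Im x - eta z) * (Im x - eta z)).
Proof. unfold ellipse_form, ell, shift, Re, Im. simpl. ring. Qed.

(* [alpha_max z <= alpha_relaxation z]: the ellipse meets the real axis inside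
   the segment. *)
Lemma ellipse_level_le (z : parameters) : admissible z ->
  ellipse_level z <= height z * height z * ((1 - Rabs (omega z)) * (1 - Rabs (omega z)))
    + (1 + height z * height z) * (eta z * eta z).
Proof.
  intros Hz. pose proof Hz as (_ & _ & Ha).
  assert (H : ~ outer_log (1 - Rabs (omega z), eta z) < alpha_max z).
  { rewrite <- alpha_segment. fold (alpha_relaxation z).
    apply Rle_not_lt. apply Rmin_l. }
  rewrite outer_log_lt_iff in H by auto.
  apply Rnot_lt_le in H. exact H.
Qed.

Lemma real_point_lt (z : parameters) (x : C) : admissible z -> Im x = 0 ->
  (ellipse_form z x < ellipse_level z -> Rabs (Re x) < 1) /\
  (ellipse_form z x <= ellipse_level z -> Rabs (Re x) <= 1).
Proof.
  intros Hz Hx. pose proof (ellipse_level_le z Hz) as HL. pose proof (height_pos z Hz) as HS.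
  destruct Hz as (_ & Hom & _).
  rewrite ellipse_form_eq, Hx. set (S2 := height z * height z) in *.
  assert (0 < S2) by (unfold S2; nra).
  set (u := Re x - omega z). set (v := 1 - Rabs (omega z)) in *.
  assert (Hv : 0 < v) by (unfold v; lra).
  assert (Hxu : Rabs (Re x) <= Rabs u + Rabs (omega z)).
  { replace (Re x) with (u + omega z) by (unfold u; ring). apply Rabs_triang. }
  assert (Huu : u * u = Rabs u * Rabs u) by (rewrite <- Rabs_mult, Rabs_right; [auto|apply Rle_ge, Rle_0_sqr]).
  split; intros HE.
  - assert (u * u < v * v) by nra. assert (Rabs u < v) by nra. unfold v in *; lra.
  - assert (u * u <= v * v) by nra. assert (Rabs u <= v) by nra. unfold v in *; lra.
Qed.

Lemma b_star_branch (z : parameters) : admissible z ->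
  is_sqrt_branch (b_star z) (sqrt_branch (b_star z)).
Proof.
  intros Hz. apply sqrt_branch_spec.
  assert (HDl : forall x, ellipse_form z x < ellipse_level z ->
    locallyC x (fun y => Im y <= 0 -> D_set z y)).
  { intros x Hx. generalize (locally_ell_lt _ _ _ _ Hx). apply filter_imp.
    intros y Hy HI. apply D_set_iff; auto. }
  apply (sqrt_branch_exists _ (D_set z) (Cmod (shift z) + (1 + height z * height z))).
  - intros x H1 H2. left; auto.
  - intros x Hb HI. apply NNPP. intros H. apply Hb. right. split; auto. split; tauto.
  - intros x HD. apply D_set_iff in HD; tauto.
  - intros x HD HI. apply D_set_iff in HD; auto. destruct HD as [HD _]. split; auto.
    apply (real_point_lt z x Hz HI); auto.
  - intros x HI HX.
    assert (HG : ellipse_level z < ellipse_form z x).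
    { apply Rnot_le_lt. intros HE. apply (real_point_lt z x Hz HI) in HE. lra. }
    generalize (locally_ell_gt _ _ _ _ HG). apply filter_imp.
    intros y Hy HD. apply D_set_iff in HD; auto. unfold ellipse_form in HD. lra.
  - intros x HD. apply D_set_iff in HD; auto. destruct HD as [HD _].
    pose proof (height_pos z Hz) as HS.
    replace x with ((x - shift z) + shift z)%C by ring.
    eapply Rle_trans; [apply Cmod_triangle|].
    assert (Cmod (x - shift z)%C <= 1 + height z * height z); [|lra].
    unfold ellipse_form, ell, ellipse_level in HD.
    set (y := (x - shift z)%C) in *. pose proof (sqr_Cmod y) as HY.
    set (S2 := height z * height z) in *. assert (0 < S2) by (unfold S2; nra).
    assert (Cmod y * Cmod y <= 1 + S2) by nra. nra.
Qed.

Lemma b_star_Im (z : parameters) (x : C) : b_star z x -> Im x <= 0.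
Proof. intros [[[_ H] _]|[_ H]]; lra. Qed.

(** [lim] is a total function specified only on proper Cauchy filters. Once the image filter is
    shown to be one, its [lim] is arbitrarily close to [F 0], hence equal to it. *)
Lemma alpha_above_limit (b : C -> Prop) (x : C) (F : R -> R) (del : R) : 0 < del ->
  (forall t, 0 < t < del -> alpha b (x + (0, t))%C = F t) -> continuous F 0 ->
  alpha_above b x = F 0.
Proof.
  intros Hd HF HC. unfold alpha_above.
  set (f := fun t => alpha b (x + (0, t))%C).
  assert (Hlim : filterlim f (at_right 0) (locally (F 0))).
  { apply filterlim_ext_loc with F.
    - exists (mkposreal del Hd). intros t Ht Ht0.
      unfold f. rewrite HF; auto. split; auto.
      apply Rabs_lt_between in Ht. simpl in Ht. unfold minus, plus, opp in Ht. simpl in Ht. lra.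
    - intros P HP. specialize (HC P HP). unfold filtermap in *.
      destruct HC as [e He]. exists e. intros t Ht _. now apply He. }
  assert (Hp : ProperFilter (filtermap f (at_right 0))) by (apply filtermap_proper_filter, at_right_proper_filter).
  assert (Hc : cauchy (filtermap f (at_right 0))).
  { intros eps. exists (F 0). apply Hlim. now exists eps. }
  apply eq_close. intros eps.
  assert (He : 0 < eps / 2) by (pose proof (cond_pos eps); lra).
  pose proof (complete_cauchy _ Hp Hc (mkposreal _ He)) as H1.
  assert (H2 : filtermap f (at_right 0) (ball (F 0) (mkposreal _ He))).
  { apply Hlim. now exists (mkposreal _ He). }
  destruct (filter_ex _ (filter_and _ _ H1 H2)) as [y [Y1 Y2]].
  replace (pos eps) with (eps / 2 + eps / 2) by field.
  apply ball_triangle with y; [exact Y1|]. now apply ball_sym.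
Qed.

(** * Minimizers on the shifted ellipse *)

Definition signed_log (x : C) : R :=
  if Rlt_dec (Im x) 0 then - outer_log x else outer_log x.

Lemma alpha_above_b_star (z : parameters) (x : C) : admissible z ->
  ellipse_form z x = ellipse_level z -> alpha_above (b_star z) x = signed_log x.
Proof.
  intros Hz Hx. pose proof (b_star_branch z Hz) as HB.
  pose proof Hz as (He & _ & _). pose proof (height_pos z Hz) as HS.
  set (L := fun t => outer_log (Re x, Im x + t)).
  assert (HL : continuous L 0).
  { apply (outer_log_path_continuous (fun _ => Re x) (fun t => Im x + t)).
    - apply continuous_const.
    - apply (continuous_plus (fun _ => Im x) (fun t => t)); [apply continuous_const|apply continuous_id]. }
  assert (Ex : forall t, (x + (0, t))%C = (Re x, Im x + t)).
  { intros t. apply injective_projections; simpl; unfold Re, Im; ring. }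
  assert (L0 : L 0 = outer_log x).
  { unfold L. rewrite Rplus_0_r. destruct x; reflexivity. }
  unfold signed_log. destruct (Rlt_dec (Im x) 0) as [HI|HI].
  - rewrite <- L0.
    apply (alpha_above_limit _ x (fun t => - L t) (- Im x)); [lra| |].
    2:{ now apply (continuous_opp L). }
    (* Just above a point of the lower arc one is inside the ellipse. *)
    assert (Hin : forall t, 0 < t -> Im x + t <= 0 ->
      ellipse_form z (Re x, Im x + t) < ellipse_level z).
    { intros t Ht HIt. rewrite <- Hx, !ellipse_form_eq. simpl.
      set (S2 := height z * height z). assert (0 < S2) by (unfold S2; nra).
      assert ((Im x + t - eta z) * (Im x + t - eta z) < (Im x - eta z) * (Im x - eta z)) by nra.
      nra. }
    assert (HX : Rabs (Re x) < 1).
    { apply (real_point_lt z (Re x, Im x + - Im x) Hz); [simpl; ring|].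
      apply Hin; lra. }
    (* Up to the real axis the vertical ray stays inside [D_set], and above the axis there is no
       cut. *)
    assert (Hray : forall t, 0 < t -> ~ b_star z (Re x, Im x + t)).
    { intros t Ht [[[_ HI1] HD]|[[HD _] HI1]]; simpl in HI1.
      - apply HD, D_set_iff; auto. split; [apply Hin; lra|simpl; lra].
      - apply HD.
        assert (H1 : locallyC (Re x, Im x + t)
          (fun y => ellipse_form z y < ellipse_level z)) by (apply locally_ell_lt, Hin; lra).
        assert (H2 : locallyC (Re x, Im x + t) (fun y => Im y < 0)).
        { apply locally_Cmod. exists (- (Im x + t)). split; [lra|]. intros y Hy.
          pose proof (im_le_Cmod (y - (Re x, (Im x + t)%R))%C) as HM.
          apply Rabs_le_between in HM. destruct HM as [_ HM]. simpl in HM.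
          unfold Im in *. lra. }
        generalize (filter_and _ _ H1 H2). apply filter_imp. intros y [Y1 Y2].
        apply D_set_iff; auto. split; auto. lra. }
    intros t Ht. unfold alpha. rewrite Ex.
    rewrite (branch_flipped (b_star z) _ (Re x, Im x + t) HB).
    + now rewrite ln_exp.
    + apply b_star_Im.
    + simpl. lra.
    + exact HX.
    + intros u Hu.
      replace ((Re x, (Im x + t)%R) + (0, u))%C with ((Re x, Im x + (t + u)) : C)
        by (apply injective_projections; simpl; ring).
      apply Hray. lra.
  - rewrite <- L0. apply (alpha_above_limit _ x L 1); [lra| |auto].
    intros t Ht. unfold alpha. rewrite Ex.
    destruct (branch_upper (b_star z) (sqrt_branch (b_star z)) (Re x, Im x + t) HB) as [E _].
    + apply b_star_Im.
    + simpl. lra.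
    + now rewrite E, ln_exp.
Qed.

Definition ellipse_point (z : parameters) (t : R) : C :=
  (omega z + sqrt (1 + height z * height z) * cos t, eta z + height z * sin t).

Lemma ellipse_point_form (z : parameters) (t : R) :
  ellipse_form z (ellipse_point z t) = ellipse_level z.
Proof.
  rewrite ellipse_form_eq. unfold ellipse_level, ellipse_point. simpl.
  set (S2 := height z * height z).
  assert (HS : 0 <= S2) by apply Rle_0_sqr.
  pose proof (sqrt_sqrt (1 + S2) ltac:(lra)) as Hq. set (c := sqrt (1 + S2)) in *.
  pose proof (sin2_cos2 t) as H1. unfold Rsqr in H1.
  transitivity (S2 * (c * c) * (cos t * cos t) +
    (1 + S2) * (height z * height z) * (sin t * sin t)); [ring|].
  fold S2.
  - rewrite Hq. transitivity (S2 * (1 + S2) * (sin t * sin t + cos t * cos t)); [ring|].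
    rewrite H1; ring.
Qed.

Lemma ellipse_point_surjective (z : parameters) (x : C) : admissible z ->
  ellipse_form z x = ellipse_level z ->
  exists t, 0 <= t <= 2 * PI /\ ellipse_point z t = x.
Proof.
  intros Hz Hx. pose proof (height_pos z Hz) as HS.
  rewrite ellipse_form_eq in Hx. unfold ellipse_level in Hx.
  set (S := height z) in *.
  assert (HS2 : 0 < S * S) by nra.
  pose proof (sqrt_sqrt (1 + S * S) ltac:(lra)) as Hq.
  assert (Hc : 0 < sqrt (1 + S * S)) by (apply sqrt_lt_R0; lra).
  set (c := sqrt (1 + S * S)) in *.
  set (u := (Re x - omega z) / c). set (v := (Im x - eta z) / S).
  assert (Hu : Re x = omega z + c * u) by (unfold u; field; lra).
  assert (Hv : Im x = eta z + S * v) by (unfold v; field; lra).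
  assert (Huv : u * u + v * v = 1).
  { rewrite Hu, Hv in Hx.
    apply Rmult_eq_reg_l with (S * S * (1 + S * S)); [|nra].
    rewrite Rmult_1_r. etransitivity; [|exact Hx]. rewrite <- Hq. ring. }
  assert (Hu1 : -1 <= u <= 1) by nra.
  assert (Hcos : cos (acos u) = u) by now apply cos_acos.
  assert (Hsin : sin (acos u) * sin (acos u) = v * v).
  { pose proof (sin2_cos2 (acos u)) as H1. unfold Rsqr in H1. rewrite Hcos in H1. lra. }
  pose proof (acos_bound u) as HB.
  assert (Hs0 : 0 <= sin (acos u)) by (apply sin_ge_0; lra).
  unfold ellipse_point. fold S. fold c.
  destruct (Rle_lt_dec 0 v) as [Hv0|Hv0].
  - exists (acos u). split; [lra|].
    assert (Es : sin (acos u) = v) by (apply Rsqr_inj; auto).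
    rewrite Hcos, Es, <- Hu, <- Hv. destruct x; reflexivity.
  - exists (2 * PI - acos u). split; [lra|].
    assert (Es : sin (acos u) = - v) by (apply Rsqr_inj; unfold Rsqr; lra).
    rewrite cos_minus, sin_minus, cos_2PI, sin_2PI, Hcos, Es.
    replace (1 * u + 0 * - v) with u by ring. replace (0 * u - 1 * - v) with v by ring.
    rewrite <- Hu, <- Hv. destruct x; reflexivity.
Qed.

(** The sign switches where the ellipse crosses the real axis. By [real_point_lt] this happens on
    the segment, where [outer_log] vanishes. *)
Lemma signed_log_ellipse_continuous (z : parameters) (t : R) : admissible z ->
  continuous (fun t => signed_log (ellipse_point z t)) t.
Proof.
  intros Hz.
  set (X := fun t => omega z + sqrt (1 + height z * height z) * cos t).
  set (Y := fun t => eta z + height z * sin t).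
  assert (CX : continuous X t).
  { apply (continuous_plus (fun _ => omega z)); [apply continuous_const|].
    apply (continuous_mult (fun _ => sqrt (1 + height z * height z)) cos);
      [apply continuous_const|apply continuous_cos]. }
  assert (CY : continuous Y t).
  { apply (continuous_plus (fun _ => eta z)); [apply continuous_const|].
    apply (continuous_mult (fun _ => height z) sin);
      [apply continuous_const|apply continuous_sin]. }
  pose proof (outer_log_path_continuous X Y t CX CY) as CL.
  assert (EP : forall s, signed_log (ellipse_point z s) =
    if Rlt_dec (Y s) 0 then - outer_log (X s, Y s) else outer_log (X s, Y s)) by reflexivity.
  destruct (Rtotal_order (Y t) 0) as [H|[H|H]].
  - apply (continuous_ext_loc _ (fun s => - outer_log (X s, Y s))).
    + generalize (CY (fun u => u < 0) (open_lt 0 _ H) : locally t (fun s => Y s < 0)). apply filter_imp. intros s Hs.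
      rewrite EP. destruct (Rlt_dec (Y s) 0); [reflexivity|contradiction].
    + now apply (continuous_opp (fun s => outer_log (X s, Y s))).
  - assert (E0 : outer_log (X t, Y t) = 0).
    { apply outer_log_segment. split; [|exact H].
      apply Rabs_le_between. apply (real_point_lt z (X t, Y t) Hz H).
      right. apply ellipse_point_form. }
    apply filterlim_locally. intros eps.
    pose proof (proj1 (filterlim_locally _ _) CL eps) as HL.
    revert HL. apply filter_imp. intros s Hs.
    rewrite !EP. rewrite E0 in *.
    replace (if Rlt_dec (Y t) 0 then - 0 else 0) with 0 by (destruct (Rlt_dec _ _); lra).
    destruct (Rlt_dec (Y s) 0); auto.
    apply ball_sym. apply ball_sym in Hs.
    change (Rabs (0 - - outer_log (X s, Y s)) < eps).
    change (Rabs (0 - outer_log (X s, Y s)) < eps) in Hs.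
    replace (0 - - outer_log (X s, Y s)) with (- (0 - outer_log (X s, Y s))) by ring.
    now rewrite Rabs_Ropp.
  - apply (continuous_ext_loc _ (fun s => outer_log (X s, Y s))); [|exact CL].
    generalize (CY (fun u => 0 < u) (open_gt 0 _ H) : locally t (fun s => 0 < Y s)). apply filter_imp. intros s Hs.
    rewrite EP. destruct (Rlt_dec (Y s) 0); [lra|reflexivity].
Qed.

(** The minimum is attained because the ellipse is the image of [[0, 2 pi]]; hence [epsilon] in
    [x_star] picks a genuine minimizer. *)
Lemma x_star_spec (z : parameters) : admissible z ->
  ellipse_form z (x_star z) = ellipse_level z /\
  alpha_above (b_star z) (x_star z) = signed_log (x_star z) /\
  forall y, ellipse_form z y = ellipse_level z ->
    alpha_above (b_star z) (x_star z) <= signed_log y.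
Proof.
  intros Hz. pose proof PI_RGT_0 as HPI.
  assert (HE : exists x, is_arg_min
       (translate (shift z) (boundary (bernstein (alpha_max z))))
       (alpha_above (b_star z)) x).
  { destruct (continuity_ab_min (fun t => signed_log (ellipse_point z t)) 0 (2 * PI))
      as (t0 & H1 & H2); [lra| |].
    - intros t _. apply continuity_pt_filterlim. now apply signed_log_ellipse_continuous.
    - exists (ellipse_point z t0). split.
      + apply ellipse_boundary_iff, ellipse_point_form; auto.
      + intros y Hy. apply ellipse_boundary_iff in Hy; auto.
        rewrite !alpha_above_b_star by auto using ellipse_point_form.
        destruct (ellipse_point_surjective z y Hz Hy) as (t & Ht & <-). now apply H1. }
  assert (HX : is_arg_min (translate (shift z) (boundary (bernstein (alpha_max z))))
       (alpha_above (b_star z)) (x_star z)) by (unfold x_star; now apply epsilon_spec).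
  destruct HX as [H1 H2]. apply ellipse_boundary_iff in H1; auto.
  split; [|split]; auto.
  - now apply alpha_above_b_star.
  - intros y Hy. rewrite <- (alpha_above_b_star z y) by auto.
    apply H2. now apply ellipse_boundary_iff.
Qed.

(** * Asymptotics of the classification *)

Lemma outer_log_ge (x : C) (a b : R) : Im x <> 0 -> 0 <= b -> sinh a <= b ->
  b * b * (b * b + 1 - Re x * Re x - Im x * Im x) <= Im x * Im x -> a <= outer_log x.
Proof.
  intros HI Hb Hab H.
  pose proof (joukowski_root_le x (psi x) a b (psi_root x) (psi_le_1 x) HI Hb Hab H) as HP.
  pose proof (psi_pos x). unfold outer_log.
  assert (ln (Cmod (psi x)) <= - a); [|lra].
  rewrite <- (ln_exp (- a)). destruct HP as [HP|HP]; [left; now apply ln_increasing|rewrite HP; lra].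
Qed.

Lemma sinh_ge (x : R) : 0 <= x -> x <= sinh x.
Proof.
  intros [Hx|<-]; [|rewrite sinh_0; lra].
  destruct (MVT_cor2 sinh cosh 0 x Hx) as [c [E Hc]].
  - intros; apply derivable_pt_lim_sinh.
  - rewrite sinh_0 in E. pose proof (cosh_ge_1 c). nra.
Qed.

Lemma outer_log_le (x : C) (r : R) : 0 < r ->
  Im x * Im x <= r * r * (r * r + 1 - Re x * Re x - Im x * Im x) -> outer_log x <= r.
Proof.
  intros Hr H. pose proof (outer_log_nonneg x) as HA.
  pose proof (sinh_ge _ HA) as HS.
  set (S := sinh (outer_log x)) in *.
  enough (S <= r) by lra. destruct (Rle_lt_dec S r) as [|Hlt]; auto. exfalso.
  set (s := S * S) in *. set (t := r * r) in *.
  assert (Hst : t < s) by (unfold s, t; nra).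
  assert (Ht : 0 <= t) by (unfold t; nra).
  set (X2 := Re x * Re x) in *. set (Y2 := Im x * Im x) in *.
  assert (HY : 0 <= Y2) by apply Rle_0_sqr.
  pose proof (outer_log_factor x t) as F. fold S s in F. cbv zeta in F. fold X2 Y2 in F.
  assert (H3 : 0 <= s * (t * (t + 1 - X2 - Y2) - Y2)) by (apply Rmult_le_pos; lra).
  rewrite F in H3.
  assert (0 < t) by (unfold t; nra). assert (0 < s * t + Y2) by nra. nra.
Qed.

(** Near the end 1 of the segment the ellipse parameter grows like the square root of the distance,
    which is of order [eta] here. *)
Lemma alpha_relaxation_bounds (z : parameters) (K : R) : 0 <= K ->
  0 < eta z <= 1 -> Rabs (omega z) <= 1 -> Rabs (omega z) <= K * eta z ->
  sqrt (/ (1 + 2 * K)) / 2 * sqrt (eta z) <= alpha_relaxation z <= 2 * sqrt (eta z).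
Proof.
  intros HK He Ho Hoe. unfold alpha_relaxation. rewrite alpha_segment.
  pose proof (Rabs_pos (omega z)) as Ho0. set (w := Rabs (omega z)) in *.
  set (h := eta z) in *.
  assert (Hs : sqrt h * sqrt h = h) by (apply sqrt_sqrt; lra).
  assert (Hs0 : 0 < sqrt h) by (apply sqrt_lt_R0; lra).
  (* The choice gives [k (k + 2 K) <= 1], which puts the point outside the ellipse of vertical
     semi-axis [sqrt (k * eta)]. *)
  set (k := / (1 + 2 * K)).
  assert (Hk : 0 < k <= 1).
  { unfold k; split; [apply Rinv_0_lt_compat; lra|].
    rewrite <- Rinv_1. apply Rinv_le_contravar; lra. }
  assert (HkK : k * (1 + 2 * K) = 1) by (unfold k; field; lra).
  assert (Hq : sqrt k * sqrt k = k) by (apply sqrt_sqrt; lra).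
  assert (Hq0 : 0 < sqrt k) by (apply sqrt_lt_R0; lra).
  set (q := sqrt k) in *. set (r := sqrt h) in *.
  split.
  - apply (outer_log_ge _ _ (q * r)); simpl.
    + lra.
    + nra.
    + replace (q * r) with (2 * (q / 2 * r)) by field. apply sinh_le_2x.
      assert (0 <= q * r <= 1) by nra. lra.
    + replace (q * r * (q * r)) with (k * h) by (rewrite <- Hq, <- Hs; ring).
      apply Rle_trans with (k * h * (k * h + 2 * (K * h))).
      * apply Rmult_le_compat_l; nra.
      * replace (k * h * (k * h + 2 * (K * h))) with (h * h * (k * (k + 2 * K))) by ring.
        assert (k * (k + 2 * K) <= 1) by nra. nra.
  - apply outer_log_le; simpl; [lra|].
    replace (2 * r * (2 * r)) with (4 * h) by (rewrite <- Hs; ring).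
    apply Rle_trans with (4 * h * (4 * h - h * h)); [nra|].
    apply Rmult_le_compat_l; nra.
Qed.

(** Above an interior point [e] of the segment the ellipse parameter is comparable to the height
    divided by [sqrt (1 - e^2)]; the numbers come from [2 <= pi <= 4]. *)
Lemma alpha_temperature_bounds (z : parameters) : -1 < EF z < 1 -> 4 <= beta z ->
  / beta z <= alpha_temperature z <= 4 / sqrt (1 - EF z * EF z) * / beta z.
Proof.
  intros HE Hb. unfold alpha_temperature. rewrite alpha_segment.
  set (e := EF z) in *. set (b := beta z) in *.
  pose proof PI_4 as P4. pose proof PI2_1 as P2.
  assert (Hi : 0 < / b <= / 4).
  { split; [apply Rinv_0_lt_compat; lra|apply Rinv_le_contravar; lra]. }
  set (i := / b) in *. unfold Rdiv at 1 2. fold i.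
  set (Y := PI * i). assert (HY : 2 * i <= Y <= 4 * i) by (unfold Y; nra).
  assert (Hee : 0 < 1 - e * e) by nra.
  split.
  - apply (outer_log_ge _ _ Y); simpl; try lra.
    + apply Rle_trans with (2 * i); [|lra]. apply sinh_le_2x; lra.
    + nra.
  - assert (Hs : sqrt (1 - e * e) * sqrt (1 - e * e) = 1 - e * e) by (apply sqrt_sqrt; lra).
    assert (Hs0 : 0 < sqrt (1 - e * e)) by (apply sqrt_lt_R0; lra).
    set (s := sqrt (1 - e * e)) in *.
    apply Rle_trans with (Y / s).
    + apply outer_log_le; simpl; [apply Rdiv_lt_0_compat; lra|].
      set (r := Y / s). assert (Hr : r * s = Y) by (unfold r; field; lra).
      replace (r * r + 1 - e * e - Y * Y) with (s * s + (r * r - Y * Y)) by lra.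
      nra.
    + replace (4 / s * i) with (4 * i / s) by (field; lra).
      apply Rmult_le_compat_r; [left; now apply Rinv_0_lt_compat|lra].
Qed.

(** Otherwise the ellipse has height at most [eta / 2]. Its shift by [i eta] then stays at imaginary
    part at least [eta / 2], where [outer_log] is at least [eta / 4]. *)
Lemma not_temperature_constrained (z : parameters) : admissible z -> eta z <= 1 ->
  ~ temperature_constrained z -> eta z / 4 < alpha_temperature z.
Proof.
  intros Hz He HT. apply Rnot_le_lt. intros HA. apply HT.
  pose proof Hz as (He0 & _ & Ha0). pose proof (height_pos z Hz) as HS.
  destruct (x_star_spec z Hz) as (HX & HV & _).
  unfold temperature_constrained. rewrite HV.
  assert (Ha : alpha_max z <= eta z / 4) by (eapply Rle_trans; [apply Rmin_r|exact HA]).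
  assert (HS2 : height z <= eta z / 2).
  { unfold height. pose proof (sinh_le_2x (alpha_max z) ltac:(lra)). lra. }
  set (x := x_star z) in *.
  rewrite ellipse_form_eq in HX. unfold ellipse_level in HX.
  set (S := height z) in *. set (y := Im x - eta z) in *.
  pose proof (Rle_0_sqr (Re x - omega z)) as HR. unfold Rsqr in HR.
  assert (Hy : y * y <= S * S).
  {
    nra. }
  assert (Hy2 : - S <= y) by nra.
  assert (HI : eta z / 2 <= Im x) by (unfold y in Hy2; lra).
  unfold signed_log. destruct (Rlt_dec (Im x) 0) as [HI0|_]; [lra|].
  eapply Rle_trans; [exact HA|].
  apply (outer_log_ge x _ (Im x)); try lra.
  - apply Rle_trans with (2 * (eta z / 4)); [|lra]. apply sinh_le_2x; lra.
  - pose proof (Rle_0_sqr (Re x)) as HR2. unfold Rsqr in HR2.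
    nra.
Qed.

Lemma temperature_constrained_le (z : parameters) : admissible z ->
  Rabs (omega z) <= / 2 -> eta z <= 1 -> 0 < alpha_temperature z ->
  temperature_constrained z -> alpha_temperature z <= 2 * eta z.
Proof.
  intros Hz Ho He HA HT.
  pose proof Hz as (He0 & _ & Ha0). pose proof (height_pos z Hz) as HS.
  destruct (x_star_spec z Hz) as (_ & _ & HM).
  unfold temperature_constrained in HT.
  (* The bottom of the ellipse. If it were below the real axis, the minimum would be nonpositive,
     contradicting [alpha_temperature z > 0]; so its height lies in [[0, eta]]. *)
  set (p := (omega z, eta z - height z) : C).
  assert (Hp : ellipse_form z p = ellipse_level z).
  { rewrite ellipse_form_eq. unfold ellipse_level, p. simpl. ring. }
  specialize (HM p Hp).
  unfold signed_log in HM. pose proof (outer_log_nonneg p) as H0.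
  destruct (Rlt_dec (Im p) 0) as [HI|HI]; [lra|].
  apply Rle_trans with (outer_log p); [lra|].
  apply outer_log_le; [lra|].
  unfold p in *. simpl in *. apply Rnot_lt_le in HI.
  set (y := eta z - height z) in *. assert (Hy : 0 <= y <= eta z) by (unfold y in *; lra).
  assert (Hoo : omega z * omega z <= / 4).
  { apply Rabs_le_between in Ho. nra. }
  apply Rle_trans with (2 * eta z * (2 * eta z) * (3 / 4)); [nra|].
  apply Rmult_le_compat_l; nra.
Qed.

(* The second bound keeps the contours away from the poles of the Fermi function, the
   last one from [E1 - E2 + omega + i eta = 0]. *)
Definition max_rate (z : parameters) : R :=
  Rmin (/ 4) (Rmin (/ (4 * beta z)) (eta z / (32 * sqrt (eta z + Rabs (omega z))))).

(** The bound [eta / 8] meets the hypothesis [8 * d <= eta]; halving [max_rate] leaves at least as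
    much for the antidiagonal rate. *)
Definition diag_rate (z : parameters) : R := Rmin (eta z / 8) (max_rate z / 2).

(** The value 0 is admissible in the mixed case, where only an upper bound is claimed. The
    conjunction settles parameters that satisfy both constraints; [low_temperature_regime] shows
    that none exist close to the limit. *)
Definition anti_rate (z : parameters) : R :=
  if excluded_middle_informative (relaxation_constrained z /\ ~ temperature_constrained z)
  then max_rate z - diag_rate z else 0.

Lemma max_rate_spec (z : parameters) : 0 < beta z -> 0 < eta z ->
  0 < max_rate z /\ forall T, 0 < T <= max_rate z ->
    T <= / 4 /\ 4 * T * beta z <= 1 /\
    1024 * (T * T) * (eta z + Rabs (omega z)) <= eta z * eta z.
Proof.
  intros Hb He. pose proof (Rabs_pos (omega z)) as Ho. unfold max_rate.
  set (w := eta z + Rabs (omega z)). assert (Hw : 0 < w) by (unfold w; lra).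
  assert (Hs : sqrt w * sqrt w = w) by (apply sqrt_sqrt; lra).
  assert (Hs0 : 0 < sqrt w) by now apply sqrt_lt_R0.
  set (m1 := / (4 * beta z)). set (m2 := eta z / (32 * sqrt w)).
  assert (H1 : 0 < m1) by (apply Rinv_0_lt_compat; lra).
  assert (H2 : 0 < m2) by (apply Rdiv_lt_0_compat; lra).
  pose proof (Rmin_l (/ 4) (Rmin m1 m2)) as L1. pose proof (Rmin_r (/ 4) (Rmin m1 m2)) as L2.
  pose proof (Rmin_l m1 m2) as L3. pose proof (Rmin_r m1 m2) as L4.
  split; [repeat apply Rmin_glb_lt; lra|].
  intros T HT. split; [lra|split].
  - assert (E : m1 * (4 * beta z) = 1) by (unfold m1; field; lra).
    assert (T * (4 * beta z) <= m1 * (4 * beta z)) by (apply Rmult_le_compat_r; lra). lra.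
  - assert (E : m2 * (32 * sqrt w) = eta z) by (unfold m2; field; lra).
    assert (E1 : T * (32 * sqrt w) <= eta z).
    { rewrite <- E. apply Rmult_le_compat_r; lra. }
    replace (1024 * (T * T) * w) with ((T * (32 * sqrt w)) * (T * (32 * sqrt w)))
      by (rewrite <- Hs at 3; ring).
    assert (0 <= T * (32 * sqrt w)) by (apply Rmult_le_pos; lra).
    apply Rmult_le_compat; lra.
Qed.

Lemma diag_rate_spec (z : parameters) : 0 < beta z -> 0 < eta z ->
  0 < diag_rate z /\ 8 * diag_rate z <= eta z /\ diag_rate z <= max_rate z / 2.
Proof.
  intros Hb He. destruct (max_rate_spec z Hb He) as [Hm _]. unfold diag_rate.
  pose proof (Rmin_l (eta z / 8) (max_rate z / 2)).
  pose proof (Rmin_r (eta z / 8) (max_rate z / 2)).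
  split; [apply Rmin_glb_lt; lra|lra].
Qed.

(** [k] and [G] come from the lower bound on [alpha_relaxation] and the upper bound on
    [alpha_temperature]; [J] compares [sqrt (eta + |omega|)] with [sqrt eta]. *)
Lemma low_temperature_regime (e K : R) : -1 < e < 1 ->
  exists k G J : R, 0 < k <= 1 /\ 0 < G /\ 1 <= J /\
  low_temperature_limit e K (fun z =>
    4 <= beta z /\ 0 < eta z <= 1 /\
    (relaxation_constrained z ->
       k * sqrt (eta z) <= G * / beta z /\ ~ temperature_constrained z) /\
    (~ relaxation_constrained z -> / beta z <= 2 * sqrt (eta z)) /\
    (~ temperature_constrained z -> eta z <= 4 * G * / beta z) /\
    (temperature_constrained z -> / beta z <= 2 * eta z) /\
    J * sqrt (eta z) <= 32 * J * J * (eta z / (32 * sqrt (eta z + Rabs (omega z)))) /\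
    eta z / (32 * sqrt (eta z + Rabs (omega z))) <= sqrt (eta z)).
Proof.
  intros He. set (K0 := Rmax K 0).
  assert (HK0 : 0 <= K0) by apply Rmax_r.
  set (k := sqrt (/ (1 + 2 * K0)) / 2). set (G := 4 / sqrt (1 - e * e)).
  set (J := sqrt (1 + K0)).
  assert (Hq0 : 0 < / (1 + 2 * K0)) by (apply Rinv_0_lt_compat; lra).
  assert (Hq1 : / (1 + 2 * K0) <= 1).
  { rewrite <- Rinv_1 at 2. apply Rinv_le_contravar; lra. }
  assert (Hk : 0 < k <= 1).
  { unfold k. pose proof (sqrt_lt_R0 _ Hq0). pose proof (sqrt_le_1 _ _ (Rlt_le _ _ Hq0) Rle_0_1 Hq1) as H1.
    rewrite sqrt_1 in H1. lra. }
  assert (HG : 0 < G) by (unfold G; apply Rdiv_lt_0_compat; [lra|apply sqrt_lt_R0; nra]).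
  assert (HJJ : J * J = 1 + K0) by (apply sqrt_sqrt; lra).
  assert (HJ : 1 <= J).
  { assert (0 <= J) by apply sqrt_pos. nra. }
  exists k, G, J. repeat split; try lra.
  (* The first radius forces [|omega| <= 1 / 4]. The second one makes both constraints incompatible:
     together they would give [k sqrt eta <= 2 eta], that is [k^2 <= 4 eta]. *)
  exists 4, (Rmin (/ (4 * (1 + K0))) (k * k / 8)).
  assert (Hkk : 0 < k * k / 8) by nra.
  assert (HKi : 0 < / (4 * (1 + K0)) <= / 4).
  { split; [apply Rinv_0_lt_compat; lra|apply Rinv_le_contravar; lra]. }
  split; [apply Rmin_glb_lt; lra|].
  intros z Hz Hb [Heta Hd] _ Ho.
  assert (Hd1 : eta z < / (4 * (1 + K0))) by (eapply Rlt_le_trans; [exact Hd|apply Rmin_l]).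
  assert (Hd2 : eta z < k * k / 8) by (eapply Rlt_le_trans; [exact Hd|apply Rmin_r]).
  assert (Ho1 : Rabs (omega z) <= K0 * eta z).
  { eapply Rle_trans; [exact Ho|]. apply Rmult_le_compat_r; [lra|apply Rmax_l]. }
  assert (Ho2 : Rabs (omega z) <= / 4).
  { apply (Rmult_lt_compat_l (4 * (1 + K0))) in Hd1; [|lra].
    rewrite Rinv_r in Hd1 by lra. nra. }
  pose proof (Rabs_pos (omega z)) as Ho0.
  assert (Hib : 0 < / beta z) by (apply Rinv_0_lt_compat; lra).
  destruct (alpha_relaxation_bounds z K0) as [R1 R2]; try lra.
  fold k in R1.
  destruct (alpha_temperature_bounds z) as [T1 T2]; try lra.
  rewrite Hz in T2. fold G in T2.
  set (h := eta z) in *.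
  assert (Hs : sqrt h * sqrt h = h) by (apply sqrt_sqrt; lra).
  assert (Hs0 : 0 < sqrt h) by (apply sqrt_lt_R0; lra).
  assert (Hadm : admissible z).
  { split; [auto|split; [lra|]]. unfold alpha_max. apply Rmin_glb_lt; nra. }
  assert (HT : temperature_constrained z -> alpha_temperature z <= 2 * h).
  { apply temperature_constrained_le; auto; fold h; lra. }
  split; [lra|]. split; [lra|].
  split; [|split; [|split; [|split; [|split]]]].
  - unfold relaxation_constrained. intros HR. split; [lra|].
    intros HTc. specialize (HT HTc).
    nra.
  - unfold relaxation_constrained. lra.
  - intros HN. pose proof (not_temperature_constrained z Hadm ltac:(fold h; lra) HN) as H.
    fold h in H. lra.
  - intros HTc. specialize (HT HTc). lra.
  - set (w := h + Rabs (omega z)).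
    assert (Hw : 0 < w <= (1 + K0) * h) by (unfold w; lra).
    assert (Hsw : 0 < sqrt w) by now apply sqrt_lt_R0.
    assert (Hsw2 : sqrt w <= J * sqrt h).
    { unfold J. rewrite <- sqrt_mult by lra. apply sqrt_le_1; lra. }
    replace (32 * J * J * (h / (32 * sqrt w))) with (J * J * (sqrt h * sqrt h) / sqrt w)
      by (rewrite Hs; field; lra).
    apply Rmult_le_reg_r with (sqrt w); auto. unfold Rdiv.
    rewrite (Rmult_assoc (J * J * _)), Rinv_l, Rmult_1_r by lra.
    apply Rle_trans with (J * sqrt h * (J * sqrt h)); [|lra].
    apply Rmult_le_compat_l; nra.
  - set (w := h + Rabs (omega z)).
    assert (Hsw : sqrt h <= sqrt w) by (apply sqrt_le_1; unfold w; lra).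
    apply Rmult_le_reg_r with (32 * sqrt w); [lra|].
    unfold Rdiv. rewrite Rmult_assoc, Rinv_l, Rmult_1_r by lra.
    rewrite <- Hs at 1. nra.
Qed.

Lemma quotient_between (x y m M : R) : 0 < y -> m * y <= x <= M * y -> m <= x / y <= M.
Proof.
  intros Hy H. assert (E : x / y * y = x) by (field; lra).
  split; apply Rmult_le_reg_r with y; lra.
Qed.

Lemma low_temperature_limit_imp (e K : R) (P Q : parameters -> Prop) :
  (forall z, P z -> Q z) -> low_temperature_limit e K P -> low_temperature_limit e K Q.
Proof.
  intros H (b0 & d & Hd & HP). exists b0, d. split; auto.
Qed.

Theorem theorem3p1 :
  exists alpha_diag alpha_anti : parameters -> R,
    (forall z : parameters, 0 < beta z -> 0 < eta z ->
       0 < alpha_diag z /\ 0 <= alpha_anti z /\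
       forall c : nat -> nat -> C, chebyshev_coefficients (F_cond z) c ->
       exists M : R, forall k1 k2 : nat,
         Cmod (c k1 k2) <=
           M * exp (- alpha_diag z * (INR k1 + INR k2)
                    - alpha_anti z * Rabs (INR k1 - INR k2))) /\
    (forall e K : R, -1 < e < 1 ->
       let L := low_temperature_limit e K in
       is_bigTheta
         (within (fun z => relaxation_constrained z \/ mixed_constrained z) L)
         alpha_diag eta /\
       is_bigTheta (within temperature_constrained L)
         alpha_diag (fun z => / beta z) /\
       is_bigTheta (within relaxation_constrained L)
         alpha_anti (fun z => sqrt (eta z)) /\
       is_bigO (within mixed_constrained L)
         alpha_anti (fun z => / beta z) /\
       within temperature_constrained L (fun z => alpha_anti z = 0) /\
       is_lesssim (within relaxation_constrained L)
         beta (fun z => / sqrt (eta z)) /\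
       is_lesssim (within mixed_constrained L)
         (fun z => / sqrt (eta z)) beta /\
       is_lesssim (within mixed_constrained L)
         beta (fun z => / eta z) /\
       is_lesssim (within temperature_constrained L)
         (fun z => / eta z) beta).
Proof.
  exists diag_rate, anti_rate. split.
  - intros z Hb He.
    destruct (max_rate_spec z Hb He) as [Hm HM].
    destruct (diag_rate_spec z Hb He) as (Hd & Hd8 & Hdm).
    split; [auto|]. unfold anti_rate.
    destruct (excluded_middle_informative _) as [_|_].
    + split; [lra|]. intros c Hc.
      destruct (HM (max_rate z)) as (M1 & M2 & M3); [lra|].
      apply (coefficient_decay z); auto; lra.
    + split; [lra|]. intros c Hc.
      (* Taking [T] equal to [diag_rate z] makes the antidiagonal rate [T - d] vanish. *)
      destruct (HM (diag_rate z)) as (M1 & M2 & M3); [lra|].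
      destruct (coefficient_decay z (diag_rate z) (diag_rate z) c) as [M H]; auto; try lra.
      exists M. intros k1 k2. specialize (H k1 k2).
      now replace (diag_rate z - diag_rate z) with 0 in H by ring.
  - intros e K He L.
    destruct (low_temperature_regime e K He) as (k & G & J & Hk & HG & HJ & HL).
    assert (HJJ : 0 < 32 * J * J) by nra.
    assert (Hrate : forall z lo, 4 <= beta z -> 0 < eta z <= 1 ->
      J * sqrt (eta z) <= 32 * J * J * (eta z / (32 * sqrt (eta z + Rabs (omega z)))) ->
      lo <= / 4 -> lo <= / beta z / 4 -> lo <= sqrt (eta z) / (32 * J) ->
      lo <= max_rate z).
    { intros z lo Hb Heta HJz H1 H2 H3. unfold max_rate. repeat apply Rmin_glb; auto.
      - rewrite Rinv_mult. lra.
      - eapply Rle_trans; [exact H3|]. set (m := eta z / _) in *.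
        apply Rmult_le_reg_l with (32 * J * J); auto.
        replace (32 * J * J * (sqrt (eta z) / (32 * J))) with (J * sqrt (eta z)) by (field; lra).
        auto. }
    assert (Hsq : forall z, 0 < eta z <= 1 ->
      0 < sqrt (eta z) <= 1 /\ sqrt (eta z) * sqrt (eta z) = eta z /\ eta z <= sqrt (eta z)).
    { intros z Hz. assert (Hs : sqrt (eta z) * sqrt (eta z) = eta z) by (apply sqrt_sqrt; lra).
      assert (Hs0 : 0 < sqrt (eta z)) by (apply sqrt_lt_R0; lra).
      assert (sqrt (eta z) <= 1) by nra. repeat split; auto. nra. }
    assert (HJ32 : 0 < / (32 * J) <= / 32).
    { split; [apply Rinv_0_lt_compat; lra|apply Rinv_le_contravar; lra]. }
    set (j := / (32 * J)) in *.
    split; [|split; [|split; [|split; [|split; [|split; [|split; [|split]]]]]]].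
    (* The two entries yield [q * eta <= 1 / (4 beta)] in the relaxation case, through
       [k sqrt eta <= G / beta], and in the mixed case, through [eta <= 4 G / beta]. *)
    + set (q := Rmin (k / (4 * G)) (/ (16 * G))).
      assert (Hq : 0 < q).
      { apply Rmin_glb_lt; [apply Rdiv_lt_0_compat; lra|apply Rinv_0_lt_compat; lra]. }
      set (m := Rmin j q).
      assert (Hm : 0 < m) by (apply Rmin_glb_lt; lra).
      exists (m / 2), (/ 8). split; [lra|]. unfold within.
      refine (low_temperature_limit_imp e K _ _ _ HL).
      intros z (Hb & Heta & HR & _ & HnT & _ & HJz & _) Hc.
      destruct (Hsq z Heta) as (Hs & Hs2 & Hs3).
      assert (Hqe : q * eta z <= / beta z / 4).
      { destruct Hc as [Hc|[_ Hc]].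
        - destruct (HR Hc) as [HR1 _]. assert (q <= k / (4 * G)) by apply Rmin_l.
          apply Rle_trans with (k / (4 * G) * sqrt (eta z)).
          + apply Rmult_le_compat; lra.
          + apply Rmult_le_reg_r with (4 * G); [lra|].
            replace (k / (4 * G) * sqrt (eta z) * (4 * G)) with (k * sqrt (eta z)) by (field; lra).
            lra.
        - specialize (HnT Hc). assert (q <= / (16 * G)) by apply Rmin_r.
          apply Rle_trans with (/ (16 * G) * eta z).
          + apply Rmult_le_compat_r; lra.
          + apply Rmult_le_reg_r with (16 * G); [lra|].
            replace (/ (16 * G) * eta z * (16 * G)) with (eta z) by (field; lra). lra. }
      assert (m <= j) by apply Rmin_l. assert (m <= q) by apply Rmin_r.
      assert (Hmr : m * eta z <= max_rate z).
      { apply Hrate; auto.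
        - nra.
        - nra.
        - unfold Rdiv. fold j. nra. }
      apply quotient_between; [lra|]. unfold diag_rate. split.
      * apply Rmin_glb; [nra|lra].
      * eapply Rle_trans; [apply Rmin_l|]. lra.
    (* Here [1 / beta <= 2 eta <= 2 sqrt eta], so half of [j] suffices against the third entry of
       [max_rate]. *)
    + set (m := j / 2).
      exists (m / 2), (/ 8). split; [unfold m; lra|]. unfold within.
      refine (low_temperature_limit_imp e K _ _ _ HL).
      intros z (Hb & Heta & _ & _ & _ & HT & HJz & _) Hc. specialize (HT Hc).
      destruct (Hsq z Heta) as (Hs & Hs2 & Hs3).
      assert (Hib : 0 < / beta z <= / 4).
      { split; [apply Rinv_0_lt_compat; lra|apply Rinv_le_contravar; lra]. }
      assert (Hmr : m * / beta z <= max_rate z).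
      { apply Hrate; auto; unfold m.
        - nra.
        - nra.
        - unfold Rdiv. fold j. nra. }
      apply quotient_between; [lra|]. unfold diag_rate. split.
      * apply Rmin_glb; [unfold m; nra|lra].
      * eapply Rle_trans; [apply Rmin_r|].
        assert (max_rate z <= / (4 * beta z)).
        { unfold max_rate. eapply Rle_trans; [apply Rmin_r|apply Rmin_l]. }
        rewrite Rinv_mult in H. lra.
    (* [max_rate] lies between [m sqrt eta] and [sqrt eta], and subtracting [diag_rate] loses at
       most half of it. *)
    + set (m := Rmin j (k / (4 * G))).
      assert (Hm : 0 < m) by (apply Rmin_glb_lt; [lra|apply Rdiv_lt_0_compat; lra]).
      exists (m / 2), 1. split; [lra|]. unfold within.
      refine (low_temperature_limit_imp e K _ _ _ HL).
      intros z (Hb & Heta & HR & _ & _ & _ & HJz & HU) Hc.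
      destruct (HR Hc) as [HR1 HR2].
      destruct (Hsq z Heta) as (Hs & Hs2 & Hs3).
      assert (m <= j) by apply Rmin_l. assert (Hmk : m <= k / (4 * G)) by apply Rmin_r.
      assert (Hmr : m * sqrt (eta z) <= max_rate z).
      { apply Hrate; auto.
        - nra.
        - apply Rle_trans with (k / (4 * G) * sqrt (eta z)).
          + apply Rmult_le_compat_r; lra.
          + apply Rmult_le_reg_r with (4 * G); [lra|].
            replace (k / (4 * G) * sqrt (eta z) * (4 * G)) with (k * sqrt (eta z)) by (field; lra).
            lra.
        - unfold Rdiv. fold j. nra. }
      destruct (diag_rate_spec z) as (D1 & _ & D3); try lra.
      assert (HU2 : max_rate z <= sqrt (eta z)).
      { eapply Rle_trans; [|exact HU]. unfold max_rate.
        eapply Rle_trans; [apply Rmin_r|apply Rmin_r]. }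
      unfold anti_rate. destruct (excluded_middle_informative _) as [_|C]; [|tauto].
      apply quotient_between; lra.
    + exists 0. unfold within. refine (low_temperature_limit_imp e K _ _ _ HL).
      intros z _ [Hc _]. unfold anti_rate.
      destruct (excluded_middle_informative _) as [C|_]; [tauto|].
      rewrite Rabs_R0. unfold Rdiv. lra.
    + unfold within. refine (low_temperature_limit_imp e K _ _ _ HL).
      intros z _ Hc. unfold anti_rate.
      destruct (excluded_middle_informative _) as [C|_]; [tauto|reflexivity].
    + exists (G / k). split; [apply Rdiv_lt_0_compat; lra|]. unfold within.
      refine (low_temperature_limit_imp e K _ _ _ HL).
      intros z (Hb & Heta & HR & _) Hc. destruct (HR Hc) as [HR1 _].
      destruct (Hsq z Heta) as (Hs & _).
      apply (Rmult_le_compat_r (beta z)) in HR1; [|lra].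
      rewrite (Rmult_assoc G), Rinv_l, Rmult_1_r in HR1 by lra.
      apply Rmult_le_reg_r with (k * sqrt (eta z)); [nra|].
      replace (G / k * / sqrt (eta z) * (k * sqrt (eta z))) with G by (field; lra). lra.
    + exists 2. split; [lra|]. unfold within.
      refine (low_temperature_limit_imp e K _ _ _ HL).
      intros z (Hb & Heta & _ & HR & _) [Hc _]. specialize (HR Hc).
      destruct (Hsq z Heta) as (Hs & _).
      apply (Rmult_le_compat_r (beta z)) in HR; [|lra]. rewrite Rinv_l in HR by lra.
      apply Rmult_le_reg_r with (sqrt (eta z)); [lra|]. rewrite Rinv_l by lra. lra.
    + exists (4 * G). split; [lra|]. unfold within.
      refine (low_temperature_limit_imp e K _ _ _ HL).
      intros z (Hb & Heta & _ & _ & HnT & _) [_ Hc]. specialize (HnT Hc).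
      apply (Rmult_le_compat_r (beta z)) in HnT; [|lra].
      rewrite (Rmult_assoc (4 * G)), Rinv_l, Rmult_1_r in HnT by lra.
      apply Rmult_le_reg_r with (eta z); [lra|].
      rewrite (Rmult_assoc (4 * G)), Rinv_l, Rmult_1_r by lra. lra.
    + exists 2. split; [lra|]. unfold within.
      refine (low_temperature_limit_imp e K _ _ _ HL).
      intros z (Hb & Heta & _ & _ & _ & HT & _) Hc. specialize (HT Hc).
      apply (Rmult_le_compat_r (beta z)) in HT; [|lra]. rewrite Rinv_l in HT by lra.
      apply Rmult_le_reg_r with (eta z); [lra|]. rewrite Rinv_l by lra. lra.
Qed.
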